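(* Let $d\ge 1$, $T>0$ and $0<H<\frac12$. Let $B^H$ be the $d$-dimensional fractional Brownian motion, $M$ the drift space and $(P_\theta)_{\theta\in M}$ the family of probability measures described in the context. If $\xi=(\xi^1,\dots,\xi^d)$ is an unbiased and adapted estimator of the drift, then for every $\theta\in M$ $$E_\theta\left[\int_0^T\|\xi_t-\theta_t\|^2\,dt\right]\ \ge\ \frac{T^{2H+1}}{2H+1}\,d ,$$ where the right-hand side is equal to the risk of $B^H$ itself, $E_\theta\left[\int_0^T\|B^H_t-\theta_t\|^2dt\right]$.
   Context: Setting. $B^H=(B^{H,1},\dots,B^{H,d})$ is a $d$-dimensional fractional Brownian motion on $[0,T]$ on a probability space $(\Omega,\mathcal F,P)$: its components are independent, centered Gaussian processes with covariance $E(B^{H,i}_sB^{H,i}_t)=\frac12(s^{2H}+t^{2H}-|t-s|^{2H})$. For each $i$, $(\mathcal F^i_t)_{t\in[0,T]}$ is the filtration generated by $B^{H,i}$. There is a $d$-dimensional standard Brownian motion $W$ under $P$ with $B^{H,i}_t=\int_0^tK_H(t,s)\,dW^i_s$, where for $H\le\frac12$ and $s<t$ $$K_H(t,s)=c_H(t-s)^{H-\frac12}+c_H\left(\tfrac12-H\right)\int_s^t(u-s)^{H-\frac32}\left(1-\left(\tfrac su\right)^{\frac12-H}\right)du,\qquad c_H=\sqrt{\frac{2H\,\Gamma(\frac32-H)}{\Gamma(H+\frac12)\Gamma(2-2H)}},$$ and $K_H(t,s)=0$ for $s\ge t$. The operator $(K_Hf)(t)=\int_0^tK_H(t,s)f(s)ds$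 is an isomorphism from $L^2([0,T])$ onto $I_{0^+}^{H+\frac12}(L^2([0,T]))$, with inverse $K_H^{-1}$; here $I_{0^+}^{\alpha}f(x)=\frac1{\Gamma(\alpha)}\int_0^x(x-y)^{\alpha-1}f(y)dy$ is the left Riemann–Liouville fractional integral. $M$ is the set of functions $\varphi=(\varphi^1,\dots,\varphi^d):[0,T]\to\mathbb R^d$ such that for each $i$, $\varphi^i_t=\int_0^t\dot\varphi^i_s\,ds$ with $\dot\varphi^i\in L^2([0,T])$, and $\varphi^i\in I_{0^+}^{H+\frac12}(L^2([0,T]))$. For $\theta\in M$, $P_\theta$ is the probability measure with density $$\frac{dP_\theta}{dP}=\exp\left[\sum_{i=1}^d\left(\int_0^TK_H^{-1}(\theta^i)(s)\,dW^i_s-\frac12\int_0^T(K_H^{-1}(\theta^i)(s))^2ds\right)\right].$$ Under $P_\theta$, the process $B^H_t-\theta_t$ is a (centered) $d$-dimensional fractional Brownian motion with Hurst parameter $H$ (Girsanov theorem). $E_\theta$ denotes expectation under $P_\theta$, and $\|\cdot\|$ is the Euclidean norm on $\mathbb R^d$. An estimator $\xi=(\xi^1,\dots,\xi^d)$ is a $\mathbb R^d$-valued process $(\xi_t)_{t\in[0,T]}$ not depending on $\theta$. It is unbiased if $E_\theta(\xi^i_t)=\theta^i_t$ for all $\theta\in M$, all $t\in[0,T]$ and all $i=1,\dots,d$; it is adapted if, for each $i$, $\xi^i$ is adapted to $(\mathcal F^i_t)_{t\in[0,T]}$. *)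

(* Defs.v *)
(* MathComp / MathComp-Analysis *)
From HB Require Import structures.
From mathcomp Require Import all_boot all_order all_algebra.
From mathcomp Require Import all_classical all_reals all_analysis.

Set Implicit Arguments.
Unset Strict Implicit.
Unset Printing Implicit Defensive.

Import Order.TTheory GRing.Theory Num.Theory.
Import numFieldNormedType.Exports.

Local Open Scope classical_set_scope.
Local Open Scope ring_scope.

(* Functions on [0, T] and processes indexed by [0, T] are total functions of
   a time parameter in R; only their values on [0, T] are ever constrained. *)

Section Deterministic.
Context {R : realType}.
Local Notation mu := (@lebesgue_measure R).

Definition Gamma (x : R) : R :=
  \int[mu]_(t in `]0, +oo[) (t `^ (x - 1) * expR (- t)).

Definition L2 (T : R) (f : R -> R) : Prop :=
  (f \_ `[0, T]) \in Lfun mu 2%:E.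

Definition RLint (alpha : R) (f : R -> R) (x : R) : R :=
  (Gamma alpha)^-1 * \int[mu]_(y in `[0, x]) ((x - y) `^ (alpha - 1) * f y).

Definition RLspace (alpha T : R) (phi : R -> R) : Prop :=
  exists2 f : R -> R, L2 T f &
    forall t, 0 <= t <= T -> phi t = RLint alpha f t.

Definition cH (H : R) : R :=
  Num.sqrt (2 * H * Gamma (3 / 2 - H) / (Gamma (H + 1 / 2) * Gamma (2 - 2 * H))).

(* Meant for 0 < s. At s = 0 the inner integral diverges and the value is
   junk, which is irrelevant for integrals in s. *)
Definition KH (H t s : R) : R :=
  if s < t then
    cH H * (t - s) `^ (H - 1 / 2) +
    cH H * (1 / 2 - H) *
      \int[mu]_(u in `[s, t])
        ((u - s) `^ (H - 3 / 2) * (1 - (s / u) `^ (1 / 2 - H)))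
  else 0.

Definition KHop (H : R) (f : R -> R) (t : R) : R :=
  \int[mu]_(s in `[0, t]) (KH H t s * f s).

(* [h] represents K_H^{-1} phi, as an element of L^2([0, T]). *)
Definition is_KHinv (H T : R) (phi h : R -> R) : Prop :=
  L2 T h /\ forall t, 0 <= t <= T -> KHop H h t = phi t.

Definition drift_space (d : nat) (H T : R) (phi : 'I_d -> R -> R) : Prop :=
  forall i,
    (exists2 dphi : R -> R, L2 T dphi &
       forall t, 0 <= t <= T -> phi i t = \int[mu]_(s in `[0, t]) dphi s) /\
    RLspace (H + 1 / 2) T (phi i).

(* A step function is coded by a list of triples (c, a, b), each standing for
   c times the indicator of ]a, b]. *)
Definition step_in (t : R) (s : seq (R * R * R)) : Prop :=
  forall c a b, (c, a, b) \in s -> 0 <= a /\ a <= b /\ b <= t.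

Definition step_fun (s : seq (R * R * R)) (x : R) : R :=
  \sum_(p <- s) let: (c, a, b) := p in c * \1_(`]a, b]%classic) x.

End Deterministic.

Section Stochastic.
Context {dsp : measure_display} {Omega : measurableType dsp} {R : realType}.
Local Notation mu := (@lebesgue_measure R).
Local Notation process := (R -> {mfun Omega >-> R}).

(* Point masses are Gaussian; they are treated apart because
   [normal_prob m 0] is not the Dirac mass at m. *)
Definition gaussian (P : probability Omega R) (X : Omega -> R) : Prop :=
  exists m sigma : R, forall U : set R, measurable U ->
    P (X @^-1` U) = if sigma == 0 then \d_m U else normal_prob m sigma U.

Definition gaussian_process (P : probability Omega R) (T : R)
    (X : process) : Prop :=
  forall (n : nat) (t a : 'I_n -> R), (forall k, 0 <= t k <= T) ->
    gaussian P (fun w => \sum_k a k * X (t k) w).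

(* sigma(X_s : 0 <= s <= t), with no completion *)
Definition natural_filtration (X : process) (t : R) : set (set Omega) :=
  <<s [set A | exists (s : R) (U : set R),
         [/\ 0 <= s <= t, measurable U & A = X s @^-1` U]] >>.

(* Since each sigma-algebra contains the whole space, the product rule over
   all indices gives it over every subfamily. *)
Definition independent_processes (P : probability Omega R) (T : R) (d : nat)
    (X : 'I_d -> process) : Prop :=
  forall A : 'I_d -> set Omega,
    (forall i, natural_filtration (X i) T (A i)) ->
    P (\bigcap_(i in [set: 'I_d]) A i) = (\prod_(i < d) P (A i))%E.

Definition measurable_process (T : R) (X : process) : Prop :=
  measurable_fun (`[0, T]%classic `*` [set: Omega])
    (fun p : measurableTypeR R * Omega => X p.1 p.2).

Definition is_fbm (P : probability Omega R) (T H : R) (d : nat)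
    (B : 'I_d -> process) : Prop :=
  [/\ independent_processes P T B,
      forall i, gaussian_process P T (B i),
      forall i (t : R), 0 <= t <= T -> ('E_P[B i t] = 0)%E
    & forall i (s t : R), 0 <= s <= T -> 0 <= t <= T ->
        'E_P[(fun w => B i s w * B i t w)%R]%E =
        (2^-1 * (s `^ (2 * H) + t `^ (2 * H) - `|t - s| `^ (2 * H)))%:E].

Definition is_bm1 (P : probability Omega R) (T : R) (W : process) : Prop :=
  [/\ {ae P, forall w, W 0 w = 0},
      {ae P, forall w, {within `[0, T], continuous (fun t : R => W t w)}},
      forall s t : R, 0 <= s -> s < t -> t <= T ->
        forall U : set R, measurable U ->
        P ((fun w => W t w - W s w) @^-1` U) =
        normal_prob 0 (Num.sqrt (t - s)) U
    & forall s t : R, 0 <= s -> s < t -> t <= T ->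
        forall (A : set Omega) (U : set R),
        natural_filtration W s A -> measurable U ->
        P (A `&` (fun w => W t w - W s w) @^-1` U) =
        (P A * P ((fun w => W t w - W s w)%R @^-1` U))%E].

Definition is_bm (P : probability Omega R) (T : R) (d : nat)
    (W : 'I_d -> process) : Prop :=
  independent_processes P T W /\ forall i, is_bm1 P T (W i).

Definition step_integral (W : process) (s : seq (R * R * R)) (w : Omega) : R :=
  \sum_(p <- s) let: (c, a, b) := p in c * (W b w - W a w).

(* [I] is a version of the Wiener integral of f against W over [0, t], i.e.
   the L^2(P)-limit of the elementary integrals of step functions that
   converge to f in L^2([0, t]). *)
Definition is_wiener_integral (P : probability Omega R) (t : R) (W : process)
    (f : R -> R) (I : {mfun Omega >-> R}) : Prop :=
  L2 t f /\
  exists s : nat -> seq (R * R * R),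
    [/\ forall n, step_in t (s n),
        (\int[mu]_(x in `[0%R, t]) ((f x - step_fun (s n) x) ^+ 2)%:E)%E
          @[n --> \oo] --> 0%E
      & (\int[P]_w ((I w - step_integral W (s n) w) ^+ 2)%:E)%E
          @[n --> \oo] --> 0%E].

(* [Q] has, with respect to P, the density
   exp (sum_i (int_0^T h_i dW^i - 1/2 int_0^T h_i^2)), h_i = K_H^{-1} theta_i *)
Definition is_drift_law (P : probability Omega R) (T H : R) (d : nat)
    (W : 'I_d -> process) (theta : 'I_d -> R -> R)
    (Q : probability Omega R) : Prop :=
  exists (h : 'I_d -> R -> R) (I : 'I_d -> {mfun Omega >-> R}),
    [/\ forall i, is_KHinv H T (theta i) (h i),
        forall i, is_wiener_integral P T (W i) (h i) (I i)
      & forall A : set Omega, measurable A ->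
          Q A = (\int[P]_(w in A)
            (expR (\sum_(i < d) (I i w -
               2^-1 * \int[mu]_(s in `[0%R, T]) (h i s ^+ 2))))%:E)%E].

Definition unbiased (T H : R) (d : nat)
    (Pth : ('I_d -> R -> R) -> probability Omega R)
    (xi : 'I_d -> process) : Prop :=
  forall theta, drift_space H T theta ->
    forall t i, 0 <= t <= T -> 'E_(Pth theta)[xi i t]%E = (theta i t)%:E.

Definition adapted (T : R) (d : nat) (B xi : 'I_d -> process) : Prop :=
  forall i t, 0 <= t <= T -> forall U : set R, measurable U ->
    natural_filtration (B i) t (xi i t @^-1` U).

Definition risk (Q : probability Omega R) (T : R) (d : nat)
    (xi : 'I_d -> process) (theta : 'I_d -> R -> R) : \bar R :=
  (\int[Q]_w \int[mu]_(t in `[0%R, T])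
     (\sum_(i < d) (xi i t w - theta i t) ^+ 2)%:E)%E.

End Stochastic.

(* Main.v *)
(* Let a scalar function phi = K_H h be such that theta + c phi e_i lies in M.
   Since K_H is injective, K_H^{-1} (theta + c phi e_i) = K_H^{-1} theta + c h e_i,
   and the Wiener isometry shows that P_(theta + c phi e_i) has density
   exp (c Z - c^2 V / 2) with respect to P_theta, where V = int h^2. Unbiasedness
   under both laws and Young's inequality, with c tending to 0 (Chapman-Robbins),
   give E_theta (xi^i_t - theta^i_t)^2 >= 2 phi_t - V. For h = K_H(t, .) the right
   side would be t^(2H), but the corresponding phi need not be in M; one
   approximates it by phi's with bounded derivative. Adaptedness plays no role.

   Injectivity of K_H: with a = 1/2 - H, the kernel satisfies
     t^a K_H(t, s) = c_H s^a (t - s)^(-a) + a int_s^t u^(a-1) K_H(u, s) du,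
   so K_H g = 0 yields Abel's equation int_0^t (t - s)^(-a) s^a g(s) ds = 0.

   For B itself, the same approximation yields
   E_theta exp (c (B^i_t - theta^i_t)) <= exp (c^2 t^(2H) / 2), hence B is unbiased
   with variance at most t^(2H), and the lower bound makes this an equality. *)

Require Import Defs.
From HB Require Import structures.
From mathcomp Require Import all_boot all_order all_algebra.
From mathcomp Require Import all_classical all_reals all_analysis.
From mathcomp Require Import measurable_realfun ring lra.

Set Implicit Arguments.
Unset Strict Implicit.
Unset Printing Implicit Defensive.

Import Order.TTheory GRing.Theory Num.Theory.
Import numFieldNormedType.Exports.

Local Open Scope classical_set_scope.
Local Open Scope ring_scope.

(** * Square-integrable functions *)

(** The data come only through predicates: each [P_theta] is given with some [h] and some Wiener
    integrals, a priori unrelated for different [theta], and no integral is supplied for a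
    prescribed integrand. Injectivity of the kernel ties the laws together: it forces the [h]
    attached to [theta + c phi e_i] to be affine in [c] almost everywhere, and the integral of the
    direction is the difference of two given ones. No Gaussian exponential moment is computed. That
    [P_(theta + c phi e_i)] has mass 1 for every real [c] is exactly the moment generating function
    of [Z], and it also yields the second moment of the density. Nor is the kernel integrated
    against itself. Square integrability and covariance of the [K_H(t, .)], and [c_H != 0], are read
    off the law of [B] through the isometry; the explicit formula serves for the Volterra relation.
    One obstacle remains: the isometry controls [L^2] distances, whereas densities are exponentials;
    hence the truncation in the bound for [B]. *)

Notation plane R := (measurableTypeR R * measurableTypeR R)%type.

Section SquareIntegrable.
Context {d : measure_display} {X : measurableType d} {R : realType}.
Variables (m : {measure set X -> \bar R}) (D : set X).
Hypothesis mD : measurable D.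

(** Genuine functions, measurable on [D] only, rather than classes. The same calculus then serves
    [[0, T]] with Lebesgue measure and [Omega] with a probability, the two sides of the Wiener
    isometry. *)
Definition sqint (f : X -> R) : Prop :=
  measurable_fun D f /\ (\int[m]_(x in D) ((f x) ^+ 2)%:E < +oo)%E.

Definition dotp (f g : X -> R) : R := \int[m]_(x in D) (f x * g x).

Lemma sqint_integrable_sqr f : sqint f ->
  m.-integrable D (fun x => ((f x) ^+ 2)%:E).
Proof.
move=> [mf ff]; apply/integrableP; split.
  by apply/measurable_EFinP; exact: measurable_funX.
suff -> : (\int[m]_(x in D) `|((f x) ^+ 2)%:E| =
  \int[m]_(x in D) ((f x) ^+ 2)%:E)%E by [].
by apply: eq_integral => x _; rewrite gee0_abs// lee_fin sqr_ge0.
Qed.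

Lemma sqint_mul f g : sqint f -> sqint g ->
  m.-integrable D (fun x => (f x * g x)%:E).
Proof.
move=> sf sg.
have := integrableD mD (sqint_integrable_sqr sf) (sqint_integrable_sqr sg).
apply: le_integrable => //.
  by apply/measurable_EFinP; apply: measurable_funM; [case: sf|case: sg].
move=> x _ /=; rewrite lee_fin [leRHS]ger0_norm ?addr_ge0 ?sqr_ge0//.
have := sqr_ge0 (f x - g x); have := sqr_ge0 (f x + g x).
have := sqr_ge0 (f x); have := sqr_ge0 (g x).
by rewrite ler_norml; nra.
Qed.

Lemma eq_sqint f g : {in D, f =1 g} -> sqint f -> sqint g.
Proof.
move=> fg [mf ff]; split; first exact: eq_measurable_fun mf.
apply: le_lt_trans ff; rewrite le_eqVlt; apply/orP; left; apply/eqP.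
by apply: eq_integral => x xD; rewrite fg.
Qed.

Lemma sqintZ (k : R) f : sqint f -> sqint (fun x => k * f x).
Proof.
move=> sf; split; first by apply: measurable_funM => //; case: sf.
have /integrable_lty := integrableZl mD (k ^+ 2) (sqint_integrable_sqr sf).
move=> /(_ mD); apply: le_lt_trans.
rewrite le_eqVlt; apply/orP; left; apply/eqP.
by apply: eq_integral => x _; rewrite -EFinM exprMn.
Qed.

Lemma sqintD f g : sqint f -> sqint g -> sqint (fun x => f x + g x).
Proof.
move=> sf sg; have [mf _] := sf; have [mg _] := sg.
split; first exact: measurable_funD.
have h1 := integrableD mD (sqint_integrable_sqr sf) (sqint_integrable_sqr sg).
have h2 := integrableZl mD 2 (sqint_mul sf sg).
have /integrable_lty := integrableD mD h1 h2.
move=> /(_ mD); apply: le_lt_trans.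
rewrite le_eqVlt; apply/orP; left; apply/eqP; apply: eq_integral => x _ /=.
by rewrite -!EFinM -!EFinD; congr EFin; ring.
Qed.

Lemma sqintB f g : sqint f -> sqint g -> sqint (fun x => f x - g x).
Proof.
move=> sf sg; have := sqintD sf (sqintZ (-1) sg).
by apply: eq_sqint => x _; rewrite mulN1r.
Qed.

Lemma sqint0 : sqint (fun=> 0).
Proof.
split; first exact: measurable_cst.
by rewrite integral0_eq ?ltry// => x _; rewrite expr0n.
Qed.

Lemma sqint_cst (c : R) : (m D < +oo)%E -> sqint (cst c).
Proof.
move=> mDoo; split; first exact: measurable_cst.
have -> : (\int[m]_(x in D) ((cst c x) ^+ 2)%:E = (c ^+ 2)%:E * m D)%E.
  by rewrite -integral_cst.
by rewrite lte_mul_pinfty// lee_fin sqr_ge0.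
Qed.

Lemma sqint_lincomb2 a b f g : sqint f -> sqint g ->
  sqint (fun x => a * f x + b * g x).
Proof. by move=> sf sg; apply: sqintD; exact: sqintZ. Qed.

Lemma dotpC f g : dotp f g = dotp g f.
Proof. by apply: eq_Rintegral => x _; rewrite mulrC. Qed.

Lemma dotp0l f : dotp (fun=> 0) f = 0.
Proof.
rewrite /dotp; under eq_Rintegral do rewrite mul0r.
by rewrite Rintegral_cst// mul0r.
Qed.

Lemma dotpDl f g h : sqint f -> sqint g -> sqint h ->
  dotp (fun x => f x + g x) h = dotp f h + dotp g h.
Proof.
move=> sf sg sh; rewrite /dotp -RintegralD//; [|exact: sqint_mul..].
by apply: eq_Rintegral => x _; rewrite mulrDl.
Qed.

Lemma dotpZl k f g : sqint f -> sqint g ->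
  dotp (fun x => k * f x) g = k * dotp f g.
Proof.
move=> sf sg; rewrite /dotp -RintegralZl//; last exact: sqint_mul.
by apply: eq_Rintegral => x _; rewrite mulrA.
Qed.

Lemma dotpBl f g h : sqint f -> sqint g -> sqint h ->
  dotp (fun x => f x - g x) h = dotp f h - dotp g h.
Proof.
move=> sf sg sh; rewrite /dotp -RintegralB//; [|exact: sqint_mul..].
by apply: eq_Rintegral => x _; rewrite mulrBl.
Qed.

Lemma dotpDr f g h : sqint f -> sqint g -> sqint h ->
  dotp h (fun x => f x + g x) = dotp h f + dotp h g.
Proof. by move=> sf sg sh; rewrite dotpC dotpDl// !(dotpC h). Qed.

Lemma dotpZr k f g : sqint f -> sqint g ->
  dotp g (fun x => k * f x) = k * dotp g f.
Proof. by move=> sf sg; rewrite dotpC dotpZl// (dotpC g). Qed.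

Lemma dotpBr f g h : sqint f -> sqint g -> sqint h ->
  dotp h (fun x => f x - g x) = dotp h f - dotp h g.
Proof. by move=> sf sg sh; rewrite dotpC dotpBl// !(dotpC h). Qed.

Lemma dotp_ge0 f : 0 <= dotp f f.
Proof. by apply: Rintegral_ge0 => x _; rewrite -expr2 sqr_ge0. Qed.

Lemma dotpEFin f : sqint f ->
  (\int[m]_(x in D) ((f x) ^+ 2)%:E)%E = (dotp f f)%:E.
Proof.
move=> sf; rewrite /dotp /Rintegral fineK//; last first.
  by have := integrable_fin_num mD (sqint_mul sf sf).
Qed.

Lemma dotp_ub (k : R) (f : X -> R) : measurable_fun D f ->
  (\int[m]_(x in D) ((f x) ^+ 2)%:E <= k%:E)%E -> sqint f /\ dotp f f <= k.
Proof.
move=> mf fk; have sf : sqint f by split=> //; apply: le_lt_trans fk (ltry _).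
by split=> //; rewrite -lee_fin -dotpEFin.
Qed.

Lemma ae_eq_dotp f f' g g' : sqint f -> sqint f' -> sqint g -> sqint g' ->
  {ae m, forall x, D x -> f x = f' x} ->
  {ae m, forall x, D x -> g x = g' x} -> dotp f g = dotp f' g'.
Proof.
move=> sf sf' sg sg' ff' gg'; rewrite /dotp /Rintegral; congr fine.
apply: ae_eq_integral => //.
- exact: measurable_int (sqint_mul sf sg).
- exact: measurable_int (sqint_mul sf' sg').
- by move: gg'; apply: filterS2 ff' => x fx gx Dx; rewrite fx ?gx.
Qed.

Lemma dotp_eq0 f : sqint f -> dotp f f = 0 ->
  {ae m, forall x, D x -> f x = 0}.
Proof.
move=> sf f0; have := dotpEFin sf; rewrite f0 => h.
have := (ae_eq_integral_abs m mD (measurable_int m (sqint_integrable_sqr sf))).1.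
have e : (\int[m]_(x in D) `|((f x) ^+ 2)%:E| = 0)%E.
  rewrite [RHS](_ : _ = \int[m]_(x in D) ((f x) ^+ 2)%:E)%E; last by rewrite h.
  by apply: eq_integral => x _; rewrite gee0_abs// lee_fin sqr_ge0.
move=> /(_ e); apply: filterS => x fx Dx; apply/eqP.
by move: (fx Dx) => /= [] /eqP; rewrite sqrf_eq0.
Qed.

(** The square norm of [a f + g] is nonnegative at [a = k] and at [a = - k]; divide by [k]. The free
    weight [k] takes the place of Cauchy-Schwarz and is tuned at each use. *)
Lemma dotp_young (k : R) f g : 0 < k -> sqint f -> sqint g ->
  2 * `|dotp f g| <= k * dotp f f + k^-1 * dotp g g.
Proof.
move=> k0 sf sg.
have [sk kk0] : 0 <= k^-1 /\ k * k^-1 = 1 by rewrite invr_ge0 ltW// mulfV// gt_eqF.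
have sfk a : sqint (fun x => a * f x) by exact: sqintZ.
have H a : 0 <= a ^+ 2 * dotp f f + 2 * a * dotp f g + dotp g g.
  have -> : a ^+ 2 * dotp f f + 2 * a * dotp f g + dotp g g =
    dotp (fun x => a * f x + g x) (fun x => a * f x + g x).
    rewrite dotpDl//; last exact: sqintD.
    rewrite !dotpDr// !dotpZl// !dotpZr// (dotpC g).
    by ring.
  exact: dotp_ge0.
have H1 := H k; have H2 := H (- k).
suff : 2 * k * `|dotp f g| <= k ^+ 2 * dotp f f + dotp g g.
  move=> /(ler_wpM2l sk); congr (_ <= _).
    by rewrite -[in RHS](mul1r `|_|) -kk0; ring.
  by rewrite mulrDr; congr (_ + _); rewrite -[in RHS](mul1r (dotp f f)) -kk0; ring.
case: (ger0P (dotp f g)) => _; nra.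
Qed.

Lemma dotp_cvg0 (f : X -> R) (g : nat -> X -> R) : sqint f ->
  (forall n, sqint (g n)) -> dotp (g n) (g n) @[n --> \oo] --> (0 : R) ->
  dotp f (g n) @[n --> \oo] --> (0 : R).
Proof.
move=> sf sg g0; apply/cvgrPdist_lt => e e0.
have F0 := dotp_ge0 f.
(* This weight keeps the [f] term at most [e]; the added 1 covers a null norm. *)
pose k := e / (dotp f f + 1).
have k0 : 0 < k by rewrite divr_gt0// ltr_wpDl.
have ke0 : 0 < k * e by rewrite mulr_gt0.
near=> n; rewrite sub0r normrN.
have := dotp_young k0 sf (sg n).
have gn : dotp (g n) (g n) < k * e.
  rewrite -[ltLHS]ger0_norm ?dotp_ge0// -normrN -sub0r.
  by near: n; move/cvgrPdist_lt : g0; exact.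
have ke : k * dotp f f <= e.
  rewrite /k mulrAC ler_pdivrMr ?ltr_wpDl//.
  by rewrite ler_wpM2l ?ltW// ltrDl.
have : k^-1 * dotp (g n) (g n) < e.
  by rewrite mulrC ltr_pdivrMr// mulrC.
by lra.
Unshelve. all: by end_near. Qed.

Lemma dotp_cvg (f : X -> R) (g : nat -> X -> R) : sqint f ->
  (forall n, sqint (g n)) ->
  dotp (fun x => f x - g n x) (fun x => f x - g n x) @[n --> \oo] --> (0 : R) ->
  dotp (g n) (g n) @[n --> \oo] --> dotp f f.
Proof.
move=> sf sg h0.
have sfg n : sqint (fun x => f x - g n x) by exact: sqintB.
have h1 := dotp_cvg0 sf sfg h0.
have -> : (fun n => dotp (g n) (g n)) = fun n => dotp f f -
  2 * dotp f (fun x => f x - g n x) + dotp (fun x => f x - g n x) (fun x => f x - g n x).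
  apply/funext => n; rewrite dotpBr// !dotpBl// !dotpBr// (dotpC (g n) f).
  by ring.
rewrite -[X in _ --> X]addr0 -[X in _ --> X + _]subr0; apply: cvgD => //.
apply: cvgB; first exact: cvg_cst.
by rewrite -[X in _ --> X](mulr0 2); apply: cvgM => //; exact: cvg_cst.
Qed.

Lemma dotp_cvg0P (f : nat -> X -> R) : (forall n, sqint (f n)) ->
  (\int[m]_(x in D) ((f n x) ^+ 2)%:E)%E @[n --> \oo] --> 0%E ->
  dotp (f n) (f n) @[n --> \oo] --> (0 : R).
Proof.
move=> sf; rewrite (_ : (fun n => _) = (fun n => (dotp (f n) (f n))%:E)).
  by move/fine_cvg.
by apply/funext => n; rewrite dotpEFin.
Qed.

Lemma sqint_le (f g : X -> R) :
  measurable_fun D f -> sqint g -> (forall x, D x -> `|f x| <= `|g x|) ->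
  sqint f.
Proof.
move=> mf [mg gg] fg; split => //; apply: le_lt_trans gg.
apply: ge0_le_integral => //.
- by move=> x _; rewrite lee_fin sqr_ge0.
- by apply/measurable_EFinP; exact: measurable_funX.
- by apply/measurable_EFinP; exact: measurable_funX.
- move=> x Dx; rewrite lee_fin -(real_normK (num_real (f x))) -(real_normK (num_real (g x))).
  by rewrite lerXn2r ?nnegrE ?normr_ge0// fg.
Qed.

Lemma sqint_norm (f : X -> R) :
  sqint f -> sqint (fun x => `|f x|).
Proof.
move=> sf; have [mf _] := sf.
apply: (sqint_le _ sf); last by move=> x _; rewrite normr_id.
exact: (measurableT_comp (@normr_measurable _ _) mf).
Qed.

Lemma dotp_norm (f : X -> R) :
  dotp (fun s => `|f s|) (fun s => `|f s|) = dotp f f.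
Proof. by apply: eq_Rintegral => s _; rewrite -expr2 real_normK ?num_real. Qed.

(** Young's inequality with weight 1. An explicit bound and not mere finiteness, since the
    domination in Fubini arguments integrates it again in a second variable. *)
Lemma integral_norm_mul_le (f g : X -> R) :
  sqint f -> sqint g ->
  (\int[m]_(x in D) `|f x * g x|%:E <= (2^-1 * (dotp f f + dotp g g))%:E)%E.
Proof.
move=> sf sg; have s1 := sqint_norm sf; have s2 := sqint_norm sg.
have := dotp_young (k := 1) ltr01 s1 s2.
rewrite ger0_norm; last by apply: Rintegral_ge0 => s _; rewrite mulr_ge0.
rewrite invr1 !mul1r !dotp_norm => Y.
have -> : (\int[m]_(s in D) `|f s * g s|%:E)%E =
    (dotp (fun s => `|f s|) (fun s => `|g s|))%:E.
  rewrite /dotp /Rintegral fineK; last first.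
    by apply: integrable_fin_num => //; exact: sqint_mul.
  by apply: eq_integral => s _; rewrite normrM.
by rewrite lee_fin; lra.
Qed.

Lemma dotpBB (f g h k : X -> R) :
  sqint f -> sqint g -> sqint h -> sqint k ->
  dotp (fun x => f x - g x) (fun x => h x - k x) =
  dotp f h - dotp f k - dotp g h + dotp g k.
Proof.
move=> sf sg sh sk; have shk := sqintB sh sk.
by rewrite dotpBl// !dotpBr//; ring.
Qed.

Lemma dotp_lincomb2 (k l : R) (f g : X -> R) :
  sqint f -> sqint g ->
  dotp (fun x => k * f x + l * g x) (fun x => k * f x + l * g x) =
  k ^+ 2 * dotp f f + 2 * k * l * dotp f g + l ^+ 2 * dotp g g.
Proof.
move=> sf sg; have skf := sqintZ k sf; have slg := sqintZ l sg.
rewrite dotpDl//; last exact: sqintD.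
rewrite !dotpDr// !dotpZl// !dotpZr// (dotpC g f); ring.
Qed.

Lemma sqint_integrable f : (m D < +oo)%E -> sqint f -> m.-integrable D (EFin \o f).
Proof.
move=> mDoo sf; have := sqint_mul sf (sqint_cst 1 mDoo); congr (integrable _ _ _).
by apply/funext => x /=; rewrite mulr1.
Qed.

End SquareIntegrable.

Lemma sqint_sub d (X : measurableType d) (R : realType) (m : {measure set X -> \bar R})
    (D E : set X) (f : X -> R) : measurable D -> measurable E -> E `<=` D ->
  sqint m D f -> sqint m E f.
Proof.
move=> mD mE ED [mf ff]; split; first exact: measurable_funS mf.
apply: le_lt_trans ff; apply: ge0_subset_integral => //.
  by apply/measurable_EFinP; exact: measurable_funX.
by move=> x _; rewrite lee_fin sqr_ge0.
Qed.

Lemma lebesgue_measure_itvcc_lty (R : realType) (a b : R) :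
  (@lebesgue_measure R `[a, b]%classic < +oo)%E.
Proof. by rewrite lebesgue_measure_itv/=; case: ifP; rewrite -?EFinB ltry. Qed.

(** * Iterated integrals *)

Section IteratedIntegrals.
Context {d1 d2 : measure_display} {X1 : measurableType d1}
  {X2 : measurableType d2} {R : realType}.
Variables (m1 : {sigma_finite_measure set X1 -> \bar R})
  (m2 : {sigma_finite_measure set X2 -> \bar R}).

Lemma measurable_integral_param (f : X1 -> X2 -> \bar R) :
  measurable_fun setT (fun p => f p.1 p.2) ->
  measurable_fun setT (fun x => \int[m2]_y f x y)%E.
Proof.
move=> mf.
have -> : (fun x => \int[m2]_y f x y)%E =
    ((fun x => \int[m2]_y ((fun p => f p.1 p.2)^\+ (x, y))) \-
     (fun x => \int[m2]_y ((fun p => f p.1 p.2)^\- (x, y))))%E.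
  apply/funext => x; rewrite [LHS]integralE; congr (_ - _)%E;
    by apply: eq_integral => y _; rewrite ?funeposE ?funenegE.
apply: emeasurable_funB.
- apply: (measurable_fun_fubini_tonelli_F (m2 := m2) (fun p => f p.1 p.2)^\+%E) => //.
  exact: measurable_funepos.
- apply: (measurable_fun_fubini_tonelli_F (m2 := m2) (fun p => f p.1 p.2)^\-%E) => //.
  exact: measurable_funeneg.
Qed.

Lemma measurable_Rintegral_param (f : X1 -> X2 -> R) :
  measurable_fun setT (fun p => f p.1 p.2) ->
  measurable_fun setT (fun x => \int[m2]_y f x y)%R.
Proof.
move=> mf; apply: (measurableT_comp (f := fine)) => //.
by apply: measurable_integral_param; exact/measurable_EFinP.
Qed.

Lemma tonelli_on (S : set (X1 * X2)) (f : X1 -> X2 -> \bar R) :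
  measurable S -> measurable_fun S (fun p => f p.1 p.2) ->
  (forall x y, S (x, y) -> 0 <= f x y)%E ->
  (\int[m1]_x \int[m2]_(y in xsection S x) f x y =
   \int[m2]_y \int[m1]_(x in ysection S y) f x y)%E.
Proof.
move=> mS mf f0.
pose g := (fun p => f p.1 p.2) \_ S.
have mg : measurable_fun setT g by apply/(measurable_restrictT _ mS).
have g0 p : (0 <= g p)%E.
  by rewrite /g patchE; case: ifPn => // /set_mem; case: p => x y; exact: f0.
have := fubini_tonelli (m1 := m1) (m2 := m2) g mg g0.
rewrite (_ : (\int[m1]_x _)%E =
  (\int[m1]_x \int[m2]_(y in xsection S x) f x y)%E); last first.
  apply: eq_integral => x _.
  rewrite [RHS]integral_mkcond; apply: eq_integral => y _.
  by rewrite /g !patchE mem_xsection.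
move=> ->; apply: eq_integral => y _.
rewrite [RHS]integral_mkcond; apply: eq_integral => x _.
by rewrite /g !patchE mem_ysection.
Qed.

Lemma fubini_on (S : set (X1 * X2)) (f : X1 -> X2 -> R) :
  measurable S -> measurable_fun S (fun p => f p.1 p.2) ->
  (\int[m1]_x \int[m2]_(y in xsection S x) `|f x y|%:E < +oo)%E ->
  \int[m1]_x \int[m2]_(y in xsection S x) f x y =
   \int[m2]_y \int[m1]_(x in ysection S y) f x y.
Proof.
move=> mS mf f0.
pose g := (fun p => f p.1 p.2) \_ S.
have mg : measurable_fun setT g by apply/(measurable_restrictT _ mS).
have ig : (m1 \x m2)%E.-integrable setT (EFin \o g).
  apply/integrable12ltyP; first exact/measurable_EFinP.
  apply: le_lt_trans f0; rewrite le_eqVlt; apply/orP; left; apply/eqP.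
  apply: eq_integral => x _; rewrite [RHS]integral_mkcond.
  apply: eq_integral => y _; rewrite /g/= !patchE mem_xsection.
  by case: ifP => // _; rewrite normr0.
have e1 x : (\int[m2]_y (EFin \o g) (x, y) = \int[m2]_(y in xsection S x) (f x y)%:E)%E.
  rewrite [RHS]integral_mkcond; apply: eq_integral => y _.
  by rewrite /g/= !patchE mem_xsection; case: ifP.
have e2 y : (\int[m1]_x (EFin \o g) (x, y) = \int[m1]_(x in ysection S y) (f x y)%:E)%E.
  rewrite [RHS]integral_mkcond; apply: eq_integral => x _.
  by rewrite /g/= !patchE mem_ysection; case: ifP.
(* An inner integral may be infinite on a null set, where [fine] replaces it by 0; the outer
   integral does not see this. *)
have aeq d (X : measurableType d) (m : {measure set X -> \bar R}) (h : X -> \bar R) :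
   measurable_fun setT h -> {ae m, forall x, h x \is a fin_num} ->
   \int[m]_x (fine (h x)) = fine (\int[m]_x h x)%E.
  move=> mh ih; rewrite /Rintegral; congr fine; apply: ae_eq_integral => //.
    by apply/measurable_EFinP; exact: measurableT_comp.
  by apply: filterS ih => x hx _; rewrite fineK.
have F := Fubini ig.
transitivity (fine (\int[m1]_x \int[m2]_y (EFin \o g) (x, y))%E).
  rewrite -aeq; [|exact: (measurable_fubini_F ig)|]; last first.
    by apply: filterS (ae_integrable1 ig) => x; exact: integrable_fin_num.
  by apply: eq_Rintegral => x _; rewrite /Rintegral e1.
rewrite F -aeq; [|exact: (measurable_fubini_G ig)|]; last first.
  by apply: filterS (ae_integrable2 ig) => x; exact: integrable_fin_num.
by apply: eq_Rintegral => y _; rewrite /Rintegral e2.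
Qed.

Lemma tonelli_rect (A : set X1) (B : set X2) (f : X1 -> X2 -> \bar R) :
  measurable A -> measurable B ->
  measurable_fun (A `*` B) (fun p => f p.1 p.2) ->
  (forall x y, A x -> B y -> 0 <= f x y)%E ->
  (\int[m1]_(x in A) \int[m2]_(y in B) f x y =
   \int[m2]_(y in B) \int[m1]_(x in A) f x y)%E.
Proof.
move=> mA mB mf f0.
have := tonelli_on (measurableX mA mB) mf (fun x y h => f0 x y h.1 h.2).
move=> h; rewrite [LHS]integral_mkcond [RHS]integral_mkcond.
transitivity (\int[m1]_x \int[m2]_(y in xsection (A `*` B) x) f x y)%E.
  apply: eq_integral => x _; rewrite patchE; case: ifPn => xA.
    by rewrite in_xsectionX.
  by rewrite notin_xsectionX// integral_set0.
rewrite h; apply: eq_integral => y _; rewrite patchE; case: ifPn => yB.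
  by rewrite in_ysectionX.
by rewrite notin_ysectionX// integral_set0.
Qed.

Lemma fubini_rect (A : set X1) (B : set X2) (f : X1 -> X2 -> R) :
  measurable A -> measurable B ->
  measurable_fun (A `*` B) (fun p => f p.1 p.2) ->
  (\int[m1]_(x in A) \int[m2]_(y in B) `|f x y|%:E < +oo)%E ->
  \int[m1]_(x in A) \int[m2]_(y in B) f x y =
   \int[m2]_(y in B) \int[m1]_(x in A) f x y.
Proof.
move=> mA mB mf f0.
rewrite [LHS]Rintegral_mkcond [RHS]Rintegral_mkcond.
transitivity (\int[m1]_x \int[m2]_(y in xsection (A `*` B) x) f x y).
  apply: eq_Rintegral => x _; rewrite patchE; case: ifPn => xA.
    by rewrite in_xsectionX.
  by rewrite notin_xsectionX// Rintegral_set0.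
rewrite (fubini_on (measurableX mA mB) mf).
  apply: eq_Rintegral => y _; rewrite patchE; case: ifPn => yB.
    by rewrite in_ysectionX.
  by rewrite notin_ysectionX// Rintegral_set0.
apply: le_lt_trans f0; rewrite le_eqVlt; apply/orP; left; apply/eqP.
rewrite [RHS]integral_mkcond.
apply: eq_integral => x _; rewrite patchE; case: ifPn => xA.
  by rewrite in_xsectionX.
by rewrite notin_xsectionX// integral_set0.
Qed.

End IteratedIntegrals.

(** * Exchange of integrals over a triangle *)

Section Triangle.
Context {R : realType}.
Local Notation mu := (@lebesgue_measure R).

(** [I] is left arbitrary: segments serve the Volterra kernels, a half line serves the Gaussian
    second moment. *)
Let tri (I : set R) : set (plane R) :=
  (I `*` I) `&` [set p | p.2 <= p.1].

Let mtri (I : set R) : measurable I -> measurable (tri I).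
Proof.
move=> mI; apply: measurableI; first exact: measurableX.
have -> : [set p : plane R | (p.2 <= p.1)] =
  (fun p : plane R => p.1 - p.2) @^-1` `[0, +oo[.
  by apply/seteqP; split => -[x y] /=; rewrite in_itv/= andbT subr_ge0.
rewrite -[X in measurable X]setTI.
by apply: measurable_funB.
Qed.

Let xtri I x : xsection (tri I) x =
  if x \in I then I `&` `]-oo, x] else set0.
Proof.
rewrite /xsection; apply/seteqP; split => y /=.
  rewrite inE => -[[/= Ix Iy] yx].
  by rewrite mem_set//=; split => //; rewrite in_itv/=.
case: ifPn => // xI [Iy] /=; rewrite in_itv/= => yx.
by rewrite inE; split => //; split => //; exact: set_mem.
Qed.

Let ytri I y : ysection (tri I) y =
  if y \in I then I `&` `[y, +oo[ else set0.
Proof.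
rewrite /ysection; apply/seteqP; split => x /=.
  rewrite inE => -[[/= Ix Iy] yx].
  by rewrite mem_set//=; split => //; rewrite in_itv/= andbT.
case: ifPn => // yI [Ix] /=; rewrite in_itv/= andbT => yx.
by rewrite inE; split => //; split => //; exact: set_mem.
Qed.

Lemma tonelli_triangle (I : set R) (f : R -> R -> \bar R) :
  measurable I ->
  measurable_fun (I `*` I) (fun p : plane R => f p.1 p.2) ->
  (forall x y, I x -> I y -> y <= x -> (0 <= f x y)%E) ->
  (\int[mu]_(x in I) \int[mu]_(y in I `&` `]-oo, x]) f x y =
   \int[mu]_(y in I) \int[mu]_(x in I `&` `[y, +oo[) f x y)%E.
Proof.
move=> mI mf f0.
have := tonelli_on mu mu (f := f) (mtri mI).
move=> h; rewrite [LHS]integral_mkcond [RHS]integral_mkcond.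
transitivity (\int[mu]_x \int[mu]_(y in xsection (tri I) x) f x y)%E.
  apply: eq_integral => x _; rewrite patchE xtri; case: ifPn => xA //.
  by rewrite integral_set0.
rewrite h.
- apply: eq_integral => y _; rewrite patchE ytri; case: ifPn => yB //.
  by rewrite integral_set0.
- by apply: (measurable_funS (measurableX mI mI) _ mf) => p [].
- by move=> x y [[/= Ix Iy] yx]; exact: f0.
Qed.

Lemma fubini_triangle (I : set R) (f : R -> R -> R) :
  measurable I ->
  measurable_fun (I `*` I) (fun p : plane R => f p.1 p.2) ->
  (\int[mu]_(x in I) \int[mu]_(y in I `&` `]-oo, x]) `|f x y|%:E < +oo)%E ->
  \int[mu]_(x in I) \int[mu]_(y in I `&` `]-oo, x]) f x y =
   \int[mu]_(y in I) \int[mu]_(x in I `&` `[y, +oo[) f x y.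
Proof.
move=> mI mf f0.
have := fubini_on (m1 := mu) (m2 := mu) (f := f) (mtri mI).
move=> h; rewrite [LHS]Rintegral_mkcond [RHS]Rintegral_mkcond.
transitivity (\int[mu]_x \int[mu]_(y in xsection (tri I) x) f x y).
  apply: eq_Rintegral => x _; rewrite patchE xtri; case: ifPn => xA //.
  by rewrite Rintegral_set0.
rewrite h.
- apply: eq_Rintegral => y _; rewrite patchE ytri; case: ifPn => yB //.
  by rewrite Rintegral_set0.
- by apply: (measurable_funS (measurableX mI mI) _ mf) => p [].
- apply: le_lt_trans f0; rewrite le_eqVlt; apply/orP; left; apply/eqP.
  rewrite [RHS]integral_mkcond.
  apply: eq_integral => x _; rewrite patchE xtri; case: ifPn => xA //.
  by rewrite integral_set0.
Qed.

Lemma setI_itvcc_Ny (a b x : R) : x <= b ->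
  `[a, b]%classic `&` `]-oo, x] = `[a, x]%classic.
Proof.
move=> xb; apply/seteqP; split => y /=; rewrite !in_itv/=.
  by move=> [/andP[-> _]].
by move=> /andP[-> yx]; rewrite yx (le_trans yx).
Qed.

Lemma setI_itvcc_y (a b y : R) : a <= y ->
  `[a, b]%classic `&` `[y, +oo[ = `[y, b]%classic.
Proof.
move=> ay; apply/seteqP; split => x /=; rewrite !in_itv/= ?andbT.
  by move=> [/andP[_ ->] ->].
by move=> /andP[yx ->]; rewrite yx (le_trans ay).
Qed.

Lemma tonelli_tri (a b : R) (f : R -> R -> \bar R) :
  measurable_fun (`[a, b] `*` `[a, b])
    (fun p : plane R => f p.1 p.2) ->
  (forall x y, a <= y -> y <= x -> x <= b -> (0 <= f x y)%E) ->
  (\int[mu]_(x in `[a, b]) \int[mu]_(y in `[a, x]) f x y =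
   \int[mu]_(y in `[a, b]) \int[mu]_(x in `[y, b]) f x y)%E.
Proof.
move=> mf f0.
have mI : measurable (`[a, b]%classic : set R) by exact: measurable_itv.
have h : (\int[mu]_(x in `[a, b]) \int[mu]_(y in `[a, b] `&` `]-oo, x]) f x y =
   \int[mu]_(y in `[a, b]) \int[mu]_(x in `[a, b] `&` `[y, +oo[) f x y)%E.
  apply: (tonelli_triangle mI mf).
  by move=> x y /=; rewrite !in_itv/= => /andP[_ xb] /andP[ay _] yx; exact: f0.
transitivity (\int[mu]_(x in `[a, b]) \int[mu]_(y in `[a, b] `&` `]-oo, x]) f x y)%E.
  by apply: eq_integral => x /set_mem/=; rewrite in_itv/= => /andP[_ xb]; rewrite setI_itvcc_Ny.
apply: (etrans h).
by apply: eq_integral => x /set_mem/=; rewrite in_itv/= => /andP[ax _]; rewrite setI_itvcc_y.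
Qed.

Lemma fubini_tri (a b : R) (f : R -> R -> R) :
  measurable_fun (`[a, b] `*` `[a, b])
    (fun p : plane R => f p.1 p.2) ->
  (\int[mu]_(x in `[a, b]) \int[mu]_(y in `[a, x]) `|f x y|%:E < +oo)%E ->
  \int[mu]_(x in `[a, b]) \int[mu]_(y in `[a, x]) f x y =
   \int[mu]_(y in `[a, b]) \int[mu]_(x in `[y, b]) f x y.
Proof.
move=> mf f0.
have mI : measurable (`[a, b]%classic : set R) by exact: measurable_itv.
have h : \int[mu]_(x in `[a, b]) \int[mu]_(y in `[a, b] `&` `]-oo, x]) f x y =
   \int[mu]_(y in `[a, b]) \int[mu]_(x in `[a, b] `&` `[y, +oo[) f x y.
  apply: (fubini_triangle mI mf).
  apply: le_lt_trans f0; rewrite le_eqVlt; apply/orP; left; apply/eqP.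
  by apply: eq_integral => x /set_mem/=; rewrite in_itv/= => /andP[_ xb]; rewrite setI_itvcc_Ny.
transitivity (\int[mu]_(x in `[a, b]) \int[mu]_(y in `[a, b] `&` `]-oo, x]) f x y).
  by apply: eq_Rintegral => x /set_mem/=; rewrite in_itv/= => /andP[_ xb]; rewrite setI_itvcc_Ny.
apply: (etrans h).
by apply: eq_Rintegral => x /set_mem/=; rewrite in_itv/= => /andP[ax _]; rewrite setI_itvcc_y.
Qed.

End Triangle.

(** * Power integrals and Abel's equation *)

Section RealIntegrals.
Context {R : realType}.
Local Notation mu := (@lebesgue_measure R).

Let aff (a b : R) : measurableTypeR R -> measurableTypeR R := fun y => a * y + b.

Let maff a b : measurable_fun setT (aff a b).
Proof. by apply: measurable_funD => //; exact: measurable_funM. Qed.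

(** Uniqueness of Lebesgue measure: the rescaled pushforward under the affine map gives each []p,
    q]] its length. *)
Lemma lebesgue_measure_affine (a b : R) (A : set R) : 0 < a -> measurable A ->
  (mu A = a%:E * mu ((fun y => (a * y + b)%R) @^-1` A))%E.
Proof.
move=> a0 mA.
pose ag := NngNum (ltW a0).
pose m : {measure set (measurableTypeR R) -> \bar R} :=
  mscale ag (pushforward mu (aff a b)).
have -> : (a%:E * mu ((fun y => (a * y + b)%R) @^-1` A) = m (@maff a b) A)%E by [].
apply: lebesgue_measure_unique => // _ [[p q]] _ <-.
rewrite -[RHS]/(a%:E * mu (aff a b @^-1` `]p, q]))%E.
have -> : aff a b @^-1` `]p, q]%classic = `](p - b) / a, (q - b) / a]%classic.
  apply/seteqP; split => y /=; rewrite !in_itv/= /aff ltr_pdivrMr// ler_pdivlMr//.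
    by rewrite ltrBlDr lerBrDr mulrC.
  by rewrite ltrBlDr lerBrDr mulrC.
rewrite !lebesgue_measure_itv/= !lte_fin ltr_pM2r ?invr_gt0// ltrD2r.
case: ifPn => _; last by rewrite mule0.
by rewrite -!EFinB -EFinM; congr EFin; field; rewrite gt_eqF.
Qed.

Lemma ge0_integral_affine (a b : R) (D : set R) (f : R -> \bar R) : 0 < a ->
  measurable D -> measurable_fun D f -> (forall x, D x -> 0 <= f x)%E ->
  (\int[mu]_(x in D) f x =
   a%:E * \int[mu]_(y in (fun y => (a * y + b)%R) @^-1` D) f (a * y + b)%R)%E.
Proof.
move=> a0 mD mf f0.
pose ag := NngNum (ltW a0).
pose pf : {measure set (measurableTypeR R) -> \bar R} := pushforward mu (aff a b).
transitivity (\int[mscale ag (pf (@maff a b))]_(x in D) f x)%E.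
  by apply: eq_measure_integral => A mA _; exact: (lebesgue_measure_affine b a0 mA).
rewrite ge0_integral_mscale//; congr (_ * _)%E.
rewrite /pf ge0_integral_pushforward//.
by move=> y /set_mem; exact: f0.
Qed.

(** An improper form: [f] may blow up at both ends, where [F] only has one-sided limits. Closed
    subintervals exhaust []a, b[] and monotone convergence handles the integral. *)
Lemma FTC_ge0 (f F : R -> R) (a b : R) : a < b ->
  {in `]a, b[, forall x, 0 <= f x} -> {in `]a, b[, continuous f} ->
  (forall x : R, x \in `]a, b[ -> is_derive x (1 : R) F (f x)) ->
  F x @[x --> a^'+] --> F a -> F x @[x --> b^'-] --> F b ->
  (\int[mu]_(x in `[a, b]) (f x)%:E = (F b - F a)%:E)%E.
Proof.
move=> ab f0 cf dF Fa Fb.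
have mf : measurable_fun `]a, b[ f.
  apply: open_continuous_measurable_fun => //.
  by move=> x /set_mem; exact: cf.
(* Dividing by [n + 2] keeps the subintervals nondegenerate already at [n = 0]. *)
pose e n : R := (b - a) / 2 / (n.+2%:R).
have e0 n : 0 < e n by rewrite divr_gt0// divr_gt0// subr_gt0.
have e1 n : e n < (b - a) / 2.
  rewrite /e ltr_pdivrMr// ltr_pMr ?ltr1n// divr_gt0// subr_gt0//.
have ecvg : e n @[n --> \oo] --> (0 : R).
  rewrite -[X in _ --> X](mulr0 ((b - a) / 2)); apply: cvgM; first exact: cvg_cst.
  have := @cvg_harmonic R; rewrite -(cvg_shiftS (@harmonic R)).
  exact.
pose I n : set R := `[a + e n, b - e n]%classic.
have ndI : nondecreasing_seq I.
  apply/nondecreasing_seqP => n; rewrite subsetEset => x /=.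
  have le : e n.+1 <= e n.
    rewrite /e ler_wpM2l ?divr_ge0 ?subr_ge0 ?(ltW ab)//.
    by rewrite lef_pV2 ?posrE// ler_nat.
  by rewrite /I /= !in_itv/= => /andP[h1 h2]; apply/andP; split; lra.
have UI : \bigcup_n I n = `]a, b[%classic.
  apply/seteqP; split => x /=.
    move=> [n _]; rewrite /I/= !in_itv/= => /andP[h1 h2].
    by have := e0 n; have := e1 n => ? ?; apply/andP; split; lra.
  rewrite in_itv/= => /andP[ax xb].
  have h : \forall n \near \oo, e n < Num.min (x - a) (b - x).
    have m0 : 0 < Num.min (x - a) (b - x) by rewrite lt_min !subr_gt0 ax.
    move/cvgrPdist_lt : ecvg => /(_ _ m0); apply: filterS => n.
    by rewrite sub0r normrN gtr0_norm.
  have [N _ hN] := h; exists N => //.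
  have := hN N (leqnn N); rewrite /= lt_min => /andP[h1 h2].
  by rewrite /I/= in_itv/=; apply/andP; split; lra.
have Isub n : I n `<=` `]a, b[%classic.
  by move=> x Ix; rewrite -UI; exists n.
have int n : (\int[mu]_(x in I n) (f x)%:E = (F (b - e n) - F (a + e n))%:E)%E.
  rewrite /I; have := e0 n; have := e1 n => h1 h2.
  have sub x : x \in `[a + e n, b - e n] -> x \in `]a, b[.
    by rewrite !in_itv/= => /andP[? ?]; apply/andP; split; lra.
  have cF x : x \in `]a, b[ -> {for x, continuous F}.
    move=> xab; apply/differentiable_continuous/derivable1_diffP.
    by have [] := dF x xab.
  rewrite (continuous_FTC2 (F := F))//; first by lra.
  - apply: continuous_in_subspaceT => x /set_mem xI; apply: cf; exact: sub.
  - split.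
    + move=> x xI; have /dF [] // : x \in `]a, b[.
      by apply: sub; move: xI; rewrite !in_itv/= => /andP[? ?]; apply/andP; split; lra.
    + apply: cvg_at_right_filter; apply: cF; rewrite in_itv/=; apply/andP; split; lra.
    + apply: cvg_at_left_filter; apply: cF; rewrite in_itv/=; apply/andP; split; lra.
  - move=> x xI; have xab : x \in `]a, b[.
      by apply: sub; move: xI; rewrite !in_itv/= => /andP[? ?]; apply/andP; split; lra.
    by rewrite derive1E; have /= := dF x xab => -[_ ->].
have lim1 : (\int[mu]_(x in I n) (f x)%:E)%E @[n --> \oo] -->
    (\int[mu]_(x in \bigcup_n I n) (f x)%:E)%E.
  apply: ge0_nondecreasing_set_cvg_integral => //.
  - by move=> n; exact: measurable_itv.
  - by move=> n; apply/measurable_EFinP; apply: measurable_funS mf => //; exact: Isub.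
  - by move=> n x Ix; rewrite lee_fin; apply: f0; exact: (Isub n x Ix).
have lim2 : (\int[mu]_(x in I n) (f x)%:E)%E @[n --> \oo] --> (F b - F a)%:E.
  under eq_fun do rewrite int.
  apply: cvg_EFin; first by near=> n.
  apply: cvgB.
    apply: cvg_comp Fb => P [d /= d0 hd].
    move/cvgrPdist_lt : ecvg => /(_ _ d0); apply: filterS => n en; apply: hd => /=.
      by rewrite opprB addrCA subrr addr0 -normrN -sub0r.
    by rewrite gtrBl.
  apply: cvg_comp Fa => P [d /= d0 hd].
  move/cvgrPdist_lt : ecvg => /(_ _ d0); apply: filterS => n en; apply: hd => /=.
    by rewrite opprD addrA subrr.
  by rewrite ltrDl.
rewrite integral_itv_bndoo; last exact/measurable_EFinP.
by move: lim1 lim2; rewrite UI => /cvg_lim h1 /cvg_lim h2; rewrite -h1// -h2.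
Unshelve. all: by end_near. Qed.

Lemma is_derive_shift (s x : R) : is_derive x (1 : R) (fun y : R => y - s) 1.
Proof. by apply: is_derive_eq; rewrite ?subr0 ?addr0. Qed.

Lemma is_derive_powR_shift (p s x : R) : s < x -> p != 0 ->
  is_derive x (1 : R) (fun y : R => (y - s) `^ p / p) ((x - s) `^ (p - 1)).
Proof.
move=> sx p0.
have h : is_derive (x - s) (1 : R) (fun y : R => y `^ p) (p * (x - s) `^ (p - 1)).
  by apply: is_derive1_powR; rewrite subr_gt0.
have hc := @is_derive1_comp R (fun y : R => y `^ p) (fun y : R => y - s) x _ _ h (is_derive_shift s x).
have := @is_deriveM R R ((fun y : R => y `^ p) \o (fun y : R => y - s))
  (cst p^-1) x 1 _ _ hc (is_derive_cst _ _ _).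
move/is_derive_eq; apply.
by rewrite scaler0 add0r /GRing.scale/= mulr1 mulrA mulVf// mul1r.
Qed.

Lemma continuous_powR_shift (p s x : R) : s < x ->
  {for x, continuous (fun y : R => (y - s) `^ p)}.
Proof.
move=> sx; apply/differentiable_continuous/derivable1_diffP.
have h : is_derive (x - s) (1 : R) (fun y : R => y `^ p) (p * (x - s) `^ (p - 1)).
  by apply: is_derive1_powR; rewrite subr_gt0.
by have [] := @is_derive1_comp R (fun y : R => y `^ p) (fun y : R => y - s) x _ _ h (is_derive_shift s x).
Qed.

(** The second alternative admits the singular endpoint [a = s], where [p > 0] makes the power
    integrable and its primitive vanish. *)
Lemma integral_powR_shift (p s a b : R) : a <= b -> p != 0 ->
  s < a \/ (s <= a /\ 0 < p) ->
  (\int[mu]_(y in `[a, b]) ((y - s) `^ (p - 1))%:E =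
   (((b - s) `^ p - (a - s) `^ p) / p)%:E)%E.
Proof.
move=> ab p0 h; have sa : s <= a by case: h => [/ltW|[]].
move: ab; rewrite le_eqVlt => /orP[/eqP <-|ab].
  by rewrite subrr mul0r set_itv1 integral_set1.
rewrite mulrBl; apply: (@FTC_ge0 _ (fun y => (y - s) `^ p / p)) => //.
- by move=> x _; exact: powR_ge0.
- move=> x; rewrite in_itv/= => /andP[ax _]; apply: continuous_powR_shift.
  exact: le_lt_trans ax.
- move=> x; rewrite in_itv/= => /andP[ax _]; apply: is_derive_powR_shift => //.
  exact: le_lt_trans ax.
- apply: cvgMl; move: sa; rewrite le_eqVlt => /orP[/eqP sa|sa].
    have p1 : 0 < p by case: h => [|[]//]; rewrite sa ltxx.
    rewrite sa subrr powR0//.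
    have := powR_cvg0 p1 => /cvgrPdist_lt H; apply/cvgrPdist_lt => e e0.
    have [d /= d0 hd] := H _ e0.
    exists d => // y /=; rewrite distrC => yd ay; apply: hd => /=.
      by rewrite sub0r normrN.
    by rewrite subr_gt0.
  by apply: cvg_at_right_filter; exact: continuous_powR_shift.
- by apply: cvgMl; apply: cvg_at_left_filter; apply: continuous_powR_shift; lra.
Qed.

Lemma integral_powR_shift_rev (q a x : R) : a <= x -> 0 < q ->
  (\int[mu]_(y in `[a, x]) ((x - y) `^ (q - 1))%:E = ((x - a) `^ q / q)%:E)%E.
Proof.
move=> + q0; rewrite le_eqVlt => /orP[/eqP <-|ax].
  by rewrite subrr powR0 ?gt_eqF// mul0r set_itv1 integral_set1.
have hs y : is_derive y (1 : R) (fun y : R => x - y) (-1).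
  have := @is_deriveB R R R (cst x) id y 1 _ _ (is_derive_cst _ _ _) (is_derive_id _ _).
  by rewrite sub0r.
have hc r y : y < x -> is_derive y (1 : R) ((fun y : R => y `^ r) \o (fun y : R => x - y))
    (r * (x - y) `^ (r - 1) * (-1)).
  move=> yx; apply: is_derive1_comp => //.
  by apply: is_derive1_powR; rewrite subr_gt0.
have cc r y : y < x -> {for y, continuous (fun y : R => (x - y) `^ r)}.
  move=> yx; apply/differentiable_continuous/derivable1_diffP.
  by have [] := hc r y yx.
have dF y : y < x -> is_derive y (1 : R) (fun y : R => - (q^-1 * (x - y) `^ q)) ((x - y) `^ (q - 1)).
  move=> yx.
  have := @is_deriveM R R (cst (- q^-1)) ((fun y : R => y `^ q) \o (fun y : R => x - y))
    y 1 _ _ (is_derive_cst _ _ _) (hc q y yx).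
  have -> : (cst (- q^-1) * ((fun y : R => y `^ q) \o (fun y : R => x - y)))%R =
     (fun y : R => - (q^-1 * (x - y) `^ q)) by apply/funext => z; rewrite /= fctE mulNr.
  move/is_derive_eq; apply.
  rewrite scaler0 addr0 /GRing.scale/=; field.
  by rewrite gt_eqF.
have -> : (x - a) `^ q / q = (fun y : R => - (q^-1 * (x - y) `^ q)) x - (fun y : R => - (q^-1 * (x - y) `^ q)) a.
  by rewrite /= subrr powR0 ?gt_eqF// mulr0 oppr0 opprK add0r mulrC.
apply: (@FTC_ge0 (fun y : R => (x - y) `^ (q - 1))
  (fun y : R => - (q^-1 * (x - y) `^ q)) a x ax).
- by move=> y _; exact: powR_ge0.
- by move=> y; rewrite in_itv/= => /andP[_ yx]; exact: cc.
- by move=> y; rewrite in_itv/= => /andP[_ yx]; exact: dF.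
- apply: cvgN; apply: cvgMr.
  by apply: cvg_at_right_filter; apply: cc.
- apply: cvgN; apply: cvgMr.
  rewrite subrr powR0 ?gt_eqF//.
  have := powR_cvg0 q0 => /cvgrPdist_lt H; apply/cvgrPdist_lt => e e0.
  have [d /= d0 hd] := H _ e0.
  exists d => // y /= yd ay; apply: hd => /=.
    by rewrite sub0r normrN.
  by rewrite subr_gt0.
Qed.

(** Substitute [t = (x - s) v + s]. Because [p + q = 1], the powers of [x - s] cancel the Jacobian,
    so the value depends neither on [s] nor on [x]. *)
Lemma integral_beta (p q s x : R) : 0 < p < 1 -> 0 < q < 1 -> p + q = 1 -> s < x ->
  (\int[mu]_(t in `[s, x]) ((t - s) `^ (p - 1) * (x - t) `^ (q - 1))%:E =
   \int[mu]_(v in `[0%R, 1%R]) (v `^ (p - 1) * (1 - v) `^ (q - 1))%:E)%E.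
Proof.
move=> /andP[p0 p1] /andP[q0 q1] pq sx.
have xs0 : 0 < x - s by rewrite subr_gt0.
have aff_pre : (fun y : R => (x - s) * y + s) @^-1` `[s, x]%classic = `[0, 1]%classic.
  apply/seteqP; split => y /=; rewrite !in_itv/= => /andP[h1 h2].
    have : 0 <= (x - s) * y by lra.
    rewrite pmulr_rge0// => ->/=.
    have : (x - s) * y <= (x - s) * 1 by lra.
    by rewrite ler_pM2l.
  have : 0 <= (x - s) * y by rewrite mulr_ge0// ltW.
  have : (x - s) * y <= (x - s) * 1 by rewrite ler_pM2l.
  by move=> ? ?; apply/andP; split; lra.
have mf (z : R) r D : measurable_fun D (fun y : R => (z - y) `^ r).
  by apply: (measurableT_comp (measurable_powR _)); apply: measurable_funB.
have mf' (z : R) r D : measurable_fun D (fun y : R => (y - z) `^ r).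
  by apply: (measurableT_comp (measurable_powR _)); apply: measurable_funB.
rewrite (@ge0_integral_affine (x - s) s) //; last 2 first.
  by apply/measurable_EFinP; apply: measurable_funM; [exact: mf'|exact: mf].
  by move=> y _; rewrite lee_fin mulr_ge0// powR_ge0.
rewrite aff_pre -ge0_integralZl_EFin//; last 3 first.
  by move=> y _; rewrite lee_fin mulr_ge0// powR_ge0.
  apply/measurable_EFinP; apply: measurable_funM.
    apply: (measurableT_comp (measurable_powR _)); apply: measurable_funB => //.
    by apply: measurable_funD => //; apply: measurable_funM.
  apply: (measurableT_comp (measurable_powR _)); apply: measurable_funB => //.
  by apply: measurable_funD => //; apply: measurable_funM.
  by rewrite ltW.
apply: eq_integral => y /set_mem/=; rewrite in_itv/= => /andP[y0 y1].
rewrite -EFinM; congr EFin.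
rewrite addrK.
have -> : x - ((x - s) * y + s) = (x - s) * (1 - y) by ring.
have y1' : 0 <= 1 - y by rewrite subr_ge0.
rewrite (powRM _ (ltW xs0) y0) (powRM _ (ltW xs0) y1').
rewrite mulrACA mulrA -powRD; last by rewrite (gt_eqF xs0) implybT.
have -> : p - 1 + (q - 1) = -1 by lra.
by rewrite powR_inv1 ?(ltW xs0)// mulrA mulrA mulfV ?gt_eqF// mul1r.
Qed.

Lemma integral_beta_bounds (p q : R) : 0 < p < 1 -> 0 < q < 1 ->
  (1%:E <= \int[mu]_(v in `[0%R, 1%R]) (v `^ (p - 1) * (1 - v) `^ (q - 1))%:E < +oo)%E.
Proof.
move=> /andP[p0 p1] /andP[q0 q1].
have mf (z : R) r D : measurable_fun D (fun y : R => (z - y) `^ r).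
  by apply: (measurableT_comp (measurable_powR _)); apply: measurable_funB.
have mf' r D : measurable_fun D (fun y : R => y `^ r).
  exact: (measurable_funS _ _ (measurable_powR _)).
have mI : measurable (`[0, 1]%classic : set (measurableTypeR R)) by exact: measurable_itv.
have mI' : measurable (`]0, 1[%classic : set (measurableTypeR R)) by exact: measurable_itv.
have mprod D : measurable_fun D (fun v : R => (v `^ (p - 1) * (1 - v) `^ (q - 1))%:E).
  by apply/measurable_EFinP; apply: measurable_funM; [exact: mf'|exact: mf].
rewrite integral_itv_bndoo; last exact: mprod.
have ge1 r (v : R) : r < 1 -> 0 < v <= 1 -> 1 <= v `^ (r - 1).
  move=> r1 v01; rewrite -[leLHS](powRr0 v); apply: ger_powR => //; lra.
apply/andP; split.
  have -> : (1%:E = \int[mu]_(v in `]0%R, 1%R[) 1%:E :> \bar R)%E.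
    by rewrite integral_cst//= mul1e lebesgue_measure_itv/= lte01 oppr0 adde0.
  apply: ge0_le_integral => //; first exact: mprod.
  move=> v /=; rewrite in_itv/= => /andP[v0 v1]; rewrite lee_fin.
  have h1 := ge1 p v p1; have h2 := ge1 q (1 - v) q1.
  rewrite -[X in X <= _](mulr1 1); apply: ler_pM => //; [apply: h1|apply: h2]; lra.
(* On each half of the interval one of the two factors is at most 2, so the product is dominated by
   a sum with a single singularity in each term. *)
apply: (@le_lt_trans _ _ (\int[mu]_(v in `[0%R, 1%R])
    (2 * (v - 0) `^ (p - 1) + 2 * (1 - v) `^ (q - 1))%:E)%E); last first.
  under eq_integral do rewrite EFinD.
  have msub r D : measurable_fun D (fun y : R => (y - 0) `^ r).
    by apply: (measurableT_comp (measurable_powR _)); apply: measurable_funB.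
  rewrite ge0_integralD//.
  - under eq_integral do rewrite EFinM.
    rewrite ge0_integralZl_EFin//; last 2 first.
      by move=> x _; rewrite lee_fin powR_ge0.
      by apply/measurable_EFinP; exact: msub.
    under [X in (_ + X)%E]eq_integral do rewrite EFinM.
    rewrite ge0_integralZl_EFin//; last 2 first.
      by move=> x _; rewrite lee_fin powR_ge0.
      by apply/measurable_EFinP; exact: mf.
    rewrite integral_powR_shift//; [|by rewrite gt_eqF|by right].
    by rewrite integral_powR_shift_rev// -!EFinM -EFinD ltry.
  - by move=> x _; rewrite lee_fin mulr_ge0// powR_ge0.
  - by apply/measurable_EFinP; apply: measurable_funM => //; exact: msub.
  - by move=> x _; rewrite lee_fin mulr_ge0// powR_ge0.
  - by apply/measurable_EFinP; apply: measurable_funM => //; exact: mf.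
rewrite -(@integral_itv_bndoo _ 0 1 _ true false); last exact: mprod.
apply: ge0_le_integral => //.
- by move=> v _; rewrite lee_fin mulr_ge0// powR_ge0.
- exact: mprod.
- apply/measurable_EFinP; apply: measurable_funD; apply: measurable_funM => //; last exact: mf.
  by apply: (measurableT_comp (measurable_powR _)); apply: measurable_funB.
- move=> v /=; rewrite in_itv/= => /andP[v0 v1]; rewrite lee_fin subr0.
  have P : 0 <= v `^ (p - 1) by exact: powR_ge0.
  have Q : 0 <= (1 - v) `^ (q - 1) by exact: powR_ge0.
  have le2 r (z : R) : 0 < r -> 1/2 <= z <= 1 -> z `^ (r - 1) <= 2.
    move=> r0 /andP[z0 z1].
    have z0' : 0 < z by lra.
    apply: (@le_trans _ _ (z `^ (- 1))).
      by apply: ger_powR; [apply/andP; split; lra|lra].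
    by rewrite powR_inv1 ?(ltW z0')// invf_ple ?posrE//; lra.
  have [v2|v2] := leP (1/2) v.
    have h : v `^ (p - 1) <= 2 by apply: le2 => //; apply/andP; split; lra.
    by nra.
  have h : (1 - v) `^ (q - 1) <= 2 by apply: le2 => //; apply/andP; split; lra.
  by nra.
Qed.

(** Euler's Beta function, which enters only as a positive constant to be divided out. *)
Definition betac (p q : R) : R :=
  fine (\int[mu]_(v in `[0%R, 1%R]) (v `^ (p - 1) * (1 - v) `^ (q - 1))%:E).

Lemma betac_gt0 p q : 0 < p < 1 -> 0 < q < 1 -> 0 < betac p q.
Proof.
move=> hp hq; have /andP[h1 h2] := integral_beta_bounds hp hq.
rewrite /betac (@lt_le_trans _ _ 1)// -lee_fin fineK//.
by rewrite ge0_fin_numE// (le_trans _ h1).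
Qed.

Lemma integral_betac (p q s x : R) : 0 < p < 1 -> 0 < q < 1 -> p + q = 1 -> s < x ->
  (\int[mu]_(t in `[s, x]) ((t - s) `^ (p - 1) * (x - t) `^ (q - 1))%:E =
   (betac p q)%:E)%E.
Proof.
move=> hp hq pq sx; rewrite integral_beta// /betac fineK//.
have /andP[h1 h2] := integral_beta_bounds hp hq.
by rewrite ge0_fin_numE// (le_trans _ h1).
Qed.

(** Valid also for nonintegrable [f]: an infinite positive or negative part makes both sides 0,
    through [fine]. *)
Lemma ge0_RintegralZl d (X : measurableType d) (m : {measure set X -> \bar R})
    (D : set X) (k : R) (f : X -> R) :
  measurable D -> measurable_fun D f -> 0 <= k ->
  \int[m]_(x in D) (k * f x) = k * \int[m]_(x in D) f x.
Proof.
move=> mD mf; rewrite le_eqVlt => /orP[/eqP <-|k0].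
  rewrite mul0r /Rintegral (eq_integral (cst 0%E)) ?integral0//.
  by move=> x _; rewrite mul0r.
rewrite /Rintegral.
have mEf : measurable_fun D (EFin \o f) by exact/measurable_EFinP.
under eq_integral do rewrite EFinM.
rewrite integralE [in RHS]integralE.
rewrite !(ge0_funeposM _ (ltW k0)) !(ge0_funenegM _ (ltW k0)).
rewrite !ge0_integralZl_EFin ?(ltW k0)//; last 2 first.
- exact: measurable_funeneg.
- exact: measurable_funepos.
have : (0 <= \int[m]_(x in D) (fun x => (f x)%:E)^\+ x)%E by exact: integral_ge0.
have : (0 <= \int[m]_(x in D) (fun x => (f x)%:E)^\- x)%E by exact: integral_ge0.
case: (\int[m]_(x in D) (fun x => (f x)%:E)^\+ x)%E => [a||//];
case: (\int[m]_(x in D) (fun x => (f x)%:E)^\- x)%E => [b||//] _ _ /=;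
  rewrite ?gt0_muley ?lte_fin//= ?mulr0//.
by rewrite mulrBr.
Qed.

(** Fractional integrals of orders [p] and [q] with [p + q = 1] compose to a multiple of the
    ordinary integral: after the exchange on the triangle, the inner integral of the two kernels is
    the constant [betac p q]. *)
Let abel_comp0 (p q x : R) (f : R -> R) : 0 < p < 1 -> 0 < q < 1 -> p + q = 1 ->
  0 < x -> measurable_fun setT f -> mu.-integrable `[0, x] (EFin \o f) ->
  \int[mu]_(t in `[0, x]) ((x - t) `^ (q - 1) *
     \int[mu]_(s in `[0, t]) ((t - s) `^ (p - 1) * f s)) =
  betac p q * \int[mu]_(s in `[0, x]) f s.
Proof.
move=> hp hq pq x0 mf intf.
have mI : measurable (`[0, x]%classic : set (measurableTypeR R)) by exact: measurable_itv.
have b0 := betac_gt0 hp hq.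
pose K t s := (x - t) `^ (q - 1) * (t - s) `^ (p - 1).
have m1 : measurable_fun setT (fun P : plane R => P.1 : R) by exact: measurable_fst.
have m2 : measurable_fun setT (fun P : plane R => P.2 : R) by exact: measurable_snd.
have mK : measurable_fun setT (fun P : plane R => K P.1 P.2).
  apply: measurable_funM.
    by apply: (measurableT_comp (measurable_powR _)); apply: measurable_funB.
  by apply: (measurableT_comp (measurable_powR _)); apply: measurable_funB.
have mf2 : measurable_fun setT (fun P : plane R => f P.2).
  exact: (measurableT_comp mf m2).
have mp t r : measurable_fun setT (fun s : R => (t - s) `^ r).
  by apply: (measurableT_comp (measurable_powR _)); apply: measurable_funB.
have mp' t r : measurable_fun setT (fun s : R => (s - t) `^ r).
  by apply: (measurableT_comp (measurable_powR _)); apply: measurable_funB.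
have K0 t s : 0 <= K t s by rewrite mulr_ge0// powR_ge0.
have intK s : s < x -> (\int[mu]_(t in `[s, x]) (K t s)%:E = (betac p q)%:E)%E.
  by move=> sx; rewrite -(integral_betac hp hq pq sx); apply: eq_integral => t _; rewrite /K mulrC.
have mKs s D : measurable_fun D (fun t => K t s).
  apply: measurable_funTS; apply: measurable_funM; [exact: mp|exact: mp'].
transitivity (\int[mu]_(t in `[0, x]) \int[mu]_(s in `[0, t]) (K t s * f s)).
  apply: eq_Rintegral => t _; rewrite -ge0_RintegralZl ?powR_ge0//.
    by apply: eq_Rintegral => s _; rewrite /K mulrA.
  by apply: measurable_funM; apply: measurable_funTS => //; exact: mp.
rewrite fubini_tri; last 2 first.
  by apply: measurable_funTS; exact: measurable_funM.
  have -> : (\int[mu]_(t in `[0%R, x]) \int[mu]_(s in `[0%R, t]) `|K t s * f s|%:E =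
    \int[mu]_(s in `[0%R, x]) \int[mu]_(t in `[s, x]) `|K t s * f s|%:E)%E.
    apply: (@tonelli_tri _ _ _ (fun t s => `|K t s * f s|%:E)) => //.
    apply: measurable_funTS; apply/measurable_EFinP.
    by apply: measurableT_comp => //; exact: measurable_funM.
  (* At [s = x] the inner integral is over a point and vanishes, so the Beta value is asserted on
     the open interval only. *)
  have E s : s \in `]0, x[ -> (\int[mu]_(t in `[s, x]) `|K t s * f s|%:E = (betac p q * `|f s|)%:E)%E.
    rewrite in_itv/= => /andP[_ sx].
    under eq_integral do rewrite normrM (ger0_norm (K0 _ _)) mulrC EFinM.
    rewrite ge0_integralZl_EFin//.
    - by rewrite intK// -EFinM mulrC.
    - by move=> t _; rewrite lee_fin.
    - by apply/measurable_EFinP; exact: mKs.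
  have mn : measurable_fun `]0, x[ (fun s => (betac p q * `|f s|)%:E).
    apply/measurable_EFinP; apply: measurable_funM => //; apply: measurableT_comp => //.
    exact: measurable_funTS.
  rewrite integral_itv_bndoo; last first.
    by apply: eq_measurable_fun mn => s /set_mem /= sx; rewrite E.
  under eq_integral => s /set_mem /= sx do rewrite (E _ sx).
  rewrite -(integral_itv_bndoo true false mn).
  under eq_integral do rewrite EFinM.
  have := integrableZl mI (betac p q) (integrable_abse intf).
  by move/integrable_lty => /(_ mI).
have E s : s \in `]0, x[ -> \int[mu]_(t in `[s, x]) (K t s * f s) = betac p q * f s.
  rewrite in_itv/= => /andP[_ sx].
  have mJ : measurable (`[s, x]%classic : set (measurableTypeR R)) by exact: measurable_itv.
  rewrite (@RintegralZr _ _ _ mu _ (fun t => K t s) (f s) mJ).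
    by rewrite /Rintegral (intK _ sx).
  apply/integrableP; split; first by apply/measurable_EFinP; exact: mKs.
  under eq_integral do rewrite /= (ger0_norm (K0 _ _)).
  by rewrite intK// ltry.
rewrite -RintegralZl//.
rewrite /Rintegral; congr fine.
apply: eq_integral_itv_bounded => //.
- apply: (@eq_measurable_fun _ _ _ _ _ (fun s => betac p q * f s)).
    by move=> s /set_mem /= sx; rewrite -(E _ sx).
  by apply: measurable_funM => //; exact: measurable_funTS.
- by apply: measurable_funM => //; exact: measurable_funTS.
Qed.

Lemma abel_comp (p q x : R) (f : R -> R) : 0 < p < 1 -> 0 < q < 1 -> p + q = 1 ->
  0 <= x -> mu.-integrable `[0, x] (EFin \o f) ->
  \int[mu]_(t in `[0, x]) ((x - t) `^ (q - 1) *
     \int[mu]_(s in `[0, t]) ((t - s) `^ (p - 1) * f s)) =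
  betac p q * \int[mu]_(s in `[0, x]) f s.
Proof.
move=> hp hq pq; rewrite le_eqVlt => /orP[/eqP <- _|x0 intf].
  by rewrite set_itv1 !Rintegral_set1 mulr0.
have mI : measurable (`[0, x]%classic : set (measurableTypeR R)) by exact: measurable_itv.
pose g := f \_ `[0, x].
have mg : measurable_fun setT g.
  apply/(measurable_restrictT _ mI); apply/measurable_EFinP; exact: measurable_int intf.
have gf : {in (`[0, x]%classic : set (measurableTypeR R)), g =1 f} by move=> s sx; rewrite /g patchE sx.
have intg : mu.-integrable `[0, x] (EFin \o g).
  by apply: eq_integrable intf => // s sx /=; rewrite gf.
have := abel_comp0 hp hq pq x0 mg intg.
rewrite (eq_Rintegral mu gf) => <-.
apply: eq_Rintegral => t /set_mem /=; rewrite in_itv/= => /andP[t0 tx]; congr (_ * _).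
apply: eq_Rintegral => s /set_mem /=; rewrite in_itv/= => /andP[s0 st].
by rewrite gf// mem_set//= in_itv/= s0 (le_trans st).
Qed.

(** Lebesgue differentiation: extended by 0 outside [[0, T]], [f] has a primitive that vanishes on
    the whole line. *)
Lemma ae_eq0_of_primitive (T : R) (f : R -> R) :
  mu.-integrable `[0, T] (EFin \o f) ->
  (forall x, 0 <= x <= T -> \int[mu]_(s in `[0, x]) f s = 0) ->
  {ae mu, forall x, `[0, T]%classic x -> f x = 0}.
Proof.
move=> intf f0.
have mI : measurable (`[0, T]%classic : set (measurableTypeR R)) by exact: measurable_itv.
pose g := f \_ `[0, T].
have ig : mu.-integrable setT (EFin \o g).
  by rewrite /g -restrict_EFin; move/integrable_mkcond : intf; apply.
have ig' y : mu.-integrable `]-oo, y] (EFin \o g) by exact: integrableS ig.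
have lg : locally_integrable setT g by apply: open_integrable_locally => //; exact: openT.
have := FTC1Ny ig' lg.
have F0 y : \int[mu]_(t in `]-oo, y]) g t = 0.
  rewrite /g -Rintegral_mkcondr.
  have [y0|y0] := ltP y 0.
    rewrite (_ : _ `&` _ = set0) ?Rintegral_set0//.
    apply/seteqP; split => // t [] /=; rewrite !in_itv/= => ty /andP[t0 _]; lra.
  have [T0|T0] := ltP T 0.
    rewrite (_ : _ `&` _ = set0) ?Rintegral_set0//.
    apply/seteqP; split => // t [] /=; rewrite !in_itv/= => ty /andP[t0 tT]; lra.
  rewrite (_ : _ `&` _ = `[0, Num.min y T]%classic).
    by apply: f0; rewrite le_min y0 T0/= ge_min lexx orbT.
  apply/seteqP; split => t /=; rewrite !in_itv/= le_min.
    by move=> [-> /andP[-> ->]].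
  by move=> /andP[-> /andP[-> ->]].
apply: filterS; first exact: (ae_filter_ringOfSetsType mu).
move=> x [_ +] xT.
rewrite (_ : (fun x => _) = cst 0); last by apply/funext => y; exact: F0.
by rewrite derive1_cst /g patchE mem_set.
Qed.

End RealIntegrals.

(** * The Volterra relation of the kernel *)

Lemma ler_powR_base (R : realType) (r x y : R) : 0 <= r -> 0 <= x -> x <= y -> x `^ r <= y `^ r.
Proof.
move=> r0 x0 xy; apply: ge0_ler_powR => //; rewrite nnegrE//; exact: le_trans xy.
Qed.

Ltac meas := lazymatch goal with
 | |- measurable_fun _ (fun x => (@?f x)%:E) => apply/measurable_EFinP; meas
 | |- measurable_fun _ (EFin \o _) => apply/measurable_EFinP; meas
 | |- measurable_fun _ (fun x => @?f x * @?g x) => apply: measurable_funM; meas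
 | |- measurable_fun _ (fun x => @?f x - @?g x) => apply: measurable_funB; meas
 | |- measurable_fun _ (fun x => @?f x + @?g x) => apply: measurable_funD; meas
 | |- measurable_fun _ (fun x => - @?f x) => apply: (measurableT_comp (@oppr_measurable _ _)); meas
 | |- measurable_fun _ (fun x => @?f x `^ ?r) =>
     apply: (measurableT_comp (measurable_powR r)); meas
 | |- measurable_fun _ (fun x => @?f x ^+ ?r) => apply: measurable_funX; meas
 | |- measurable_fun _ (fun x => `| @?f x |) =>
     apply: (measurableT_comp (@normr_measurable _ _)); meas
 | |- measurable_fun _ (fun x => (@?f x * @?g x)%E) => apply: emeasurable_funM; meas
 | |- measurable_fun _ (fun x => x) => exact: measurable_id
 | |- measurable_fun _ (fun x => x.1) => apply: measurable_funTS; exact: measurable_fst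
 | |- measurable_fun _ (fun x => x.2) => apply: measurable_funTS; exact: measurable_snd
 | |- measurable_fun _ (fun x => ?c) => first [done | exact: measurable_cst]
 | |- measurable_fun _ ?f => first [assumption
    | apply: measurable_funTS; first [exact: measurable_fst|exact: measurable_snd]
    | match goal with H : forall D, measurable_fun D _ |- _ => exact: H end
    | match goal with H : measurable_fun setT _ |- _ => apply: measurable_funTS; exact: H end ]
 end.

Section VolterraKernel.
Context {R : realType}.
Local Notation mu := (@lebesgue_measure R).
Variable a : R.
Hypotheses (a0 : 0 < a) (a1 : a < 1).

Definition kerint (s u : R) : R := (u - s) `^ (- a - 1) * (1 - s `^ a * u `^ (- a)).

Local Ltac lraa := have := a0; have := a1 => ? ?; lra.

Let mpow (z r : R) D : measurable_fun D (fun y : R => (y - z) `^ r).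
Proof. by apply: (measurableT_comp (measurable_powR _)); apply: measurable_funB. Qed.

Lemma measurable_kerint s D : measurable_fun D (kerint s).
Proof.
by apply: measurable_funM; [exact: mpow|meas].
Qed.

Lemma kerintE (s u : R) : 0 < s -> 0 < u ->
  kerint s u * u `^ a = (u - s) `^ (- a - 1) * (u `^ a - s `^ a).
Proof.
move=> s0 u0; rewrite /kerint -mulrA mulrBl mul1r -mulrA -powRD ?addNr ?powRr0 ?mulr1//.
by rewrite (gt_eqF u0) implybT.
Qed.

Lemma kerint_ge0 (s u : R) : 0 < s -> s <= u -> 0 <= kerint s u.
Proof.
move=> s0 su; have u0 : 0 < u by exact: lt_le_trans su.
have := powR_gt0 a u0 => ua.
rewrite -(pmulr_lge0 _ ua) kerintE// mulr_ge0 ?powR_ge0// subr_ge0.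
by apply: ler_powR_base; lraa.
Qed.

(** Integration by parts carried out as an exchange of integrals, from
    [r^a - s^a = a int_s^r q^(a-1) dq]. It is stated in the extended reals because the integrability
    of [kerint] is deduced from it. *)
Lemma kerint_identity (s t : R) : 0 < s -> s <= t ->
  (a%:E * \int[mu]_(r in `[s, t]) (kerint s r * r `^ a)%:E
     + ((t - s) `^ (- a) * (t `^ a - s `^ a))%:E
   = a%:E * \int[mu]_(u in `[s, t]) (u `^ (a - 1) * (u - s) `^ (- a))%:E)%E.
Proof.
move=> s0; rewrite le_eqVlt => /orP[/eqP <-|st].
  by rewrite !subrr mulr0 adde0 !set_itv1 !integral_set1.
have e1 r : s <= r -> (\int[mu]_(q in `[s, r]) (q `^ (a - 1))%:E = ((r `^ a - s `^ a) / a)%:E)%E.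
  move=> sr; rewrite -[in RHS](subr0 r) -[in RHS](subr0 s) -(integral_powR_shift sr); last 2 first.
  - by rewrite gt_eqF.
  - by left.
  by apply: eq_integral => q _; rewrite subr0.
have e2 q : s < q -> q <= t -> (\int[mu]_(r in `[q, t]) ((r - s) `^ (- a - 1))%:E =
   (((q - s) `^ (- a) - (t - s) `^ (- a)) / a)%:E)%E.
  move=> sq qt; rewrite integral_powR_shift ?oppr_eq0 ?gt_eqF//; last by left.
  by congr EFin; field; rewrite gt_eqF.
have T1 : (a%:E * \int[mu]_(r in `[s, t]) (kerint s r * r `^ a)%:E =
   a%:E * \int[mu]_(r in `[s, t]) \int[mu]_(q in `[s, r]) (a * (r - s) `^ (- a - 1) * q `^ (a - 1))%:E)%E.
  congr (_ * _)%E; apply: eq_integral => r /set_mem/=; rewrite in_itv/= => /andP[sr rt].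
  rewrite kerintE//; last exact: lt_le_trans sr.
  under eq_integral do rewrite EFinM.
  rewrite ge0_integralZl_EFin//.
  - by rewrite e1// -EFinM; congr EFin; field; rewrite gt_eqF.
  - by move=> q _; rewrite lee_fin powR_ge0.
  - by meas.
  - by rewrite mulr_ge0 ?powR_ge0// ltW.
rewrite T1 (tonelli_tri
  (f := fun r q => (a * (r - s) `^ (- a - 1) * q `^ (a - 1))%:E)); last 2 first.
- by meas.
- by move=> r q *; rewrite lee_fin !mulr_ge0 ?powR_ge0// ltW.
(* For [q > s] the integral over [[q, t]] stays away from the nonintegrable singularity of
   [(r - s)^(-a-1)] at [r = s]. *)
have T2 q : q \in `]s, t[ -> (\int[mu]_(r in `[q, t]) (a * (r - s) `^ (- a - 1) * q `^ (a - 1))%:E =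
    (q `^ (a - 1) * ((q - s) `^ (- a) - (t - s) `^ (- a)))%:E)%E.
  rewrite in_itv/= => /andP[sq qt].
  transitivity (\int[mu]_(r in `[q, t]) ((a * q `^ (a - 1))%:E * ((r - s) `^ (- a - 1))%:E))%E.
    by apply: eq_integral => r _; rewrite -EFinM mulrAC.
  rewrite ge0_integralZl_EFin//.
  - by rewrite e2 ?(ltW qt)// -EFinM; congr EFin; field; rewrite gt_eqF.
  - by move=> r _; rewrite lee_fin powR_ge0.
  - by meas.
  - by rewrite mulr_ge0 ?powR_ge0// ltW.
have mT2 : measurable_fun `]s, t[ (fun q => (q `^ (a - 1) * ((q - s) `^ (- a) - (t - s) `^ (- a)))%:E).
  by meas.
rewrite integral_itv_bndoo; last first.
  by apply: eq_measurable_fun mT2 => q /set_mem /= /T2 ->.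
under eq_integral => q /set_mem /= sq do rewrite (T2 _ sq).
have c0 : 0 <= (t - s) `^ (- a) by exact: powR_ge0.
have -> : (((t - s) `^ (- a) * (t `^ a - s `^ a))%:E =
   a%:E * \int[mu]_(q in `]s, t[) ((t - s) `^ (- a) * q `^ (a - 1))%:E)%E.
  under eq_integral do rewrite EFinM.
  rewrite ge0_integralZl_EFin//; last 2 first.
    by move=> r _; rewrite lee_fin powR_ge0.
    by meas.
  rewrite -(@integral_itv_bndoo _ _ _ _ true false); last by meas.
  by rewrite e1 ?ltW// -!EFinM; congr EFin; field; rewrite gt_eqF.
have anti q : q \in `]s, t[ -> (t - s) `^ (- a) <= (q - s) `^ (- a).
  rewrite in_itv/= => /andP[sq qt]; rewrite !powRN lef_pV2 ?posrE ?powR_gt0 ?subr_gt0//.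
  by apply: ler_powR_base; lraa.
rewrite -ge0_muleDr ?integral_ge0//; last 2 first.
- move=> q /= qst; rewrite lee_fin mulr_ge0 ?powR_ge0// subr_ge0; exact: anti.
- by move=> q _; rewrite lee_fin mulr_ge0 ?powR_ge0.
congr (_ * _)%E; rewrite -ge0_integralD//; last 3 first.
- move=> q /= qst; rewrite lee_fin mulr_ge0 ?powR_ge0// subr_ge0; exact: anti.
- by move=> q _; rewrite lee_fin mulr_ge0 ?powR_ge0.
- by meas.
rewrite [RHS]integral_itv_bndoo.
  by apply: eq_integral => q _; rewrite -EFinD; congr EFin; ring.
by meas.
Qed.

(** The factor [(r - s)^(-a-1)] alone is not integrable. [kerint_identity] trades it for
    [(r - s)^(-a)], integrable as [a < 1]; the weight [r^a] is then removed by [r^a >= s^a]. *)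
Lemma integrable_kerint (s t : R) : 0 < s -> s <= t ->
  mu.-integrable `[s, t] (EFin \o kerint s).
Proof.
move=> s0 st.
have mk D : measurable_fun D (EFin \o kerint s).
  by apply/measurable_EFinP; exact: measurable_kerint.
have kp : (\int[mu]_(r in `[s, t]) (kerint s r * r `^ a)%:E < +oo)%E.
  have sa0 : 0 < s `^ (a - 1) by rewrite powR_gt0.
  have fin : (a%:E * \int[mu]_(u in `[s, t]) (u `^ (a - 1) * (u - s) `^ (- a))%:E < +oo)%E.
    apply: lte_mul_pinfty => //; rewrite ?lee_fin ?(ltW a0)//.
    apply: (@le_lt_trans _ _ (\int[mu]_(u in `[s, t]) ((s `^ (a - 1))%:E * ((u - s) `^ (1 - a - 1))%:E))%E).
      apply: ge0_le_integral => //.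
      - by move=> u _; rewrite lee_fin mulr_ge0// powR_ge0.
      - by meas.
      - by meas.
      - move=> u /=; rewrite in_itv/= => /andP[su ut]; rewrite -EFinM lee_fin.
        have -> : 1 - a - 1 = - a by ring.
        apply: ler_wpM2r; first exact: powR_ge0.
        have -> : a - 1 = - (1 - a) by ring.
        rewrite !powRN lef_pV2 ?posrE ?powR_gt0//; last exact: lt_le_trans su.
        by apply: ler_powR_base; lraa.
    rewrite ge0_integralZl_EFin//; last 3 first.
    - by move=> r _; rewrite lee_fin powR_ge0.
    - by meas.
    - exact: ltW.
    rewrite integral_powR_shift//; last 2 first.
    - by rewrite gt_eqF// subr_gt0.
    - by right; rewrite lexx subr_gt0.
    by rewrite -EFinM ltry.
  have := kerint_identity s0 st => E.
  have le : (a%:E * \int[mu]_(r in `[s, t]) (kerint s r * r `^ a)%:E <=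
     a%:E * \int[mu]_(u in `[s, t]) (u `^ (a - 1) * (u - s) `^ (- a))%:E)%E.
    rewrite -E; apply: leeDl; rewrite lee_fin; apply: mulr_ge0;
      first exact: powR_ge0.
    rewrite subr_ge0.
    by apply: ler_powR_base; lraa.
  rewrite ltey; apply: contraTneq (le_lt_trans le fin) => ->.
  by rewrite gt0_muley ?lte_fin// ltxx.
apply/integrableP; split => //.
  exact: mk.
apply: (@le_lt_trans _ _ (\int[mu]_(r in `[s, t]) ((s `^ (- a))%:E * (kerint s r * r `^ a)%:E))%E).
  apply: ge0_le_integral => //.
  - by apply: measurableT_comp => //; exact: mk.
  - by have mk' := measurable_kerint s; meas.
  - move=> r /=; rewrite in_itv/= => /andP[sr rt].
    have k0 := kerint_ge0 s0 sr.
    rewrite ger0_norm// -EFinM lee_fin mulrCA -[leLHS]mulr1 ler_wpM2l//.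
    rewrite powRN mulrC ler_pdivlMr ?powR_gt0// mul1r.
    by apply: ler_powR_base; lraa.
rewrite ge0_integralZl_EFin ?powR_ge0//.
- by apply: lte_mul_pinfty => //; rewrite lee_fin powR_ge0.
- move=> r /=; rewrite in_itv/= => /andP[sr rt].
  by rewrite lee_fin mulr_ge0 ?powR_ge0// kerint_ge0.
- by have mk' := measurable_kerint s; meas.
Qed.

(* [kerV] is [K_H / c_H] for [a = 1/2 - H]; [kerint] is the integrand of the
   inner integral with the power of [s / u] distributed. *)
Definition kerV (t s : R) : R := (t - s) `^ (- a) + a * \int[mu]_(u in `[s, t]) kerint s u.

Lemma kerV_ge0 t s : 0 < s -> 0 <= kerV t s.
Proof.
move=> s0; rewrite addr_ge0 ?powR_ge0// mulr_ge0 ?(ltW a0)//.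
apply: Rintegral_ge0 => u /=; rewrite in_itv/= => /andP[su _]; exact: kerint_ge0.
Qed.

Lemma measurable_kerV :
  measurable_fun setT (fun P : plane R => kerV P.1 P.2).
Proof.
apply: measurable_funD.
  by apply: (measurableT_comp (measurable_powR _)); apply: measurable_funB.
apply: measurable_funM => //.
pose G (P : plane R) (u : measurableTypeR R) : R :=
  if (P.2 <= u) && (u <= P.1) then kerint P.2 u else 0.
have -> : (fun P : plane R => \int[mu]_(u in `[P.2, P.1]) kerint P.2 u)
   = fun P => \int[mu]_u G P u.
  apply/funext => P; rewrite Rintegral_mkcond; apply: eq_Rintegral => u _.
  rewrite patchE /G; case: ifPn.
    by move=> /set_mem /=; rewrite in_itv/= => ->.
  by move=> h; case: ifPn => // h'; move: h; rewrite mem_set//= in_itv/=.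
apply: measurable_Rintegral_param.
have m1 : measurable_fun setT (fun Q : plane R * measurableTypeR R => Q.1.1 : R).
  exact: (measurableT_comp measurable_fst).
have m2 : measurable_fun setT (fun Q : plane R * measurableTypeR R => Q.1.2 : R).
  exact: (measurableT_comp measurable_snd).
have m3 : measurable_fun setT (fun Q : plane R * measurableTypeR R => Q.2 : R).
  exact: measurable_snd.
apply: measurable_fun_ifT => //.
  by apply: measurable_and; apply: measurable_fun_ler.
apply: measurable_funM.
  by apply: (measurableT_comp (measurable_powR _)); apply: measurable_funB.
by apply: measurable_funB => //; apply: measurable_funM;
   apply: (measurableT_comp (measurable_powR _)).
Qed.

(* Multiplying by [t^a] and integrating in time removes the inner integral of
   the kernel: only the Abel kernel [(t - s)^(-a)] remains. *)
Lemma kerV_volterra (t s : R) : 0 < s -> s < t ->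
  ((t `^ a * kerV t s)%:E = (s `^ a * (t - s) `^ (- a))%:E +
    a%:E * \int[mu]_(u in `[s, t]) (u `^ (a - 1) * kerV u s)%:E)%E.
Proof.
move=> s0 st; have st' := ltW st.
have ta0 : 0 <= t `^ a by exact: powR_ge0.
have mk D : measurable_fun D (kerint s) by exact: measurable_kerint.
have IE r : s <= r -> (\int[mu]_(q in `[s, r]) (kerint s q)%:E = (\int[mu]_(q in `[s, r]) kerint s q)%:E)%E.
  by move=> sr; rewrite /Rintegral fineK// integrable_fin_num//; exact: integrable_kerint.
have T1 : (\int[mu]_(u in `[s, t]) (u `^ (a - 1) * \int[mu]_(q in `[s, u]) kerint s q)%:E =
  \int[mu]_(r in `[s, t]) (kerint s r * ((t `^ a - r `^ a) / a))%:E)%E.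
  transitivity (\int[mu]_(u in `[s, t]) \int[mu]_(q in `[s, u]) (u `^ (a - 1) * kerint s q)%:E)%E.
    apply: eq_integral => u /set_mem/=; rewrite in_itv/= => /andP[su ut].
    under [RHS]eq_integral do rewrite EFinM.
    rewrite ge0_integralZl_EFin ?powR_ge0//.
    - by rewrite IE// -EFinM.
    - by move=> q /=; rewrite in_itv/= => /andP[sq _]; rewrite lee_fin kerint_ge0.
    - by meas.
  rewrite tonelli_tri; last 2 first.
  - apply: measurable_funTS; apply/measurable_EFinP; apply: measurable_funM.
      exact: (measurableT_comp (measurable_powR _)).
    exact: (measurableT_comp (mk _)).
  - by move=> u q sq qu ut; rewrite lee_fin mulr_ge0 ?powR_ge0// kerint_ge0.
  apply: eq_integral => r /set_mem/=; rewrite in_itv/= => /andP[sr rt].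
  transitivity (\int[mu]_(u in `[r, t]) ((kerint s r)%:E * (((u - 0) `^ (a - 1))%:E)))%E.
    by apply: eq_integral => u _; rewrite -EFinM mulrC subr0.
  rewrite ge0_integralZl_EFin ?kerint_ge0//.
  - rewrite integral_powR_shift ?gt_eqF//; first by rewrite !subr0 -EFinM.
    by left; exact: lt_le_trans sr.
  - by move=> q _; rewrite lee_fin powR_ge0.
  - by meas.
have mIk : measurable_fun `[s, t] (fun u => \int[mu]_(q in `[s, u]) kerint s q).
  have h := @measurableT_comp _ _ _ _ _ _ _ _ (fun u : measurableTypeR R => (u, s) : plane R) measurable_kerV.
  have h2 : measurable_fun setT (fun u => kerV u s).
    by apply: h; exact: pair2_measurable.
  have -> : (fun u => \int[mu]_(q in `[s, u]) kerint s q) = fun u => a^-1 * (kerV u s - (u - s) `^ (- a)).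
    apply/funext => u; rewrite /kerV addrAC subrr add0r mulrA mulVf ?mul1r//.
    by rewrite gt_eqF.
  apply: measurable_funTS; apply: measurable_funM => //; apply: measurable_funB => //.
under eq_integral do rewrite /kerV mulrDr EFinD.
rewrite ge0_integralD//; last 4 first.
- by move=> u _; rewrite lee_fin mulr_ge0 ?powR_ge0.
- by meas.
- move=> u /=; rewrite in_itv/= => /andP[su ut].
  rewrite lee_fin mulr_ge0 ?powR_ge0// mulr_ge0 ?(ltW a0)//.
  apply: Rintegral_ge0 => q /=; rewrite in_itv/= => /andP[sq _]; exact: kerint_ge0.
- by meas.
rewrite ge0_muleDr ?integral_ge0//; last 2 first.
- by move=> u _; rewrite lee_fin mulr_ge0 ?powR_ge0.
- move=> u /=; rewrite in_itv/= => /andP[su ut].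
  rewrite lee_fin mulr_ge0 ?powR_ge0// mulr_ge0 ?(ltW a0)//.
  apply: Rintegral_ge0 => q /=; rewrite in_itv/= => /andP[sq _]; exact: kerint_ge0.
rewrite -kerint_identity//.
have -> : (\int[mu]_(u in `[s, t]) (u `^ (a - 1) * (a * \int[mu]_(q in `[s, u]) kerint s q))%:E =
  \int[mu]_(r in `[s, t]) (kerint s r * (t `^ a - r `^ a))%:E)%E.
  transitivity (\int[mu]_(u in `[s, t]) (a%:E * (u `^ (a - 1) * \int[mu]_(q in `[s, u]) kerint s q)%:E))%E.
    by apply: eq_integral => u _; rewrite -EFinM mulrCA.
  rewrite ge0_integralZl_EFin ?(ltW a0)//; last 2 first.
  - move=> u /=; rewrite in_itv/= => /andP[su ut].
    rewrite lee_fin mulr_ge0 ?powR_ge0//.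
    apply: Rintegral_ge0 => q /=; rewrite in_itv/= => /andP[sq _]; exact: kerint_ge0.
  - by meas.
  rewrite T1 -ge0_integralZl_EFin ?(ltW a0)//.
  - by apply: eq_integral => r _; rewrite -EFinM; congr EFin; field; rewrite gt_eqF.
  - move=> r /=; rewrite in_itv/= => /andP[sr rt].
    rewrite lee_fin mulr_ge0 ?kerint_ge0// divr_ge0 ?(ltW a0)// subr_ge0.
    by apply: ler_powR_base; lraa.
  - by meas.
(* The weight [r^a] comes from [kerint_identity], the weight [t^a - r^a] from the exchange [T1];
   their sum [t^a] restores the inner integral of [kerV t s]. *)
have sum : (\int[mu]_(r in `[s, t]) (kerint s r * r `^ a)%:E +
   \int[mu]_(r in `[s, t]) (kerint s r * (t `^ a - r `^ a))%:E =
   (t `^ a * \int[mu]_(r in `[s, t]) kerint s r)%:E)%E.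
  rewrite -ge0_integralD//; last 4 first.
  - move=> r /=; rewrite in_itv/= => /andP[sr rt].
    by rewrite lee_fin mulr_ge0 ?kerint_ge0 ?powR_ge0.
  - by meas.
  - move=> r /=; rewrite in_itv/= => /andP[sr rt].
    rewrite lee_fin mulr_ge0 ?kerint_ge0// subr_ge0.
    by apply: ler_powR_base; lraa.
  - by meas.
  rewrite EFinM -IE// -ge0_integralZl_EFin//.
  - by apply: eq_integral => r _; rewrite -EFinM -EFinD; congr EFin; ring.
  - by move=> r /=; rewrite in_itv/= => /andP[sr rt]; rewrite lee_fin kerint_ge0.
  - by meas.
set A := (\int[mu]_(r in `[s, t]) (kerint s r * r `^ a)%:E)%E in sum *.
set B := (\int[mu]_(r in `[s, t]) (kerint s r * (t `^ a - r `^ a))%:E)%E in sum *.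
have A0 : (0 <= A)%E.
  apply: integral_ge0 => r /=; rewrite in_itv/= => /andP[sr rt].
  by rewrite lee_fin mulr_ge0 ?kerint_ge0 ?powR_ge0.
have B0 : (0 <= B)%E.
  apply: integral_ge0 => r /=; rewrite in_itv/= => /andP[sr rt].
  rewrite lee_fin mulr_ge0 ?kerint_ge0// subr_ge0.
  by apply: ler_powR_base; lraa.
(* Nonnegative with a finite sum, [A] and [B] are both real; what is left is real algebra. *)
move: A B A0 B0 sum => [x| |] [y| |] //= _ _ [] xy.
rewrite -!EFinM -!EFinD; congr EFin; rewrite /kerV.
have -> : t `^ a * ((t - s) `^ (- a) + a * \int[mu]_(u in `[s, t]) kerint s u) =
   t `^ a * (t - s) `^ (- a) + a * (x + y) by rewrite xy; ring.
ring.
Qed.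

End VolterraKernel.

(** * The kernel as an injective operator *)

Lemma measurable_fun_fixl d1 d2 d3 (X1 : measurableType d1) (X2 : measurableType d2)
    (Y : measurableType d3) (f : X1 -> X2 -> Y) (x : X1) :
  measurable_fun setT (fun p => f p.1 p.2) -> measurable_fun setT (f x).
Proof. by move=> mf; have := measurableT_comp mf (pair1_measurable x). Qed.

Lemma measurable_fun_fixr d1 d2 d3 (X1 : measurableType d1) (X2 : measurableType d2)
    (Y : measurableType d3) (f : X1 -> X2 -> Y) (y : X2) :
  measurable_fun setT (fun p => f p.1 p.2) -> measurable_fun setT (f ^~ y).
Proof. by move=> mf; have := measurableT_comp mf (pair2_measurable y). Qed.

Section Kernel.
Context {R : realType}.
Local Notation mu := (@lebesgue_measure R).
Variables (H T : R).
Hypotheses (T0 : 0 < T) (H0 : 0 < H) (H1 : H < 1 / 2).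

Local Notation a := (1 / 2 - H).
Local Notation I := (`[0, T]%classic : set (measurableTypeR R)).

Let mI : measurable I.
Proof. exact: measurable_itv. Qed.

Let a0 : 0 < a. Proof. by have := H1 => h; lra. Qed.
Let a1 : a < 1. Proof. by have := H0 => h; lra. Qed.
Let a12 : 0 < 1 - a - a. Proof. by have := H0 => h; lra. Qed.

Lemma L2P (f : R -> R) : L2 T f <-> sqint mu I f.
Proof.
rewrite /L2; split.
  move=> fL; have mf : measurable_fun I f.
    apply/(measurable_restrictT _ mI); move: fL; rewrite inE => /andP[].
    by rewrite inE.
  split => //.
  have := Lfun2_integrable_sqr fL => /integrable_lty => /(_ measurableT).
  apply: le_lt_trans; rewrite le_eqVlt; apply/orP; left; apply/eqP.
  rewrite integral_mkcond; apply: eq_integral => x _ /=.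
  by rewrite !patchE; case: ifP => //; rewrite expr0n.
move=> [mf ff]; rewrite inE; apply/andP; split.
  by rewrite inE; apply/(measurable_restrictT _ mI).
rewrite inE /= /finite_norm unlock /=.
apply: poweR_lty; apply: le_lt_trans ff.
rewrite le_eqVlt; apply/orP; left; apply/eqP.
rewrite [RHS]integral_mkcond; apply: eq_integral => x _ /=.
rewrite !patchE; case: ifP => _; last by rewrite normr0 powR0.
by rewrite powR_mulrn// real_normK ?num_real.
Qed.

(* [K_H] with its junk value at [s <= 0] replaced by 0, which makes it jointly
   measurable and nonnegative everywhere. *)
Definition KK (t s : R) : R :=
  if (0 < s) && (s < t) then cH H * kerV a t s else 0.

Lemma KK_KH t s : 0 < s -> KK t s = KH H t s.
Proof.
move=> s0; rewrite /KK /KH s0/=; case: ifPn => // st.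
rewrite /kerV mulrDr; congr (_ + _).
  by congr (_ * _ `^ _); ring.
rewrite mulrA; congr (_ * _); apply: eq_Rintegral => u /set_mem/=.
rewrite in_itv/= => /andP[su ut]; rewrite /kerint.
have u0 : 0 < u by exact: lt_le_trans su.
congr (_ * _); first by congr (_ `^ _); lra.
congr (_ - _); rewrite powRM ?invr_ge0 ?(ltW s0) ?(ltW u0)//; congr (_ * _).
by rewrite -(powR_inv1 (ltW u0)) -powRrM; congr (_ `^ _); ring.
Qed.

Lemma KK_ge0 t s : 0 <= KK t s.
Proof.
rewrite /KK; case: ifPn => // /andP[s0 st].
by rewrite mulr_ge0 ?sqrtr_ge0// kerV_ge0.
Qed.

Lemma KK0 t s : t <= s -> KK t s = 0.
Proof. by move=> ts; rewrite /KK ltNge [_ < _]ltNge ts andbF. Qed.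

Lemma measurable_KK :
  measurable_fun setT (fun P : plane R => KK P.1 P.2).
Proof.
have m1 : measurable_fun setT (fun P : plane R => P.1 : R) by exact: measurable_fst.
have m2 : measurable_fun setT (fun P : plane R => P.2 : R) by exact: measurable_snd.
apply: measurable_fun_ifT => //.
  by apply: measurable_and; apply: measurable_fun_ltr.
by apply: measurable_funM => //; exact: measurable_kerV.
Qed.

Lemma measurable_KKr t D : measurable_fun D (KK t).
Proof.
apply: measurable_funTS; exact: (measurable_fun_fixl _ measurable_KK).
Qed.

Lemma measurable_KKl s D : measurable_fun D (fun t => KK t s).
Proof.
apply: measurable_funTS; exact: (measurable_fun_fixr _ measurable_KK).
Qed.

Lemma KK_volterra (t s : R) : 0 < s -> s < t ->
  ((t `^ a * KK t s)%:E = (cH H * (s `^ a * (t - s) `^ (- a)))%:E +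
    a%:E * \int[mu]_(u in `[s, t]) (u `^ (a - 1) * KK u s)%:E)%E.
Proof.
move=> s0 st; have := kerV_volterra a0 a1 s0 st => E.
have c0 : 0 <= cH H by exact: sqrtr_ge0.
rewrite {1}/KK s0 st/= mulrCA EFinM E ge0_muleDr; last 2 first.
- by rewrite lee_fin mulr_ge0 ?powR_ge0.
- apply: mule_ge0; first by rewrite lee_fin ltW.
  apply: integral_ge0 => u _; rewrite lee_fin mulr_ge0 ?powR_ge0// kerV_ge0//.
rewrite -EFinM; congr (_ + _)%E.
rewrite muleCA; congr (_ * _)%E.
have mk := measurable_fun_fixr s (measurable_kerV a).
have mKs := measurable_KKl s.
rewrite -ge0_integralZl_EFin//; last 2 first.
- by move=> u _; rewrite lee_fin mulr_ge0 ?powR_ge0// kerV_ge0.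
- apply/measurable_EFinP; apply: measurable_funM; first by meas.
  apply: measurable_funTS; exact: mk.
under [LHS]eq_integral do rewrite -EFinM.
apply: eq_integral_itv_bounded.
- apply: measurable_funM; first by meas. apply: measurable_funM; first by meas.
  apply: measurable_funTS; exact: mk.
- by meas.
- by move=> u; rewrite in_itv/= => /andP[su ut]; rewrite /KK s0 su/=; ring.
Qed.

(** [KK t] vanishes beyond [t], so the Volterra integral is an inner product over a fixed interval.
    This lets [KK t] be treated as a vector of [L^2([0, T])]. *)
Lemma KK_dotp_itv (g : R -> R) t : t <= T ->
  \int[mu]_(s in `[0, t]) (KK t s * g s) = dotp mu I (KK t) g.
Proof.
move=> tT; rewrite /dotp Rintegral_mkcond [RHS]Rintegral_mkcond; apply: eq_Rintegral => s _.
rewrite !patchE; case: ifPn => [/set_mem|/negP] /=.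
  rewrite in_itv/= => /andP[s0 st]; rewrite mem_set//= in_itv/= s0.
  exact: le_trans tT.
move=> h; case: ifPn => [/set_mem|//] /=; rewrite in_itv/= => /andP[s0 sT].
rewrite KK0 ?mul0r// leNgt; apply/negP => st; apply: h.
by apply: mem_set => /=; rewrite in_itv/= s0 ltW.
Qed.

(** The closed interval may be replaced by the open one, where [KH] and [KK] agree; the junk value
    of [KH] sits at [s = 0]. *)
Lemma KHop_dotp (g : R -> R) t : measurable_fun I g -> 0 <= t <= T ->
  KHop H g t = dotp mu I (KK t) g.
Proof.
move=> mg /andP[t0 tT].
have mg' : measurable_fun (`]0, t[%classic : set (measurableTypeR R)) g.
  apply: measurable_funS mg => // x /=; rewrite !in_itv/= => /andP[x0 xt].
  by rewrite (ltW x0) (le_trans (ltW xt)).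
have mKt := measurable_KKr t.
have mp : measurable_fun (`]0, t[%classic : set (measurableTypeR R)) (fun s => KK t s * g s).
  by apply: measurable_funM => //; exact: mKt.
transitivity (\int[mu]_(s in `[0, t]) (KK t s * g s)).
  rewrite /KHop /Rintegral; congr fine; apply: eq_integral_itv_bounded => //.
    apply: eq_measurable_fun mp => s /set_mem /=; rewrite in_itv/= => /andP[s0 _].
    by rewrite KK_KH.
  by move=> s; rewrite in_itv/= => /andP[s0 st]; rewrite KK_KH.
exact: KK_dotp_itv.
Qed.

(** This and the two assumptions that follow are later read off the law of [B] by the isometry, not
    off the formula of the kernel. *)
Hypothesis KKL2 : forall t, 0 <= t <= T -> sqint mu I (KK t).
Variable M : R.
Hypothesis KKM : forall t, 0 <= t <= T -> dotp mu I (KK t) (KK t) <= M.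
Hypothesis c0 : cH H != 0.

(** Domination for Fubini: Young's inequality bounds the inner integral by [u^(a-1)] times a
    constant uniform in [u], and this power is integrable since [a > 0]. *)
Let KK_finite (g : R -> R) (t : R) : measurable_fun setT g -> sqint mu I g -> 0 < t <= T ->
  (\int[mu]_(u in `[0%R, t]) \int[mu]_(s in `[0%R, u]) `|u `^ (a - 1) * KK u s * g s|%:E < +oo)%E.
Proof.
move=> mg sg /andP[t0 tT].
pose F u s := u `^ (a - 1) * KK u s * g s.
have m1 : measurable_fun setT (fun P : plane R => P.1 : R) by exact: measurable_fst.
have m2 : measurable_fun setT (fun P : plane R => P.2 : R) by exact: measurable_snd.
have mK2 := measurable_KK.
have mg2 : measurable_fun setT (fun P : plane R => g P.2).
  exact: (measurableT_comp mg m2).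
rewrite -[X in (X < _)%E]/(\int[mu]_(u in `[0%R, t]) \int[mu]_(s in `[0%R, u]) `|F u s|%:E)%E.
pose C := 2^-1 * (M + dotp mu I g g).
have C0 : 0 <= C.
  rewrite mulr_ge0// addr_ge0 ?dotp_ge0//; apply: le_trans (KKM (t := 0) _).
    exact: dotp_ge0.
  by rewrite lexx ltW.
apply: (@le_lt_trans _ _ (\int[mu]_(u in `[0%R, t]) (C%:E * ((u - 0) `^ (a - 1))%:E))%E).
  apply: ge0_le_integral => //.
  - by move=> u _; apply: integral_ge0 => s _; rewrite lee_fin.
  - have -> : (fun u => \int[mu]_(s in `[0%R, u]) `|F u s|%:E)%E =
       (fun u : R => \int[mu]_s (if (0 <= s)%R && (s <= u)%R then `|F u s|%:E else 0%E))%E.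
      apply/funext => u; rewrite integral_mkcond; apply: eq_integral => s _.
      rewrite patchE; case: ifPn => [/set_mem|/negP] /=; first by rewrite in_itv/= => ->.
      by move=> h; case: ifPn => // h'; case: h; apply: mem_set; rewrite /= in_itv.
    apply: measurable_funTS; apply: measurable_integral_param.
    apply: measurable_fun_ifT => //.
      apply: measurable_and; apply: measurable_fun_ler => //.
    apply/measurable_EFinP; apply: measurableT_comp => //.
    rewrite /F; apply: measurable_funM; last exact: mg2.
    apply: measurable_funM; [by meas|exact: mK2].
  - by meas.
  - move=> u /=; rewrite in_itv/= => /andP[u0 ut]; rewrite subr0.
    have uT : 0 <= u <= T by rewrite u0 (le_trans ut).
    have mKu := measurable_KKr u.
    have mKg D : measurable_fun D (fun s => `|KK u s * g s|).
      apply: measurableT_comp => //; apply: measurable_funM; first exact: mKu.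
      by apply: measurable_funTS; exact: mg.
    apply: (@le_trans _ _ (\int[mu]_(s in I) ((u `^ (a - 1))%:E * `|KK u s * g s|%:E))%E).
      apply: (@le_trans _ _ (\int[mu]_(s in `[0%R, u]) ((u `^ (a - 1))%:E * `|KK u s * g s|%:E))%E).
        rewrite le_eqVlt; apply/orP; left; apply/eqP; apply: eq_integral => s _.
        by rewrite -EFinM; congr EFin; rewrite /F -mulrA normrM (ger0_norm (powR_ge0 _ _)).
      apply: ge0_subset_integral => //.
      - by apply: emeasurable_funM; [exact: measurable_cst|apply/measurable_EFinP; exact: mKg].
      - by move=> s _; rewrite -EFinM lee_fin mulr_ge0 ?powR_ge0.
      - move=> s /=; rewrite !in_itv/= => /andP[-> su]; exact: le_trans (le_trans ut tT).
    rewrite ge0_integralZl_EFin ?powR_ge0//; last by apply/measurable_EFinP; exact: mKg.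
    rewrite muleC lee_wpmul2r ?lee_fin ?powR_ge0//.
    apply: le_trans (integral_norm_mul_le mI (KKL2 uT) sg) _.
    by rewrite lee_fin /C ler_pM2l ?invr_gt0// lerD2r; exact: KKM.
rewrite ge0_integralZl_EFin//; last 2 first.
- by move=> u _; rewrite lee_fin powR_ge0.
- by meas.
rewrite integral_powR_shift ?(ltW t0)//; last 2 first.
- by rewrite gt_eqF.
- by right; rewrite lexx.
by rewrite -EFinM ltry.
Qed.

(** Integrate [u^(a-1) (K_u, g) = 0] over [u] in [[0, t]] and exchange. [KK_volterra] evaluates the
    inner integral; up to the factor [1 / a], what remains is [t^a (K_t, g)], which is 0, minus
    [c_H] times the Abel integral. *)
Let weighted_abel_eq0 (g : R -> R) (t : R) : measurable_fun setT g -> sqint mu I g ->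
  (forall t, 0 <= t <= T -> dotp mu I (KK t) g = 0) -> 0 < t <= T ->
  mu.-integrable `[0, t] (fun s => ((t - s) `^ (- a) * (s `^ a * g s))%:E) /\
  \int[mu]_(s in `[0, t]) ((t - s) `^ (- a) * (s `^ a * g s)) = 0.
Proof.
move=> mg sg K0 tt; have /andP[t0 tT] := tt.
pose J := (`[0, t]%classic : set (measurableTypeR R)).
have mJ : measurable J by exact: measurable_itv.
have JI : J `<=` I.
  by move=> x; rewrite /J /= !in_itv/= => /andP[-> xt]; rewrite (le_trans xt).
have sqJ f := @sqint_sub _ _ _ mu _ _ f mI mJ JI.
have Kdot u : 0 <= u <= t -> \int[mu]_(s in `[0, u]) (KK u s * g s) = 0.
  move=> /andP[u0 ut].
  have uT : 0 <= u <= T by rewrite u0 (le_trans ut).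
  by rewrite KK_dotp_itv ?K0// (le_trans ut).
have m1 : measurable_fun setT (fun P : plane R => P.1 : R) by exact: measurable_fst.
have m2 : measurable_fun setT (fun P : plane R => P.2 : R) by exact: measurable_snd.
have mK2 := measurable_KK.
have mg2 : measurable_fun setT (fun P : plane R => g P.2).
  exact: (measurableT_comp mg m2).
(* Twice the exponent [- a] is [2 H - 1 > -1]. *)
have sq1 : sqint mu J (fun s => (t - s) `^ (- a)).
  split; first by meas.
  have -> : (\int[mu]_(x in J) (((t - x) `^ (- a)) ^+ 2)%:E =
     \int[mu]_(x in `[0%R, t]) ((t - x) `^ (1 - a - a - 1))%:E)%E.
    apply: eq_integral => x _; congr EFin; rewrite -powR_mulrn ?powR_ge0// -powRrM.
    by congr (_ `^ _); ring.
  by rewrite integral_powR_shift_rev ?(ltW t0)// ltry.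
have sq2 : sqint mu J (fun s => s `^ a * g s).
  apply: (sqint_le mJ _ (sqintZ mJ (T `^ a) (sqJ _ sg))).
    by meas.
  move=> x; rewrite /J/= in_itv/= => /andP[x0 xt]; rewrite !normrM ler_wpM2r//.
  rewrite !ger0_norm ?powR_ge0//; apply: ler_powR_base => //; first exact: ltW.
  exact: le_trans tT.
have int1 := sqint_mul mJ sq1 sq2.
split; first exact: int1.
pose F u s := u `^ (a - 1) * KK u s * g s.
have mF : measurable_fun (J `*` J) (fun P : plane R => F P.1 P.2).
  rewrite /F; apply: measurable_funM.
    apply: measurable_funM; first by meas.
    apply: measurable_funTS; exact: mK2.
  apply: measurable_funTS; exact: mg2.
have intF := KK_finite mg sg tt.
have := fubini_tri mF intF.
have -> : \int[mu]_(x in `[0, t]) \int[mu]_(y in `[0, x]) F x y = 0.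
  rewrite (eq_Rintegral mu (g := cst 0)); first by rewrite Rintegral_cst ?mul0r.
  move=> u /set_mem/=; rewrite in_itv/= => /andP[u0 ut].
  have uI : 0 <= u <= t by rewrite u0.
  rewrite -[RHS](mulr0 (u `^ (a - 1))) -[X in _ = _ * X](Kdot u uI) -ge0_RintegralZl ?powR_ge0//.
    by apply: eq_Rintegral => s _; rewrite /F mulrA.
  apply: measurable_funM; first exact: measurable_KKr.
  by apply: measurable_funTS; exact: mg.
have inner s : s \in `]0, t[ -> \int[mu]_(u in `[s, t]) F u s =
   a^-1 * (t `^ a * (KK t s * g s) - cH H * ((t - s) `^ (- a) * (s `^ a * g s))).
  rewrite in_itv/= => /andP[s0 st].
  have V := KK_volterra s0 st.
  (* An infinite inner integral would contradict the Volterra relation, whose left side is real. *)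
  have fin : (\int[mu]_(u in `[s, t]) (u `^ (a - 1) * KK u s)%:E)%E \is a fin_num.
    rewrite ge0_fin_numE; last first.
      by apply: integral_ge0 => u _; rewrite lee_fin mulr_ge0 ?powR_ge0// KK_ge0.
    rewrite ltey; apply/eqP => E; move: V; rewrite E gt0_muley ?lte_fin//.
  have mKs := measurable_KKl s.
  have ints : mu.-integrable `[s, t] (EFin \o (fun u => u `^ (a - 1) * KK u s)).
    apply/integrableP; split.
      apply/measurable_EFinP; apply: measurable_funM; last exact: measurable_KKl.
      by meas.
    under eq_integral do rewrite /= ger0_norm ?mulr_ge0 ?powR_ge0 ?KK_ge0//.
    by rewrite -ge0_fin_numE// integral_ge0// => u _; rewrite lee_fin mulr_ge0 ?powR_ge0// KK_ge0.
  rewrite /F RintegralZr//.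
  move: V; rewrite -(fineK fin) -EFinM -EFinD => -[] V.
  have -> : \int[mu]_(u in `[s, t]) (u `^ (a - 1) * KK u s) =
     a^-1 * (t `^ a * KK t s - cH H * (s `^ a * (t - s) `^ (- a))).
    by rewrite V /Rintegral [X in _ * (X - _)]addrC addrK mulKf// lt0r_neq0//; exact: a0.
  by ring.
have mKt := measurable_KKr t.
move=> /esym.
have -> : \int[mu]_(s in `[0, t]) \int[mu]_(u in `[s, t]) F u s =
  \int[mu]_(s in `[0, t]) (a^-1 * (t `^ a * (KK t s * g s) - cH H * ((t - s) `^ (- a) * (s `^ a * g s)))).
  have mR D : measurable_fun D (fun s => a^-1 * (t `^ a * (KK t s * g s) - cH H * ((t - s) `^ (- a) * (s `^ a * g s)))).
    have mgD : measurable_fun D g by apply: measurable_funTS; exact: mg.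
    apply: measurable_funM; first exact: measurable_cst.
    apply: measurable_funB; (apply: measurable_funM; first exact: measurable_cst).
      by apply: measurable_funM; [exact: measurable_KKr|exact: mgD].
    apply: measurable_funM; first by meas.
    by apply: measurable_funM; [meas|exact: mgD].
  rewrite /Rintegral; congr fine; apply: eq_integral_itv_bounded => //.
    by apply: (eq_measurable_fun _ _ (mR _)) => s /set_mem /= st; rewrite -(inner _ st).
have iK : mu.-integrable J (EFin \o (fun s => KK t s * g s)).
  have tT' : 0 <= t <= T by rewrite (ltW t0).
  exact: (sqint_mul mJ (sqJ _ (KKL2 tT')) (sqJ _ sg)).
have iK' : mu.-integrable J (EFin \o (fun s => t `^ a * (KK t s * g s))).
  by have := integrableZl mJ (t `^ a) iK.
have i1' : mu.-integrable J (EFin \o (fun s => cH H * ((t - s) `^ (- a) * (s `^ a * g s)))).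
  by have := integrableZl mJ (cH H) int1.
rewrite RintegralZl//; last first.
  by have := integrableB mJ iK' i1'.
rewrite RintegralB// RintegralZl// (Kdot t) ?(ltW t0) ?lexx// mulr0 sub0r RintegralZl//.
move/eqP; rewrite mulf_eq0 invr_eq0 (gt_eqF a0)/= oppr_eq0 mulf_eq0 (negbTE c0)/=.
by move/eqP.
Qed.

Lemma KK_inj (g : R -> R) : sqint mu I g ->
  (forall t, 0 <= t <= T -> dotp mu I (KK t) g = 0) ->
  {ae mu, forall x, I x -> g x = 0}.
Proof.
move=> sg gK.
pose G := g \_ I.
have GE : {in I, G =1 g} by move=> x xI; rewrite /G patchE xI.
have mG : measurable_fun setT G by apply/(measurable_restrictT _ mI); case: sg.
have sG : sqint mu I G by apply: eq_sqint sg => x xI; rewrite GE.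
have GK t : 0 <= t <= T -> dotp mu I (KK t) G = 0.
  by move=> tT; rewrite -[RHS](gK t tT); apply: eq_Rintegral => x xI; rewrite GE.
have S1 := weighted_abel_eq0 mG sG GK.
have iG : mu.-integrable I (EFin \o (fun s => s `^ a * G s)).
  have s1 : sqint mu I (fun s => s `^ a).
    apply: (@sqint_le _ _ _ _ _ mI _ (cst (T `^ a))).
    - by meas.
    - by apply: sqint_cst => //; exact: lebesgue_measure_itvcc_lty.
    - move=> x /=; rewrite in_itv/= => /andP[x0 xT].
      rewrite !ger0_norm ?powR_ge0//; apply: ler_powR_base => //; exact: ltW.
  have := sqint_mul mI s1 sG; exact.
have prim x : 0 <= x <= T -> \int[mu]_(s in `[0, x]) (s `^ a * G s) = 0.
  move=> /andP[x0 xT].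
  (* The kernel of order [a] is applied to Abel's equation, whose kernel has order [1 - a]: the two
     compose to a multiple of the primitive of [s^a g(s)]. *)
  have hp : 0 < 1 - a < 1 by have := a0; have := a1 => ? ?; apply/andP; split; lra.
  have hq : 0 < a < 1 by rewrite a0 a1.
  have pq : 1 - a + a = 1 by ring.
  have iGx : mu.-integrable `[0, x] (EFin \o (fun s => s `^ a * G s)).
    apply: integrableS iG => //; move=> s /=; rewrite !in_itv/= => /andP[-> sx].
    exact: le_trans xT.
  have := abel_comp hp hq pq x0 iGx.
  rewrite (eq_Rintegral mu (g := cst 0)).
    rewrite Rintegral_cst// mul0r => /esym/eqP; rewrite mulf_eq0 gt_eqF ?betac_gt0//=.
    by move/eqP.
  move=> t /set_mem/=; rewrite in_itv/= => /andP[+ tx].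
  rewrite le_eqVlt => /orP[/eqP <-|t0].
    by rewrite set_itv1 Rintegral_set1 mulr0.
  have tT : 0 < t <= T by rewrite t0 (le_trans tx xT).
  have [_] := S1 t tT.
  have -> : 1 - a - 1 = - a by ring.
  by move=> ->; rewrite mulr0.
have := ae_eq0_of_primitive iG prim.
(* At [x = 0] the factor [x^a] vanishes, so this null set is discarded before dividing. *)
have z : {ae mu, forall x : R, x != 0}.
  exists [set 0]; split => //; first by rewrite lebesgue_measure_set1.
  by move=> x /= /negP; rewrite negbK => /eqP.
move: z; apply: filterS2; first exact: (ae_filter_ringOfSetsType mu).
move=> x x0 + Ix => /(_ Ix) /eqP.
rewrite mulf_eq0 powR_eq0 (negbTE x0)/= => /eqP.
by rewrite GE// mem_set.
Qed.

End Kernel.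

(** * Gaussian second moments and densities *)

Section NormalSecondMoment.
Context {R : realType}.
Local Notation mu := (@lebesgue_measure R).

(** Write one factor [x] as [int_0^x dy] and exchange: the integral of [x exp (- x^2 / (2 v))]
    beyond [y] is [v exp (- y^2 / (2 v))]. *)
Lemma integral_sqr_gauss (v : R) : 0 < v ->
  (\int[mu]_(x in `[0%R, +oo[) (x ^+ 2 * expR (- x ^+ 2 / (v *+ 2)))%:E =
   v%:E * \int[mu]_(x in `[0%R, +oo[) (expR (- x ^+ 2 / (v *+ 2)))%:E)%E.
Proof.
move=> v0.
pose g (x : R) := expR (- x ^+ 2 / (v *+ 2)).
have mg D : measurable_fun D g.
  apply: measurable_funTS.
  apply: (measurableT_comp (@measurable_expR R)).
  by apply: measurable_funM => //; apply: measurableT_comp => //; exact: measurable_funX.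
have g0 x : 0 <= g x by exact: expR_ge0.
have dg x : is_derive x (1 : R) (fun x => - v * g x) (x * g x).
  rewrite /g; apply: is_derive_eq.
  rewrite scaler0 add0r /GRing.scale/= !mulr1 -mulr_natr.
  by field; rewrite gt_eqF.
have cg : continuous g.
  move=> x; apply/differentiable_continuous/derivable1_diffP.
  rewrite /g. by [].
have tail y : 0 <= y -> (\int[mu]_(x in `[y, +oo[) (x * g x)%:E = (v * g y)%:E)%E.
  move=> y0.
  have -> : (v * g y)%:E = (0%:E - (- v * g y)%:E)%E by rewrite -EFinB sub0r mulNr opprK.
  apply: (@ge0_continuous_FTC2y R (fun x => x * g x) (fun x => - v * g x)).
  - by move=> x yx; rewrite mulr_ge0// (le_trans y0).
  - apply: continuous_subspaceT => x; apply: cvgM; [exact: cvg_id|exact: cg].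
  - rewrite -[X in _ --> X](mulr0 (- v)); apply: cvgMr.
    have -> : g = (fun x => expR (- x)) \o (fun x => x ^+ 2 * (v *+ 2)^-1).
      by apply/funext => x; rewrite /g /= mulNr.
    apply: cvg_comp; last exact: cvgr_expR.
    by apply: gt0_cvgMly; [rewrite invr_gt0 mulrn_wgt0|exact: cvgr_expr2].
  - by move=> x yx; have [] := dg x.
  - apply: cvg_at_right_filter; apply: cvgMr; exact: cg.
  - by move=> x _; rewrite derive1E; have [_ ->] := dg x.
have mI : measurable (`[0, +oo[%classic : set (measurableTypeR R)) by exact: measurable_itv.
have T : (\int[mu]_(x in `[0%R, +oo[) \int[mu]_(y in `[0%R, +oo[ `&` `]-oo, x]) (x * g x)%:E =
   \int[mu]_(y in `[0%R, +oo[) \int[mu]_(x in `[0%R, +oo[ `&` `[y, +oo[) (x * g x)%:E)%E.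
  apply: (@tonelli_triangle R `[0, +oo[ (fun x y => (x * g x)%:E)) => //.
    apply: measurable_funTS; apply/measurable_EFinP; apply: measurable_funM.
      exact: measurable_fst.
    apply: (measurableT_comp (mg _)); exact: measurable_fst.
  by move=> x y /=; rewrite !in_itv/= !andbT => x0 _ _; rewrite lee_fin mulr_ge0.
transitivity (\int[mu]_(x in `[0%R, +oo[) \int[mu]_(y in `[0%R, +oo[ `&` `]-oo, x]) (x * g x)%:E)%E.
  apply: eq_integral => x /set_mem/=; rewrite in_itv/= andbT => x0.
  rewrite integral_cst/=; last exact: measurableI.
  have -> : `[0, +oo[%classic `&` `]-oo, x] = `[0, x]%classic.
    apply/seteqP; split => y /=; rewrite !in_itv/= andbT; first by move=> [h1 h2]; rewrite h1 h2.
    by move=> /andP[h1 h2]; split.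
  rewrite lebesgue_measure_itv/= lte_fin; case: ltP => [x1|x1].
    by rewrite oppr0 adde0 -EFinM; congr EFin; rewrite /g; ring.
  have -> : x = 0 by apply/eqP; rewrite eq_le x1.
  by rewrite mule0 expr0n/= mul0r.
apply: (etrans T).
transitivity (\int[mu]_(y in `[0%R, +oo[) (v%:E * (g y)%:E))%E; last first.
  rewrite -[X in _ = (_ * X)%E]/(\int[mu]_(x in `[0%R, +oo[) (g x)%:E)%E.
  apply: ge0_integralZl_EFin; first exact: mI.
  - by move=> x _; rewrite lee_fin.
  - by apply/measurable_EFinP; exact: mg.
  - exact: ltW.
apply: eq_integral => y /set_mem/=; rewrite in_itv/= andbT => y0.
have -> : `[0, +oo[%classic `&` `[y, +oo[ = `[y, +oo[%classic.
  apply/seteqP; split => x /=; rewrite !in_itv/= !andbT; first by move=> [_ h].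
  by move=> yx; split; [exact: le_trans y0 yx | exact: yx].
by apply: (etrans (tail y y0)); rewrite EFinM.
Qed.

End NormalSecondMoment.

Section StepFunctions.
Context {R : realType}.
Local Notation mu := (@lebesgue_measure R).

(** Written with the four distances between endpoints because each of them is the variance of a
    Brownian increment, the form in which polarization delivers a covariance. *)
Lemma itv_overlap (T a b c e : R) : 0 <= a -> a <= b -> b <= T -> 0 <= c -> c <= e -> e <= T ->
  \int[mu]_(x in `[0, T]) (\1_(`]a, b]%classic) x * \1_(`]c, e]%classic) x) =
   2^-1 * (`|a - e| + `|b - c| - `|b - e| - `|a - c|).
Proof.
move=> a0 ab bT c0 ce eT.
have mab : measurable (`]a, b]%classic : set (measurableTypeR R)) by exact: measurable_itv.
have mce : measurable (`]c, e]%classic : set (measurableTypeR R)) by exact: measurable_itv.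
have -> : \int[mu]_(x in `[0, T]) (\1_(`]a, b]%classic) x * \1_(`]c, e]%classic) x) =
  fine (mu (`]Num.max a c, Num.min b e]%classic)).
  have E : (`]a, b]%classic `&` `]c, e]%classic : set (measurableTypeR R)) = `]Num.max a c, Num.min b e]%classic.
    apply/seteqP; split => x /=; rewrite !in_itv/= gt_max le_min.
      by move=> [/andP[-> ->] /andP[-> ->]].
    by move=> /andP[/andP[-> ->] /andP[-> ->]].
  have <- : (\int[mu]_(x in `[0%R, T]) (\1_(`]Num.max a c, Num.min b e]%classic : set (measurableTypeR R)) x)%:E =
      mu (`]Num.max a c, Num.min b e]%classic))%E.
    rewrite integral_indic//; congr (mu _); apply/seteqP; split => x /=; first by case.
    rewrite !in_itv/= gt_max le_min => /andP[/andP[h1 h2] /andP[h3 h4]].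
    by rewrite h1 h2 h3 h4; split => //; apply/andP; split; lra.
  rewrite /Rintegral; congr fine; apply: eq_integral => x _; congr EFin.
  by rewrite -E indicI.
rewrite lebesgue_measure_itv/= lte_fin.
case: (leP c b) => cb; last first.
  have ae : a - e <= 0 by lra.
  have bc : b - c <= 0 by lra.
  have be : b - e <= 0 by lra.
  have ac : a - c <= 0 by lra.
  rewrite !ler0_norm// ltNge (le_trans (y := c))//=; first by lra.
    by rewrite ge_min (ltW cb).
  by rewrite le_max lexx orbT.
case: (leP a e) => ae; last first.
  have ae' : 0 <= a - e by lra.
  have bc : 0 <= b - c by lra.
  have be : 0 <= b - e by lra.
  have ac : 0 <= a - c by lra.
  rewrite !ger0_norm// ltNge (le_trans (y := a))//=; first by lra.
    by rewrite ge_min (ltW ae) orbT.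
  by rewrite le_max lexx.
rewrite (@ler0_norm _ (a - e)) ?subr_le0// (@ger0_norm _ (b - c)) ?subr_ge0//.
have -> : Num.min b e = 2^-1 * (b + e - `|b - e|).
  by case: (leP b e) => be; [rewrite ler0_norm ?subr_le0//|rewrite ger0_norm ?subr_ge0 ?(ltW be)//]; lra.
have -> : Num.max a c = 2^-1 * (a + c + `|a - c|).
  by case: (leP a c) => ac; [rewrite ler0_norm ?subr_le0//|rewrite ger0_norm ?subr_ge0 ?(ltW ac)//]; lra.
have h : 2^-1 * (a + c + `|a - c|) <= 2^-1 * (b + e - `|b - e|).
  by rewrite ler_pM2l//; case: (ger0P (a - c)); case: (ger0P (b - e)) => *; lra.
by move: h; rewrite le_eqVlt => /orP[/eqP E|->]; [rewrite E ltxx/=|rewrite /=]; lra.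
Qed.

End StepFunctions.

Section Density.
Import HBNNSimple.
Context {d : measure_display} {X : measurableType d} {R : realType}.
Variables (m Q : {measure set X -> \bar R}) (D : X -> R).
Hypothesis mD : measurable_fun setT D.
Hypothesis D0 : forall x, 0 <= D x.
Hypothesis QD : forall A, measurable A -> Q A = (\int[m]_(x in A) (D x)%:E)%E.

Lemma ge0_integral_density (f : X -> R) : measurable_fun setT f -> (forall x, 0 <= f x) ->
  (\int[Q]_x (f x)%:E = \int[m]_x (f x * D x)%:E)%E.
Proof.
move=> mf f0.
have mfE : measurable_fun setT (EFin \o f) by exact/measurable_EFinP.
pose f_ := nnsfun_approx measurableT mfE.
have cvf (x : X) : (f_ n x)%:E @[n --> \oo] --> (f x)%:E.
  by apply: (@cvg_nnsfun_approx _ _ _ _ measurableT _ mfE) => // y _ /=; rewrite lee_fin.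
have ndf (x : X) : {homo (fun n => f_ n x) : a b / (a <= b)%N >-> a <= b}.
  by move=> a b ab; exact/lefP/nd_nnsfun_approx.
transitivity (limn (fun n => \int[Q]_x (f_ n x)%:E))%E.
  rewrite -monotone_convergence//.
  - by apply: eq_integral => y _; apply/esym/cvg_lim => //; exact: cvf.
  - by move=> n; exact/measurable_EFinP/measurable_funP.
  - by move=> n y _; rewrite lee_fin.
  - by move=> y _ a b ab; rewrite lee_fin ndf.
transitivity (limn (fun n => \int[m]_x (f_ n x * D x)%:E))%E; last first.
  rewrite -monotone_convergence//.
  - apply: eq_integral => y _; apply/cvg_lim => //.
    have -> : (fun n => (f_ n y * D y)%:E) = (fun n => (f_ n y)%:E * (D y)%:E)%E by apply/funext => n; rewrite EFinM.
    by rewrite EFinM; apply: cvgeZr => //; exact: cvf.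
  - move=> n; apply/measurable_EFinP; apply: measurable_funM => //.
  - by move=> n y _; rewrite lee_fin mulr_ge0.
  - by move=> y _ a b ab; rewrite lee_fin ler_wpM2r// ndf.
congr (limn _); apply/funext => n.
rewrite integralT_nnsfun sintegralE.
transitivity (\sum_(k \in range (f_ n)) \int[m]_x (k * (\1_(f_ n @^-1` [set k]) x * D x))%:E)%E.
  apply: eq_fsbigr => r /set_mem [x _ <-].
  rewrite QD//.
  under [in RHS]eq_integral do rewrite EFinM.
  rewrite ge0_integralZl_EFin//.
  - congr (_ * _)%E; rewrite integral_mkcond; apply: eq_integral => y _.
    rewrite patchE indicE; case: ifP => _; last by rewrite mul0r.
    by rewrite mul1r.
  - by move=> y _; rewrite lee_fin mulr_ge0.
  - by apply/measurable_EFinP; apply: measurable_funM.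
rewrite -ge0_integral_fsum//.
- by apply: eq_integral => x _; rewrite fsumEFin//; congr EFin; rewrite [in RHS]fimfunE mulr_fsuml//; apply: eq_fsbigr => k _; rewrite mulrA.
- by move=> r; apply/measurable_EFinP; apply: measurable_funM => //; apply: measurable_funM.
- by move=> r x _; rewrite mulrA EFinM EFinM; apply: mule_ge0; [exact: nnfun_muleindic_ge0|rewrite lee_fin].
Qed.

End Density.

Section NormalMoment.
Context {R : realType}.
Local Notation mu := (@lebesgue_measure R).

Lemma normal_second_moment (v : R) : 0 < v ->
  (\int[normal_prob 0%R (Num.sqrt v)]_x (x ^+ 2)%:E = v%:E)%E.
Proof.
move=> v0; have s0 : Num.sqrt v != 0 by rewrite gt_eqF// sqrtr_gt0.
pose p := normal_pdf 0 (Num.sqrt v).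
pose g (x : R) := expR (- x ^+ 2 / (v *+ 2)).
have pE x : p x = normal_peak (Num.sqrt v) * g x.
  by rewrite /p normal_pdfE// /normal_fun subr0 sqr_sqrtr ?ltW.
have k0 : 0 <= normal_peak (Num.sqrt v) by exact: normal_peak_ge0.
rewrite (ge0_integral_density (m := mu) (D := p)); last 5 first.
- exact: measurable_normal_pdf.
- exact: normal_pdf_ge0.
- by [].
- exact: measurable_funX.
- by move=> x; exact: sqr_ge0.
have cg : continuous g.
  move=> x; apply/differentiable_continuous/derivable1_diffP.
  rewrite /g. by [].
have mg D : measurable_fun D g.
  by apply: measurable_funTS; exact: continuous_measurable_fun.
(* The Gaussian integral is not evaluated: the total mass 1 of the normal law provides it. *)
have N : (\int[mu]_x (normal_peak (Num.sqrt v) * g x)%:E = 1)%E.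
  by rewrite -[RHS](integral_normal_pdf 0 (Num.sqrt v)); apply: eq_integral => x _; rewrite -pE.
have Z (f : R -> R) : (forall x, 0 <= f x) -> continuous f -> (\int[mu]_x (normal_peak (Num.sqrt v) * f x)%:E =
   (normal_peak (Num.sqrt v))%:E * \int[mu]_x (f x)%:E)%E.
  move=> f0 cf; under eq_integral do rewrite EFinM.
  apply: ge0_integralZl_EFin; first exact: measurableT.
  - by move=> x _; rewrite lee_fin.
  - by apply/measurable_EFinP; exact: continuous_measurable_fun.
  - exact: k0.
have cg2 : continuous (fun x : R => x ^+ 2 * g x).
  by move=> x; apply: cvgM; [exact: sqr_continuous|exact: cg].
have g20 x : 0 <= x ^+ 2 * g x by rewrite mulr_ge0 ?sqr_ge0 ?expR_ge0.
have g0 x : 0 <= g x by exact: expR_ge0.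
transitivity (\int[mu]_x (normal_peak (Num.sqrt v) * (x ^+ 2 * g x))%:E)%E.
  by apply: eq_integral => x _; rewrite pE mulrCA.
have S : [set x : R | 0 <= x] = `[0, +oo[%classic by rewrite set_itvcy.
rewrite Z// ge0_symfun_integralT//; last by move=> x; rewrite /g /= sqrrN.
rewrite S integral_sqr_gauss// -[RHS]mule1 -N Z// (ge0_symfun_integralT _ cg)//; last by move=> x; rewrite /g /= sqrrN.
rewrite S; set G := (\int[mu]_(x in _) _)%E.
by rewrite (muleCA 2 v%:E G)%E (muleCA _ v%:E)%E.
Qed.

End NormalMoment.

Lemma second_moment_normal d (X : measurableType d) (R : realType) (P : probability X R)
   (f : {RV P >-> R}) (v : R) : 0 < v ->
  (forall U : set R, measurable U -> P (f @^-1` U) = normal_prob 0 (Num.sqrt v) U) ->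
  (\int[P]_w (f w ^+ 2)%:E = v%:E)%E.
Proof.
move=> v0 law; rewrite -[RHS](normal_second_moment v0).
have mf : measurable_fun setT (f : X -> measurableTypeR R) by exact: (measurable_funPT f).
pose pf : {measure set (measurableTypeR R) -> \bar R} := pushforward P (f : X -> measurableTypeR R).
transitivity (\int[pf mf]_x (x ^+ 2)%:E)%E; last first.
  by apply: eq_measure_integral => A mA _; exact: law.
rewrite ge0_integral_pushforward//.
  by apply/measurable_EFinP; exact: measurable_funX.
by move=> x _; rewrite lee_fin sqr_ge0.
Qed.

(** * The Wiener isometry *)

Section Wiener.
Context {dsp : measure_display} {Omega : measurableType dsp} {R : realType}.
Local Notation mu := (@lebesgue_measure R).
Variables (P : probability Omega R) (T : R) (W : R -> {mfun Omega >-> R}).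
Hypothesis Wlaw : forall s t : R, 0 <= s -> s < t -> t <= T ->
  forall U : set R, measurable U ->
    P ((fun w => W t w - W s w) @^-1` U) = normal_prob 0 (Num.sqrt (t - s)) U.

Local Notation I := (`[0, T]%classic : set (measurableTypeR R)).
Local Notation sqP := (sqint P setT).
Local Notation dotP := (dotp P setT).
Local Notation sqI := (sqint mu I).
Local Notation dotI := (dotp mu I).

Let mI : measurable I.
Proof. exact: measurable_itv. Qed.
Let mT : measurable [set: Omega].
Proof. exact: measurableT. Qed.

Let incr s t (w : Omega) := W t w - W s w.

Let incr_sq (s t : R) : 0 <= s -> s <= t -> t <= T ->
  sqP (incr s t) /\ dotP (incr s t) (incr s t) = t - s.
Proof.
move=> s0; rewrite le_eqVlt => /orP[/eqP<-|st] tT.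
  have z w : incr s s w = 0 by rewrite /incr subrr.
  have e : incr s s = cst 0 by apply/funext.
  by rewrite e subrr; split; [exact: sqint0|exact: dotp0l].
pose f : {RV P >-> R} := (W t \- W s)%R.
have E := second_moment_normal (P := P) (f := f) (v := t - s) _ (Wlaw s0 st tT).
have st' : 0 < t - s by rewrite subr_gt0.
have sq : sqP (incr s t).
  split; first by apply: measurable_funB; exact: measurable_funPT.
  by have -> := E st'; rewrite ltry.
split => //; apply: EFin_inj; rewrite -dotpEFin//; exact: E.
Qed.

(** Subtracting [W 0] makes [Z t] itself an increment, whose law is known. *)
Let Z t (w : Omega) := W t w - W 0 w.

Let Zsq t : 0 <= t -> t <= T -> sqP (Z t).
Proof. by move=> t0 tT; have [] := incr_sq (lexx 0) t0 tT. Qed.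

Let Zdist s t : 0 <= s -> s <= T -> 0 <= t -> t <= T ->
  dotP (Z s) (Z s) - 2 * dotP (Z s) (Z t) + dotP (Z t) (Z t) = `|s - t|.
Proof.
wlog st : s t / s <= t.
  move=> hw s0 sT t0 tT; case: (leP s t) => [st|/ltW ts]; first exact: hw.
  by rewrite distrC -(hw t s)// (dotpC _ _ (Z t)); ring.
move=> s0 sT t0 tT; rewrite ler0_norm ?subr_le0// opprB.
have [_ <-] := incr_sq s0 st tT.
have -> : incr s t = (fun w => Z t w - Z s w).
  by apply/funext => w; rewrite /Z /incr; ring.
have z1 := Zsq s0 sT; have z2 := Zsq t0 tT; have z3 := sqintB mT z2 z1.
by rewrite dotpBB// (dotpC _ _ (Z t) (Z s)); ring.
Qed.

(* Polarization: the covariance of increments is a combination of variances of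
   increments, so only their one-dimensional laws are used. *)
Let incr_dotp a b c e : 0 <= a -> a <= b -> b <= T -> 0 <= c -> c <= e -> e <= T ->
  dotP (incr a b) (incr c e) = dotI (\1_(`]a, b]%classic)) (\1_(`]c, e]%classic)).
Proof.
move=> a0 ab bT c0 ce eT.
have [b0 e0 aT cT] : [/\ 0 <= b, 0 <= e, a <= T & c <= T].
  by split; [exact: le_trans ab|exact: le_trans ce|exact: le_trans bT|exact: le_trans eT].
rewrite /dotp itv_overlap//.
rewrite -(Zdist a0 aT e0 eT) -(Zdist b0 bT c0 cT) -(Zdist b0 bT e0 eT) -(Zdist a0 aT c0 cT).
have eZ x y : incr x y = (fun w => Z y w - Z x w).
  by apply/funext => w; rewrite /Z /incr; ring.
rewrite -/(dotP _ _) !eZ.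
have za := Zsq a0 aT; have zb := Zsq b0 bT; have zc := Zsq c0 cT; have ze := Zsq e0 eT.
have zec := sqintB mT ze zc.
rewrite (dotpBB mT zb za ze zc); lra.
Qed.

Let term (p : R * R * R) (x : R) : R := let: (c, a, b) := p in c * \1_(`]a, b]%classic) x.
Let termW (p : R * R * R) (w : Omega) : R := let: (c, a, b) := p in c * (W b w - W a w).
Let good (p : R * R * R) := let: (c, a, b) := p in 0 <= a /\ a <= b /\ b <= T.

Let indic_sq a b : sqI (\1_(`]a, b]%classic)).
Proof.
apply: (sqint_le mI _ (sqint_cst mI 1 (lebesgue_measure_itvcc_lty 0 T))).
  by apply: measurable_indic; exact: measurable_itv.
by move=> x _; rewrite indicE; case: (x \in _); rewrite /= ?normr0 ?normr1.
Qed.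

Let term_sq p : sqI (term p).
Proof. by case: p => [[c a] b]; apply: sqintZ => //; exact: indic_sq. Qed.

Let termW_sq p : good p -> sqP (termW p).
Proof.
by case: p => [[c a] b] [a0 [ab bT]]; apply: sqintZ => //; have [] := incr_sq a0 ab bT.
Qed.

Let term_iso p q : good p -> good q -> dotP (termW p) (termW q) = dotI (term p) (term q).
Proof.
case: p => [[c a] b]; case: q => [[c' a'] b'] [a0 [ab bT]] [a0' [ab' bT']].
have s1 := indic_sq a b; have s2 := indic_sq a' b'.
have [t1 _] := incr_sq a0 ab bT; have [t2 _] := incr_sq a0' ab' bT'.
have s2' := sqintZ mI c' s2; have t2' := sqintZ mT c' t2.
rewrite /termW /term dotpZl// dotpZr// (dotpZl mI c s1 s2') dotpZr//.
by rewrite -(incr_dotp a0 ab bT a0' ab' bT').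
Qed.

Let stepfE s : step_fun s = fun x => \sum_(p <- s) term p x.
Proof. by []. Qed.

Let stepWE s : step_integral W s = fun w => \sum_(p <- s) termW p w.
Proof. by []. Qed.

Let step_fun_nil : step_fun [::] = (fun=> 0) :> (R -> R).
Proof. by apply/funext => x; rewrite stepfE big_nil. Qed.

Let step_integral_nil : step_integral W [::] = (fun=> 0).
Proof. by apply/funext => x; rewrite stepWE big_nil. Qed.

Let step_fun_cons p s : step_fun (p :: s) = fun x => term p x + step_fun s x.
Proof. by apply/funext => x; rewrite stepfE big_cons. Qed.

Let step_integral_cons p s : step_integral W (p :: s) = fun x => termW p x + step_integral W s x.
Proof. by apply/funext => x; rewrite stepWE big_cons. Qed.

Let step_in_cons p s : step_in T (p :: s) -> good p /\ step_in T s.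
Proof.
move=> h; split; first by case: p h => [[c a] b] h; apply: (h c); rewrite inE eqxx.
by move=> c a b ps; apply: (h c); rewrite inE ps orbT.
Qed.

Lemma step_fun_sq s : sqI (step_fun s).
Proof.
elim: s => [|p s IH].
  by rewrite step_fun_nil; exact: sqint0.
by rewrite step_fun_cons; apply: sqintD => //; exact: term_sq.
Qed.

Lemma step_integral_sq s : step_in T s -> sqP (step_integral W s).
Proof.
elim: s => [_|p s IH].
  by rewrite step_integral_nil; exact: sqint0.
move=> /step_in_cons[gp gs]; rewrite step_integral_cons; apply: sqintD => //.
  exact: termW_sq.
exact: IH.
Qed.

(** Bilinearity, by an induction on each list in turn, reduces to pairs of intervals. Those may
    overlap arbitrarily, even within one list, which is why [incr_dotp] covers every pair. *)
Lemma step_iso s s' : step_in T s -> step_in T s' ->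
  dotP (step_integral W s) (step_integral W s') = dotI (step_fun s) (step_fun s').
Proof.
move=> + gs'; have t1 := step_integral_sq gs'; have t2 := step_fun_sq s'.
elim: s => [_|p s IH].
  by rewrite step_fun_nil step_integral_nil !dotp0l.
move=> /step_in_cons[gp gs]; rewrite step_integral_cons step_fun_cons.
have u1 := step_integral_sq gs; have u2 := step_fun_sq s.
have v1 := termW_sq gp; have v2 := term_sq p.
rewrite dotpDl// (dotpDl mI v2 u2 t2) IH//; congr (_ + _).
elim: s' gs' t1 t2 {IH gs u1 u2} => [_ _ _|q s' IH].
  by rewrite step_fun_nil step_integral_nil dotpC (dotpC mu) !dotp0l.
move=> /step_in_cons[gq gs'] _ _.
have u1 := step_integral_sq gs'; have u2 := step_fun_sq s'.
have w1 := termW_sq gq; have w2 := term_sq q.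
rewrite step_integral_cons step_fun_cons dotpDr// (dotpDr mI w2 u2 v2) IH//.
by congr (_ + _); exact: term_iso.
Qed.

(** [is_wiener_integral] recast: one horizon [T] for all integrands, limits of real inner products,
    and [X] a plain function, so that linear combinations are directly of this form. *)
Definition wiener (f : R -> R) (X : Omega -> R) : Prop :=
  [/\ sqI f, sqP X & exists s : nat -> seq (R * R * R),
    [/\ forall n, step_in T (s n),
       dotI (fun x => f x - step_fun (s n) x) (fun x => f x - step_fun (s n) x) @[n --> \oo] --> (0 : R)
     & dotP (fun w => X w - step_integral W (s n) w) (fun w => X w - step_integral W (s n) w)
         @[n --> \oo] --> (0 : R)]].

Lemma wiener_iso f X : wiener f X -> dotP X X = dotI f f.
Proof.
move=> [sf sX [s [sT c1 c2]]].
have h1 := dotp_cvg mI sf (fun n => step_fun_sq (s n)) c1.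
have h2 := dotp_cvg mT sX (fun n => step_integral_sq (sT n)) c2.
have e : (fun n => dotP (step_integral W (s n)) (step_integral W (s n))) =
    (fun n => dotI (step_fun (s n)) (step_fun (s n))) by apply/funext => n; exact: step_iso.
rewrite e in h2; exact: (cvg_unique _ h2 h1).
Qed.

Let dotp_lincomb2_cvg0 d (X : measurableType d) (m : {measure set X -> \bar R}) (D : set X) (mD : measurable D)
   (f g : nat -> X -> R) : (forall n, sqint m D (f n)) -> (forall n, sqint m D (g n)) ->
  dotp m D (f n) (f n) @[n --> \oo] --> (0 : R) ->
  dotp m D (g n) (g n) @[n --> \oo] --> (0 : R) -> forall k l : R,
  dotp m D (fun x => k * f n x + l * g n x) (fun x => k * f n x + l * g n x) @[n --> \oo] --> (0 : R).
Proof.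
move=> sf sg f0 g0 k l.
apply: (@squeeze_cvgr _ _ _ _ (cst 0) (fun n => 2 * k ^+ 2 * dotp m D (f n) (f n) + 2 * l ^+ 2 * dotp m D (g n) (g n))).
- near=> n; rewrite /= dotp_ge0/=.
  have skf := sqintZ mD k (sf n); have slg := sqintZ mD l (sg n).
  (* Parallelogram argument: as the norm of the difference is nonnegative, the square norm of the
     sum is at most twice the sum of the square norms. *)
  have := dotp_ge0 m D (fun x => k * f n x - l * g n x).
  rewrite dotpBB// dotp_lincomb2// !dotpZl// !dotpZr// (dotpC _ _ (g n) (f n)); lra.
- exact: cvg_cst.
- rewrite -[X in _ --> X](addr0 0) -[X in _ --> X + _](mulr0 (2 * k ^+ 2)) -[X in _ --> _ + X](mulr0 (2 * l ^+ 2)).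
  by apply: cvgD; apply: cvgMr.
Unshelve. all: by end_near. Qed.

Lemma wiener_lin (k l : R) f g X Y : wiener f X -> wiener g Y ->
  wiener (fun x => k * f x + l * g x) (fun w => k * X w + l * Y w).
Proof.
move=> [sf sX [s [sT c1 c2]]] [sg sY [s' [sT' c1' c2']]]; split.
- exact: sqint_lincomb2.
- exact: sqint_lincomb2.
pose sc (k : R) (p : R * R * R) := let: (c, a, b) := p in (k * c, a, b).
have scF u v x : step_fun (map (sc u) v) x = u * step_fun v x.
  rewrite !stepfE big_map mulr_sumr; apply: eq_bigr => -[[c a] b] _ /=; ring.
have scW u v x : step_integral W (map (sc u) v) x = u * step_integral W v x.
  rewrite !stepWE big_map mulr_sumr; apply: eq_bigr => -[[c a] b] _ /=; ring.
have catF u v x : step_fun (u ++ v) x = step_fun u x + step_fun v x by rewrite /step_fun big_cat.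
have catW u v x : step_integral W (u ++ v) x = step_integral W u x + step_integral W v x.
  by rewrite /step_integral big_cat.
exists (fun n => map (sc k) (s n) ++ map (sc l) (s' n)); split.
- move=> n c a b; rewrite mem_cat => /orP[] /mapP[[[c' a'] b'] h [_ -> ->]].
    exact: sT h.
  exact: sT' h.
- have E n : (fun x => k * f x + l * g x - step_fun (map (sc k) (s n) ++ map (sc l) (s' n)) x) =
      (fun x => k * (f x - step_fun (s n) x) + l * (g x - step_fun (s' n) x)).
    by apply/funext => x; rewrite catF !scF; ring.
  under eq_cvg do rewrite E.
  by apply: dotp_lincomb2_cvg0 => // n; apply: sqintB => //; exact: step_fun_sq.
- have E n : (fun x => k * X x + l * Y x - step_integral W (map (sc k) (s n) ++ map (sc l) (s' n)) x) =
      (fun x => k * (X x - step_integral W (s n) x) + l * (Y x - step_integral W (s' n) x)).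
    by apply/funext => x; rewrite catW !scW; ring.
  under eq_cvg do rewrite E.
  by apply: dotp_lincomb2_cvg0 => // n; apply: sqintB => //; exact: step_integral_sq.
Qed.

Lemma wiener_dotp f g X Y : wiener f X -> wiener g Y -> dotP X Y = dotI f g.
Proof.
move=> w1 w2; have w3 := wiener_lin 1 1 w1 w2.
have := wiener_iso w1; have := wiener_iso w2; have := wiener_iso w3.
have [sf sX _] := w1; have [sg sY _] := w2.
rewrite dotp_lincomb2// (dotp_lincomb2 mI _ _ sf sg); lra.
Qed.

(** By linearity and the isometry, [X - Y] has the norm of [f - g], which is 0. *)
Lemma wiener_uniq f g X Y : wiener f X -> wiener g Y ->
  {ae mu, forall x, I x -> f x = g x} -> {ae P, forall w, X w = Y w}.
Proof.
move=> w1 w2 fg; have w3 := wiener_lin 1 (-1) w1 w2.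
have [s3 S3 _] := w3.
have D0 : dotI (fun x => 1 * f x + -1 * g x) (fun x => 1 * f x + -1 * g x) = 0.
  have s0 := sqint0 mu I.
  transitivity (dotI (fun=> 0) (fun=> 0)).
    have h : {ae mu, forall x, I x -> 1 * f x + -1 * g x = 0}.
      by move: fg; apply: filterS => x h Ix; rewrite (h Ix); ring.
    exact: (ae_eq_dotp mI s3 s0 s3 s0 h h).
  exact: dotp0l.
have := wiener_iso w3; rewrite D0 => /(dotp_eq0 mT S3).
apply: filterS => w /(_ Logic.I) h; apply/eqP; rewrite -subr_eq0 -h; apply/eqP; ring.
Qed.

(** Passes from the horizon [t] to [T] by extending the integrand by 0; the approximating step
    functions already vanish beyond [t]. Agreement is asked on the open interval, which leaves out
    [s = 0], where [KH] is junk. *)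
Lemma wiener_of_integral t f g (X : {mfun Omega >-> R}) : 0 <= t -> t <= T ->
  is_wiener_integral P t W f X -> measurable_fun I g ->
  (forall x, 0 < x -> x < t -> g x = f x) -> (forall x, t < x -> x <= T -> g x = 0) ->
  wiener g X.
Proof.
move=> t0 tT [L2f [s [sin cf cX]]] mg gf g0.
have sT n : step_in T (s n).
  by move=> c a b /sin [h1 [h2 h3]]; split => //; split => //; exact: le_trans tT.
pose J := (`[0, t]%classic : set (measurableTypeR R)).
have mf : measurable_fun J f.
  apply/(measurable_restrictT _ (measurable_itv _)); move: L2f; rewrite /L2 inE => /andP[].
  by rewrite inE.
have mst n : measurable_fun I (step_fun (s n)) by have [] := step_fun_sq (s n).
have st0 n x : t < x -> step_fun (s n) x = 0.
  move=> tx; rewrite stepfE big_seq big1// => -[[c a] b] /sin [_ [_ bt]] /=.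
  rewrite indicE memNset ?mulr0//= in_itv/= => /andP[_ xb].
  by have := lt_le_trans tx (le_trans xb bt); rewrite ltxx.
have eqn n : (\int[mu]_(x in I) ((g x - step_fun (s n) x) ^+ 2)%:E =
     \int[mu]_(x in `[0%R, t]) ((f x - step_fun (s n) x) ^+ 2)%:E)%E.
  transitivity (\int[mu]_(x in `[0%R, t]) ((g x - step_fun (s n) x) ^+ 2)%:E)%E.
    rewrite integral_mkcond [RHS]integral_mkcond; apply: eq_integral => x _.
    rewrite !patchE; case: ifPn => [/set_mem|/negP hI] /=; case: ifPn => [/set_mem|/negP hJ]//=.
      rewrite in_itv/= => /andP[x0 xT]; rewrite g0 ?st0 ?subr0 ?expr0n//.
        by rewrite ltNge; apply/negP => xt; apply: hJ; apply: mem_set; rewrite /= in_itv/= x0.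
      by rewrite ltNge; apply/negP => xt; apply: hJ; apply: mem_set; rewrite /= in_itv/= x0.
    rewrite in_itv/= => /andP[x0 xt]; exfalso; apply: hI; apply: mem_set.
    by rewrite /= in_itv/= x0 (le_trans xt).
  have JI : `]0, t[%classic `<=` I.
    by move=> x /=; rewrite !in_itv/= => /andP[x0 xt]; rewrite (ltW x0) (le_trans (ltW xt)).
  have JJ : `]0, t[%classic `<=` J.
    by move=> x; rewrite /J/= !in_itv/= => /andP[x0 xt]; rewrite (ltW x0) (ltW xt).
  apply: eq_integral_itv_bounded.
  - apply: measurable_funX; apply: measurable_funB; [exact: (measurable_funS mI JI mg)|exact: (measurable_funS mI JI (mst n))].
  - apply: measurable_funX; apply: measurable_funB; [exact: (measurable_funS (measurable_itv _) JJ mf)|exact: (measurable_funS mI JI (mst n))].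
  - by move=> x; rewrite in_itv/= => /andP[x0 xt]; rewrite gf.
(* Square integrability of [X] is not given. It follows because convergence to 0 makes its distance
   to some step integral finite. *)
have fin_ev d (Y : measurableType d) (m : {measure set Y -> \bar R}) (D : set Y) (h : nat -> Y -> R) :
  (\int[m]_(x in D) ((h n x) ^+ 2)%:E)%E @[n --> \oo] --> 0%E ->
  exists n, (\int[m]_(x in D) ((h n x) ^+ 2)%:E < +oo)%E.
  move=> h0.
  have /fine_cvgP[[N _ hN] _] := h0.
  by exists N; have := hN N (leqnn N); rewrite fin_numE ltey => /andP[_ ->].
have sg : sqI g.
  have [n hn] := fin_ev _ _ _ _ _ cf.
  have s1 : sqI (fun x => g x - step_fun (s n) x).
    by split; [apply: measurable_funB|rewrite eqn].
  have := sqintD mI s1 (step_fun_sq (s n)).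
  by apply: eq_sqint => x _; rewrite subrK.
have sX : sqP X.
  have [n hn] := fin_ev _ _ _ _ _ cX.
  have s0 := step_integral_sq (sT n).
  have s1 : sqP (fun x => X x - step_integral W (s n) x).
    by split; [apply: measurable_funB => //; case: s0|].
  have := sqintD mT s1 s0.
  by apply: eq_sqint => x _; rewrite subrK.
split => //; exists s; split => //.
  apply: dotp_cvg0P; first exact: mI.
    by move=> n; apply: sqintB => //; exact: step_fun_sq.
  by rewrite (_ : (fun n => _) = (fun n => \int[mu]_(x in `[0%R, t]) ((f x - step_fun (s n) x) ^+ 2)%:E)%E)//; apply/funext => n.
apply: dotp_cvg0P => // n; apply: sqintB => //; exact: step_integral_sq.
Qed.

End Wiener.

(** * Test drifts *)

Lemma continuous_norm_powR (R : realType) (r : R) : 0 < r -> continuous (fun x : R => `|x| `^ r).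
Proof.
move=> r0 x; have [->|x0] := eqVneq x 0.
  rewrite /continuous_at normr0 powR0 ?gt_eqF//; apply/cvgrPdist_lt => e e0.
  have e1 : 0 < e `^ r^-1 by exact: powR_gt0.
  near=> y; rewrite sub0r normrN ger0_norm ?powR_ge0//.
  have ye : `|y| < e `^ r^-1.
    by near: y; apply: (cvgr0_norm_lt (F := nbhs (0 : R)) id) => //; exact: cvg_id.
  have -> : e = (e `^ r^-1) `^ r by rewrite -powRrM mulVf ?gt_eqF// powRr1 ?ltW.
  by apply: gt0_ltr_powR => //; rewrite nnegrE ?powR_ge0.
have nx : 0 < `|x| by rewrite normr_gt0.
have h : {for `|x|, continuous (fun y : R => (y - 0) `^ r)} by exact: continuous_powR_shift.
have h' : {for `|x|, continuous (fun y : R => y `^ r)}.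
  have e2 : (fun y : R => (y - 0) `^ r) = (fun y : R => y `^ r) by apply/funext => y; rewrite subr0.
  by rewrite e2 in h.
apply: (continuous_comp (f := fun x : R => `|x|) (g := fun y : R => y `^ r)) => //.
exact: norm_continuous.
Unshelve. all: by end_near. Qed.

(** An abstract primitive on a bounded interval avoids the signed formula for the primitive of
    [|x|^(2H)]. *)
Lemma continuous_primitive (R : realType) (q : R -> R) (A : R) : continuous q ->
  exists p : R -> R, forall x, - A < x -> x < A -> is_derive x (1 : R) p (q x).
Proof.
move=> cq; exists (fun y => \int[lebesgue_measure]_(t in `[- A, y]) q t) => x Ax xA.
have cI : lebesgue_measure.-integrable `[- A, A] (EFin \o q).
  apply: continuous_compact_integrable; first exact: segment_compact.
  exact: continuous_subspaceT.
have [d1 d2] := continuous_FTC1_closed xA cI Ax (cq x).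
by split; [exact: d1|rewrite -derive1E; exact: d2].
Qed.

Lemma integral_of_derive (R : realType) (F f : R -> R) (a b : R) : a <= b ->
  (forall x, a <= x <= b -> is_derive x (1 : R) F (f x)) -> continuous f ->
  \int[lebesgue_measure]_(x in `[a, b]) f x = F b - F a.
Proof.
move=> + dF cf; rewrite le_eqVlt => /orP[/eqP<-|ab]; first by rewrite subrr set_itv1 Rintegral_set1.
have cF x : a <= x <= b -> {for x, continuous F}.
  by move=> /dF [dx _]; apply/differentiable_continuous/derivable1_diffP.
rewrite /Rintegral (continuous_FTC2 (F := F) ab) ?fineB//.
- exact: continuous_subspaceT.
- split.
  + by move=> x; rewrite in_itv/= => /andP[ax xb]; have [] := dF x _; rewrite ?(ltW ax) ?(ltW xb).
  + by apply: cvg_at_right_filter; apply: cF; rewrite lexx ltW.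
  + by apply: cvg_at_left_filter; apply: cF; rewrite lexx ltW.
- move=> x; rewrite in_itv/= => /andP[ax xb].
  have h : a <= x <= b by rewrite (ltW ax) (ltW xb).
  by rewrite derive1E; have [_ ->] := dF x h.
Qed.

Lemma is_derive_rev (R : realType) (p : R -> R) (c x v : R) :
  is_derive (c - x) (1 : R) p v -> is_derive x (1 : R) (fun y => p (c - y)) (- v).
Proof.
move=> h.
have hs : is_derive x (1 : R) (fun y : R => c - y) (-1).
  have := @is_deriveB R R R (cst c) id x 1 _ _ (is_derive_cst _ _ _) (is_derive_id _ _).
  by rewrite sub0r.
have := @is_derive1_comp R p (fun y : R => c - y) x _ _ h hs.
by rewrite mulrN1.
Qed.

Lemma measurable_Rintegral_param_on d1 d2 (X1 : measurableType d1) (X2 : measurableType d2)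
    (R : realType) (m : {sigma_finite_measure set X2 -> \bar R}) (B : set X2)
    (f : X1 -> X2 -> R) : measurable B -> measurable_fun setT (fun p => f p.1 p.2) ->
  measurable_fun setT (fun x => \int[m]_(y in B) f x y)%R.
Proof.
move=> mB mf.
have -> : (fun x => \int[m]_(y in B) f x y) = (fun x => \int[m]_y (f x y * \1_B y)).
  apply/funext => x; rewrite Rintegral_mkcond; apply: eq_Rintegral => y _.
  by rewrite patchE indicE; case: (y \in B); rewrite ?mulr1 ?mulr0.
apply: measurable_Rintegral_param; apply: measurable_funM => //.
by apply: measurableT_comp => //; exact: measurable_indic.
Qed.

Lemma sqr_Rintegral_le d (X : measurableType d) (R : realType) (m : {measure set X -> \bar R})
    (D : set X) (mD : measurable D) (f : X -> R) (e : R) : 0 < e -> m D = e%:E -> sqint m D f ->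
  (\int[m]_(x in D) f x) ^+ 2 <= e * dotp m D f f.
Proof.
move=> e0 De sf.
have s1 : sqint m D (cst 1) by apply: sqint_cst => //; rewrite De ltry.
have f1 : dotp m D f (cst 1) = \int[m]_(x in D) f x by apply: eq_Rintegral => x _; rewrite mulr1.
have d1 : dotp m D (cst 1) (cst 1) = e.
  transitivity (\int[m]_(x in D) cst 1 x); first by apply: eq_Rintegral => x _; rewrite mulr1.
  by rewrite Rintegral_cst// De mul1r.
rewrite -f1; have [->|c0] := eqVneq (dotp m D f (cst 1)) 0.
  by rewrite expr0n/= mulr_ge0 ?dotp_ge0// ltW.
have c1 : 0 < `|dotp m D f (cst 1)| by rewrite normr_gt0.
(* With the weight [e / |(f, 1)|] the second term of Young's inequality is [|(f, 1)|], half of the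
   left side, which gives Cauchy-Schwarz. *)
have := dotp_young mD (divr_gt0 e0 c1) sf s1.
rewrite d1 invfM invrK [X in _ <= _ + X]mulrAC mulVf ?gt_eqF// mul1r => h.
have {}h : `|dotp m D f (cst 1)| <= e / `|dotp m D f (cst 1)| * dotp m D f f by lra.
rewrite -(real_normK (num_real _)) expr2 -ler_pdivlMr//.
by rewrite mulrAC.
Qed.

Section TestFunction.
Context {R : realType}.
Local Notation mu := (@lebesgue_measure R).
Variables (H T : R).
Hypotheses (T0 : 0 < T) (H0 : 0 < H) (H1 : H < 1 / 2).
Local Notation a := (1 / 2 - H).
Local Notation I := (`[0, T]%classic : set (measurableTypeR R)).
Local Notation K := (KK H).
Let q (x : R) := `|x| `^ (2 * H).

Hypothesis KKL2 : forall t, 0 <= t <= T -> sqint mu I (K t).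
Hypothesis KKcov : forall s t, 0 <= s <= T -> 0 <= t <= T ->
  dotp mu I (K s) (K t) = 2^-1 * (s `^ (2 * H) + t `^ (2 * H) - `|t - s| `^ (2 * H)).
Hypothesis c0 : cH H != 0.

Variables (t e : R).
Hypotheses (t0 : 0 < t) (tT : t <= T) (e0 : 0 < e) (et : e < t).
Local Notation J := (`[0, e]%classic : set (measurableTypeR R)).

Let mI : measurable I. Proof. exact: measurable_itv. Qed.
Let mJ : measurable J. Proof. exact: measurable_itv. Qed.
Let HH : 0 < 2 * H. Proof. by have := H0 => h; lra. Qed.

(* [K t] represents the covariance [R(t, .)], whose derivative need not be in
   L^2: it is singular at 0, through the term [u^(2H)], and at [t]. Subtracting
   [K r] cancels the first singularity, averaging over [r] smooths the second. *)
Let k r s := K (t - r) s - K r s.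
Let h s := e^-1 * \int[mu]_(r in J) k r s.

Let rng r : J r -> [/\ 0 <= r, r <= e, 0 <= t - r <= T & 0 <= r <= T].
Proof.
rewrite /= in_itv/= => /andP[r0 re]; have := et; have := tT => h1 h2.
by split => //; apply/andP; split; lra.
Qed.

Let k_sq r : J r -> sqint mu I (k r).
Proof. by move=> /rng[_ _ r1 r2]; exact: (sqintB mI (KKL2 r1) (KKL2 r2)). Qed.

(** [K (t - r) - K r] represents the increment of the process between [r] and [t - r], of variance
    [|t - 2 r|^(2H)]. *)
Let k_norm r : J r -> dotp mu I (k r) (k r) <= t `^ (2 * H).
Proof.
move=> /rng[r0 re r1 r2].
have s1 := KKL2 r1; have s2 := KKL2 r2.
rewrite /k (dotpBB mI s1 s2 s1 s2) !KKcov// !subrr normr0 powR0 ?gt_eqF//.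
have -> : `|r - (t - r)| = `|t - r - r| by rewrite distrC.
have tr : `|t - r - r| <= t by have := et; have := e0 => *; rewrite ler_norml; apply/andP; split; lra.
have := ler_powR_base (ltW HH) (normr_ge0 _) tr; lra.
Qed.

Let kdot u r : 0 <= u <= T -> J r -> dotp mu I (K u) (k r) =
  2^-1 * (q (t - r) - q (t - r - u) - q r + q (r - u)).
Proof.
move=> uT /rng[r0 re r1 r2]; rewrite /k (dotpBr mI (KKL2 r1) (KKL2 r2) (KKL2 uT)) !KKcov//.
by have /andP[tr _] := r1; rewrite /q (ger0_norm tr) (ger0_norm r0); ring.
Qed.

Let mK : measurable_fun setT (fun P : plane R => k P.1 P.2).
Proof.
have m1 : measurable_fun setT (fun P : plane R => P.1 : R) by exact: measurable_fst.
have m2 : measurable_fun setT (fun P : plane R => P.2 : R) by exact: measurable_snd.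
apply: measurable_funB; last exact: measurable_KK.
have mm : measurable_fun setT (fun P : plane R => ((t - P.1 : measurableTypeR R), P.2)).
  by apply/measurable_fun_pairP; split => //=; apply: measurable_funB.
exact: (measurableT_comp (measurable_KK H) mm).
Qed.

Let mKC : measurable_fun setT (fun P : plane R => k P.2 P.1).
Proof. exact: (measurableT_comp mK (@measurable_swap _ _ (measurableTypeR R) (measurableTypeR R))). Qed.

Let mh : measurable_fun (setT : set (measurableTypeR R)) h.
Proof.
apply: measurable_funM; first exact: measurable_cst.
exact: (measurable_Rintegral_param_on (f := fun s r => k r s) mu mJ mKC).
Qed.

Let muJ : mu J = e%:E.
Proof. by rewrite lebesgue_measure_itv/= lte_fin e0 -EFinB subr0. Qed.

Let intJ (c : R) : (\int[mu]_(x in J) c%:E = (c * e)%:E)%E.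
Proof. by rewrite EFinM -muJ -integral_cst. Qed.

(** Jensen's inequality for the average over [J]. It is stated in the extended reals because [k r s]
    need not be square integrable in [r] for every [s]. *)
Let jensen s : (((h s) ^+ 2)%:E <= (e^-1)%:E * \int[mu]_(r in J) ((k r s) ^+ 2)%:E)%E.
Proof.
have mk D : measurable_fun D (fun r => k r s).
  apply: measurable_funTS; exact: (measurable_fun_fixr (Y := measurableTypeR R) s mK).
have e1 : 0 < e^-1 by rewrite invr_gt0 e0.
have [fin|] := boolP (\int[mu]_(r in J) ((k r s) ^+ 2)%:E < +oo)%E; last first.
  rewrite -leNgt leye_eq => /eqP ->; rewrite gt0_muley ?lte_fin//; exact: leey.
have sk : sqint mu J (fun r => k r s) by split => //; exact: mk.
have := sqr_Rintegral_le mJ e0 muJ sk.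
rewrite (dotpEFin mJ sk) -EFinM lee_fin /h exprMn => Q.
apply: le_trans (ler_wpM2l (sqr_ge0 _) Q) _.
by rewrite mulrA expr2 -(mulrA e^-1) mulVf ?mulr1// gt_eqF// e0.
Qed.

(** Averaging does not increase the bound on the norm: integrate [jensen] in [s], exchange, and
    apply [k_norm]. *)
Let h_sq : sqint mu I h /\ dotp mu I h h <= t `^ (2 * H).
Proof.
have e1 : 0 <= e^-1 by rewrite invr_ge0 ltW// e0.
have mhI : measurable_fun I h by apply: measurable_funTS; exact: mh.
have mk2 : measurable_fun (I `*` J) (fun P : plane R => ((k P.2 P.1) ^+ 2)%:E).
  apply/measurable_EFinP; apply: measurable_funX.
  by apply: measurable_funTS; exact: mKC.
have mk2' : measurable_fun setT (fun s : measurableTypeR R => \int[mu]_(r in J) ((k r s) ^+ 2)%:E)%E.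
  rewrite (_ : (fun s => _) = (fun s => \int[mu]_r ((k r s) ^+ 2 * \1_J r)%:E)%E).
    apply: measurable_integral_param; apply/measurable_EFinP; apply: measurable_funM.
      by apply: measurable_funX; exact: mKC.
    apply: measurableT_comp; last exact: measurable_snd.
    by apply: measurable_indic; exact: mJ.
  apply/funext => s; rewrite integral_mkcond; apply: eq_integral => r _.
  by rewrite patchE indicE; case: (r \in J); rewrite ?mulr1 ?mulr0.
apply: (dotp_ub mI mhI).
apply: (@le_trans _ _ (\int[mu]_(s in I) ((e^-1)%:E * \int[mu]_(r in J) ((k r s) ^+ 2)%:E))%E).
  apply: ge0_le_integral => //.
  - by move=> s _; rewrite lee_fin sqr_ge0.
  - by apply/measurable_EFinP; apply: measurable_funX.
  - apply: emeasurable_funM; first exact: measurable_cst.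
    by apply: measurable_funTS; exact: mk2'.
rewrite ge0_integralZl_EFin//; last 2 first.
- by move=> s _; apply: integral_ge0 => r _; rewrite lee_fin sqr_ge0.
- by apply: measurable_funTS; exact: mk2'.
rewrite (tonelli_rect mu mu (f := fun s r => ((k r s) ^+ 2)%:E) mI mJ mk2); last first.
  by move=> s r _ _; rewrite lee_fin sqr_ge0.
apply: (@le_trans _ _ ((e^-1)%:E * \int[mu]_(r in J) (t `^ (2 * H))%:E)%E).
  apply: lee_wpmul2l; first by rewrite lee_fin.
  apply: ge0_le_integral; first exact: mJ.
  - by move=> r _; apply: integral_ge0 => s _; rewrite lee_fin sqr_ge0.
  - rewrite (_ : (fun r => _) = (fun r => \int[mu]_s ((k r s) ^+ 2 * \1_I s)%:E)%E).
      apply: measurable_funTS.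
      apply: measurable_integral_param; apply/measurable_EFinP; apply: measurable_funM.
        by apply: measurable_funX; exact: mK.
      apply: measurableT_comp; last exact: measurable_snd.
      by apply: measurable_indic; exact: mI.
    apply/funext => r; rewrite integral_mkcond; apply: eq_integral => s _.
    by rewrite patchE indicE; case: (s \in I); rewrite ?mulr1 ?mulr0.
  - exact: measurable_cst.
  - move=> r Jr; rewrite (dotpEFin mI (k_sq Jr)) lee_fin; exact: k_norm.
by rewrite intJ -EFinM lee_fin mulrCA mulVf ?mulr1// gt_eqF// e0.
Qed.

Let h_dot u : 0 <= u <= T ->
  dotp mu I (K u) h = e^-1 * \int[mu]_(r in J) dotp mu I (K u) (k r).
Proof.
move=> uT; have e1 : 0 <= e^-1 by rewrite invr_ge0 ltW// e0.
have mk D s : measurable_fun D (fun r => k r s).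
  apply: measurable_funTS; exact: (measurable_fun_fixr (Y := measurableTypeR R) s mK).
have mk' D r : measurable_fun D (fun s => k r s).
  apply: measurable_funTS; exact: (measurable_fun_fixl (Y := measurableTypeR R) r mK).
have c1 s : 0 <= e^-1 * K u s by rewrite mulr_ge0// KK_ge0.
have mKu : measurable_fun setT (fun p : plane R => K u p.2).
  have mKu : measurable_fun (setT : set (measurableTypeR R)) (K u) by exact: measurable_KKr.
  exact: (measurableT_comp mKu measurable_snd).
pose F r s := e^-1 * K u s * k r s.
transitivity (\int[mu]_(s in I) \int[mu]_(r in J) F r s).
  apply: eq_Rintegral => s _; rewrite /F.
  by rewrite (ge0_RintegralZl mu mJ (mk _ _) (c1 s)) /h mulrCA mulrA.
have sKu := sqintZ mI e^-1 (KKL2 uT).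
rewrite -(fubini_rect (m1 := mu) (m2 := mu) (f := F) mJ mI).
- have mR : measurable_fun J (fun r => dotp mu I (K u) (k r)).
    apply: measurable_funTS.
    apply: (measurable_Rintegral_param_on (f := fun r s => K u s * k r s) mu mI).
    apply: measurable_funM; last exact: mK.
    exact: mKu.
  rewrite -(ge0_RintegralZl mu mJ mR e1); apply: eq_Rintegral => r _.
  rewrite -ge0_RintegralZl//.
    by apply: eq_Rintegral => s _; rewrite /F mulrA.
  by apply: measurable_funM; [exact: measurable_KKr|exact: mk'].
- apply: measurable_funTS.
  apply: measurable_funM; last exact: mK.
  apply: measurable_funM; first exact: measurable_cst.
  exact: mKu.
pose C := 2^-1 * (dotp mu I (fun s => e^-1 * K u s) (fun s => e^-1 * K u s) + t `^ (2 * H)).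
apply: (@le_lt_trans _ _ (\int[mu]_(r in J) C%:E)%E); last first.
  by rewrite intJ ltry.
apply: ge0_le_integral => //.
- by move=> r _; apply: integral_ge0 => s _; rewrite lee_fin.
- rewrite (_ : (fun r => _) = (fun r => \int[mu]_s (`|F r s| * \1_I s)%:E)%E).
    apply: measurable_funTS.
    apply: measurable_integral_param; apply/measurable_EFinP; apply: measurable_funM.
      apply: measurableT_comp; first exact: normr_measurable.
      apply: measurable_funM; last exact: mK.
      apply: measurable_funM; first exact: measurable_cst.
      exact: mKu.
    apply: measurableT_comp; last exact: measurable_snd.
    by apply: measurable_indic; exact: mI.
  apply/funext => r; rewrite integral_mkcond; apply: eq_integral => s _.
  by rewrite patchE indicE; case: (s \in I); rewrite ?mulr1 ?mulr0.
- move=> r Jr; apply: le_trans (integral_norm_mul_le mI sKu (k_sq Jr)) _.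
  by rewrite lee_fin /C ler_pM2l ?invr_gt0// lerD2l; exact: k_norm.
Qed.

Let cq : continuous q. Proof. exact: continuous_norm_powR. Qed.

Let cc c : continuous (fun u => q (c - u)).
Proof.
move=> x; apply: (continuous_comp (f := fun x : R => c - x) (g := q)); last exact: cq.
by apply: cvgB; [exact: cvg_cst|exact: cvg_id].
Qed.

(** The derivative of [phi] below. In the average of [kdot] over [r], differentiating the terms
    [q (t - r - u)] and [q (r - u)] in [u] amounts, up to sign, to differentiating in [r], and the
    integral over [[0, e]] leaves the end values. Hence a continuous function, although the
    derivative of [q] is singular at 0. *)
Let dq : R -> R := fun u => (2 * e)^-1 * (q (t - u) - q (t - e - u) - q (e - u) + q u).

Let cdq : continuous dq.
Proof.
move=> x; apply: cvgM; first exact: cvg_cst.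
apply: cvgD; last exact: cq.
by apply: cvgB; [apply: cvgB|]; exact: cc.
Qed.

Let phi u := dotp mu I (K u) h.

Let phi_primitive u : 0 <= u <= T -> phi u = \int[mu]_(s in `[0, u]) dq s.
Proof.
move=> uT; have /andP[u0 uT'] := uT.
(* [3 T] bounds every argument of [q] below. Both sides are evaluated with the primitive [p], so
   nothing is differentiated under the integral sign. *)
have [p dp] := continuous_primitive (3 * T) cq.
have TT := T0; have ee := e0; have tt := tT; have et' := et.
rewrite /phi h_dot//.
have -> : \int[mu]_(r in J) dotp mu I (K u) (k r) =
   \int[mu]_(r in J) (2^-1 * (q (t - r) - q (t - u - r) - q r + q (r - u))).
  apply: eq_Rintegral => r /set_mem Jr; rewrite (kdot uT Jr); congr (_ * (_ - _ - _ + _)).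
  by congr q; ring.
have dr c x : - (3 * T) < c - x -> c - x < 3 * T ->
    is_derive x (1 : R) (fun y => p (c - y)) (- q (c - x)).
  by move=> h1 h2; apply: is_derive_rev; exact: dp.
have ds c x : - (3 * T) < x - c -> x - c < 3 * T ->
    is_derive x (1 : R) (fun y => p (y - c)) (q (x - c)).
  move=> h1 h2; have := @is_derive1_comp R p (fun y : R => y - c) x _ _ (dp _ h1 h2) (is_derive_shift c x).
  by rewrite mulr1.
pose P1 r := 2^-1 * (p (t - u - r) - p (t - r) - p r + p (r - u)).
have -> : \int[mu]_(r in J) (2^-1 * (q (t - r) - q (t - u - r) - q r + q (r - u))) = P1 e - P1 0.
  apply: (@integral_of_derive R P1
    (fun r => 2^-1 * (q (t - r) - q (t - u - r) - q r + q (r - u))) 0 e (ltW e0)).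
- move=> r /andP[r0 re].
  have d1 := dr t r; have d2 := dr (t - u) r; have d3 := ds u r; have d4 := dp r.
  have {}d1 := d1 ltac:(lra) ltac:(lra).
  have {}d2 := d2 ltac:(lra) ltac:(lra).
  have {}d3 := d3 ltac:(lra) ltac:(lra).
  have {}d4 := d4 ltac:(lra) ltac:(lra).
  apply: is_derive_eq; rewrite /GRing.scale/=; ring.
- move=> x; apply: cvgM; first exact: cvg_cst.
  apply: cvgD; last first.
    apply: (continuous_comp (f := fun x : R => x - u) (g := q)); last exact: cq.
    by apply: cvgB; [exact: cvg_id|exact: cvg_cst].
  apply: cvgB; last exact: cq.
  by apply: cvgB; exact: cc.
pose P2 s := (2 * e)^-1 * (p (t - e - s) - p (t - s) + p (e - s) - p (0 - s)).
have -> : \int[mu]_(s in `[0, u]) dq s = P2 u - P2 0.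
  apply: (@integral_of_derive R P2 dq 0 u u0).
- move=> r /andP[r0 re].
  have d1 := dr t r; have d2 := dr (t - e) r; have d3 := dr e r; have d4 := dr 0 r.
  have {}d1 := d1 ltac:(lra) ltac:(lra).
  have {}d2 := d2 ltac:(lra) ltac:(lra).
  have {}d3 := d3 ltac:(lra) ltac:(lra).
  have {}d4 := d4 ltac:(lra) ltac:(lra).
  apply: is_derive_eq; rewrite /GRing.scale/= /dq (_ : q r = q (0 - r)); [ring|by rewrite sub0r /q normrN].
- exact: cdq.
rewrite /P1 /P2 !subr0 sub0r (_ : t - u - e = t - e - u); last by ring.
by rewrite invfM; field; rewrite gt_eqF.
Qed.

Let dq_bound u : 0 <= u <= T -> `|dq u| <= (2 * e)^-1 * (4 * T `^ (2 * H)).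
Proof.
move=> /andP[u0 uT]; have ee : 0 <= (2 * e)^-1 by rewrite invr_ge0 mulr_ge0// ltW// e0.
rewrite /dq normrM (ger0_norm ee) ler_wpM2l//.
have b x : - T <= x -> x <= T -> 0 <= q x <= T `^ (2 * H).
  move=> x1 x2; rewrite powR_ge0/=; apply: ler_powR_base => //; first exact: ltW HH.
  by rewrite ler_norml x1.
have TT := T0; have e0' := e0; have tt := tT; have et' := et.
have /andP[b1 b1'] := b (t - u) ltac:(lra) ltac:(lra).
have /andP[b2 b2'] := b (t - e - u) ltac:(lra) ltac:(lra).
have /andP[b3 b3'] := b (e - u) ltac:(lra) ltac:(lra).
have /andP[b4 b4'] := b u ltac:(lra) ltac:(lra).
rewrite ler_norml; apply/andP; split; lra.
Qed.

Let bounded_sqint (f : R -> R) (C : R) : measurable_fun I f ->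
  (forall x, 0 <= x <= T -> `|f x| <= C) -> sqint mu I f.
Proof.
move=> mf fC; apply: (sqint_le mI mf (g := cst C)).
  by apply: sqint_cst => //; exact: lebesgue_measure_itvcc_lty.
move=> x; rewrite /= in_itv/= => xT; apply: le_trans (fC _ xT) _; exact: ler_norm.
Qed.

Let mdq (D : set (measurableTypeR R)) : measurable_fun D dq.
Proof.
apply: measurable_funTS.
exact: continuous_measurable_fun cdq.
Qed.

Let dq_sq : sqint mu I dq.
Proof. have h1 := @mdq I; have h2 := bounded_sqint h1; exact: h2 dq_bound. Qed.

Let a0 : 0 < a. Proof. by have := H1 => ?; lra. Qed.
Let a1 : a < 1. Proof. by have := H0 => ?; lra. Qed.

(** Up to a constant, the fractional integral of order [a] of [dq]. Since [(H + 1/2) + a = 1], a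
    further fractional integral of order [H + 1/2] gives a multiple of the primitive of [dq], which
    is [phi]. *)
Let abel y := \int[mu]_(u in `[0, y]) ((y - u) `^ (a - 1) * dq u).

Let mabel (D : set (measurableTypeR R)) : measurable_fun D abel.
Proof.
apply: measurable_funTS.
have -> : abel = (fun y : measurableTypeR R => \int[mu]_u (if (0 <= u) && (u <= y) then (y - u) `^ (a - 1) * dq u else 0)).
  apply/funext => y; rewrite /abel Rintegral_mkcond; apply: eq_Rintegral => u _.
  rewrite patchE; case: ifPn => [/set_mem|/negP] /=; first by rewrite in_itv/= => ->.
  by move=> h1; case: ifPn => // h2; case: h1; apply: mem_set; rewrite /= in_itv.
have m1 : measurable_fun setT (fun P : plane R => P.1 : R) by exact: measurable_fst.
have m2 : measurable_fun setT (fun P : plane R => P.2 : R) by exact: measurable_snd.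
apply: measurable_Rintegral_param; apply: measurable_fun_ifT => //.
  by apply: measurable_and; apply: measurable_fun_ler.
apply: measurable_funM.
  by apply: (measurableT_comp (measurable_powR _)); apply: measurable_funB.
have h1 := @mdq setT; exact: (measurableT_comp h1 m2).
Qed.

Let abel_bound y : 0 <= y <= T -> `|abel y| <= (2 * e)^-1 * (4 * T `^ (2 * H)) * (T `^ a / a).
Proof.
move=> /andP[y0 yT]; set M := (2 * e)^-1 * _.
have M0 : 0 <= M by apply: le_trans (dq_bound (u := 0) _); rewrite ?normr_ge0// lexx ltW.
have mY : measurable (`[0, y]%classic : set (measurableTypeR R)) by exact: measurable_itv.
have mp D : measurable_fun D (fun u : measurableTypeR R => (y - u) `^ (a - 1)).
  by apply: (measurableT_comp (measurable_powR _)); apply: measurable_funB.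
have le1 : (\int[mu]_(u in `[0%R, y]) `|((y - u) `^ (a - 1) * dq u)%:E| <= (M * (y `^ a / a))%:E)%E.
  apply: (@le_trans _ _ (\int[mu]_(u in `[0%R, y]) (M%:E * ((y - u) `^ (a - 1))%:E))%E).
    apply: ge0_le_integral => //.
    - apply: measurableT_comp => //; apply/measurable_EFinP; apply: measurable_funM; [exact: mp|exact: mdq].
    - apply: emeasurable_funM; first exact: measurable_cst.
      by apply/measurable_EFinP; exact: mp.
    - move=> u; rewrite /= in_itv/= => /andP[u0 uy]; rewrite -EFinM lee_fin normrM mulrC.
      rewrite (ger0_norm (powR_ge0 _ _)) ler_wpM2r ?powR_ge0//; apply: dq_bound.
      by rewrite u0 (le_trans uy).
  rewrite ge0_integralZl_EFin//; last 2 first.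
  - by move=> u _; rewrite lee_fin powR_ge0.
  - by apply/measurable_EFinP; exact: mp.
  by rewrite integral_powR_shift_rev// subr0 -EFinM.
have ii : mu.-integrable `[0, y] (EFin \o (fun u => (y - u) `^ (a - 1) * dq u)).
  apply/integrableP; split; last by apply: le_lt_trans le1 (ltry _).
  by apply/measurable_EFinP; apply: measurable_funM; [exact: mp|exact: mdq].
apply: le_trans (le_normr_Rintegral mY ii) _.
apply: (@le_trans _ _ (M * (y `^ a / a))).
  rewrite -lee_fin; apply: le_trans le1; rewrite /Rintegral fineK//.
  by apply: integrable_fin_num => //; exact: integrable_norm ii.
rewrite ler_wpM2l// ler_wpM2r ?invr_ge0 ?(ltW a0)//; apply: ler_powR_base => //; exact: ltW.
Qed.

(* Junk values at work: if Gamma vanished here, the quotient under the square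
   root in [cH] would be 0. *)
Let Gamma_neq0 : Gamma (H + 1 / 2) != 0.
Proof. by apply/eqP => G; move: c0; rewrite /cH G mul0r invr0 mulr0 sqrtr0 eqxx. Qed.

Let phi_RL : RLspace (H + 1 / 2) T phi.
Proof.
pose b := betac a (1 - a).
have ha : 0 < a < 1 by rewrite a0 a1.
have ha' : 0 < 1 - a < 1 by have := a0; have := a1 => ? ?; apply/andP; split; lra.
have b0 : b != 0 by rewrite gt_eqF// betac_gt0.
(* The constant cancels the inverse Gamma factor of [RLint] and the Beta factor of [abel_comp]. *)
exists (fun y => Gamma (H + 1 / 2) / b * abel y).
  apply/L2P => //; apply: (sqintZ mI); have h1 := @mabel I; exact: (bounded_sqint h1 abel_bound).
move=> x xT; have /andP[x0 xT'] := xT; rewrite /RLint phi_primitive//.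
have idq : mu.-integrable `[0, x] (EFin \o dq).
  have sx := sqint_cst mI 1 (lebesgue_measure_itvcc_lty 0 T).
  have hI : mu.-integrable I (EFin \o dq).
    have := sqint_mul mI dq_sq sx; congr (integrable _ _ _).
    by apply/funext => y /=; rewrite mulr1.
  apply: (integrableS _ _ _ hI); [exact: mI|exact: measurable_itv|].
  by move=> y /=; rewrite !in_itv/= => /andP[-> yx]; rewrite (le_trans yx).
have := abel_comp ha ha' (subrKC _ _) x0 idq; rewrite -/b => E.
have Gb : 0 <= Gamma (H + 1 / 2) / b.
  rewrite divr_ge0//; last by rewrite ltW// betac_gt0.
  by apply: Rintegral_ge0 => y _; rewrite mulr_ge0 ?powR_ge0 ?expR_ge0.
have -> : \int[mu]_(y in `[0, x]) ((x - y) `^ (H + 1 / 2 - 1) * (Gamma (H + 1 / 2) / b * abel y)) =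
  Gamma (H + 1 / 2) / b * (b * \int[mu]_(s in `[0, x]) dq s).
  rewrite -E (_ : 1 - a - 1 = H + 1 / 2 - 1); last by lra.
  rewrite -(ge0_RintegralZl mu _ _ Gb); last 2 first.
  - exact: measurable_itv.
  - apply: measurable_funM; last exact: mabel.
    by apply: (measurableT_comp (measurable_powR _)); apply: measurable_funB.
  by apply: eq_Rintegral => y _; rewrite mulrCA.
by rewrite -[X in _ = _ * X]mulrA mulKf// mulKf.
Qed.

Let phi_lower : q (t - e) - q e <= phi t.
Proof.
have t0' : 0 <= t <= T by rewrite (ltW t0).
have tt := tT; have ee := e0; have et' := et.
rewrite /phi h_dot// ler_pdivlMl// mulrC.
(* At [u = t] the four terms of [kdot] pair up because [q] is even; the resulting integrand is
   smallest at [r = e]. *)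
have -> : \int[mu]_(r in J) dotp mu I (K t) (k r) = \int[mu]_(r in J) (q (t - r) - q r).
  apply: eq_Rintegral => r /set_mem Jr; rewrite kdot//.
  have -> : q (t - r - t) = q r by rewrite /q addrAC subrr add0r normrN.
  have -> : q (r - t) = q (t - r) by rewrite /q distrC.
  lra.
have -> : (q (t - e) - q e) * e = \int[mu]_(r in J) (cst (q (t - e) - q e) r).
  by rewrite /Rintegral intJ.
apply: le_Rintegral; first exact: mJ.
- apply: continuous_compact_integrable; first exact: segment_compact.
  apply: continuous_subspaceT => x; exact: cvg_cst.
- apply: continuous_compact_integrable; first exact: segment_compact.
  apply: continuous_subspaceT => x; apply: cvgB; [exact: cc|exact: cq].
move=> r /rng[r0 re /andP[r1 _] _] /=; apply: lerB; apply: ler_powR_base => //; try exact: ltW.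
  by rewrite !ger0_norm//; lra.
by rewrite !ger0_norm//; lra.
Qed.

Lemma test_function_eps : exists h phi : R -> R,
  [/\ sqint mu I h, forall u, 0 <= u <= T -> dotp mu I (K u) h = phi u,
      exists2 dphi, L2 T dphi & forall u, 0 <= u <= T -> phi u = \int[mu]_(s in `[0, u]) dphi s,
      RLspace (H + 1 / 2) T phi
    & dotp mu I h h <= t `^ (2 * H) /\ `|t - e| `^ (2 * H) - `|e| `^ (2 * H) <= phi t].
Proof.
have [h1 h2] := h_sq; exists h, phi; split; [exact: h1|by []| |exact: phi_RL|by []].
by exists dq; [exact/L2P|exact: phi_primitive].
Qed.

End TestFunction.

Section TestFunctions.
Context {R : realType}.
Local Notation mu := (@lebesgue_measure R).
Variables (H T : R).
Hypotheses (T0 : 0 < T) (H0 : 0 < H) (H1 : H < 1 / 2).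
Local Notation I := (`[0, T]%classic : set (measurableTypeR R)).
Hypothesis KKL2 : forall t, 0 <= t <= T -> sqint mu I (KK H t).
Hypothesis KKcov : forall s t, 0 <= s <= T -> 0 <= t <= T ->
  dotp mu I (KK H s) (KK H t) = 2^-1 * (s `^ (2 * H) + t `^ (2 * H) - `|t - s| `^ (2 * H)).
Hypothesis c0 : cH H != 0.

Lemma test_function (t eta : R) : 0 <= t -> t <= T -> 0 < eta -> exists h phi : R -> R,
  [/\ sqint mu I h, forall u, 0 <= u <= T -> dotp mu I (KK H u) h = phi u,
      exists2 dphi, L2 T dphi & forall u, 0 <= u <= T -> phi u = \int[mu]_(s in `[0, u]) dphi s,
      RLspace (H + 1 / 2) T phi
    & dotp mu I h h <= t `^ (2 * H) /\ t `^ (2 * H) - eta <= phi t].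
Proof.
move=> t0 tT eta0; have HH : 0 < 2 * H by have := H0 => ?; lra.
have mI : measurable I by exact: measurable_itv.
(* The averaging window requires [0 < e < t]; at [t = 0] the zero drift suffices. *)
move: t0; rewrite le_eqVlt => /orP[/eqP <-|t0].
  have z1 := sqint0 mu I.
  have z2 (g : R -> R) (J : set (measurableTypeR R)) : measurable J -> \int[mu]_(x in J) (g x * 0) = 0.
    by move=> mJ; under eq_Rintegral do rewrite mulr0; rewrite Rintegral_cst// mul0r.
  exists (fun=> 0), (fun=> 0); split.
  - exact: z1.
  - by move=> u _; exact: z2.
  - exists (fun=> 0); first exact/L2P.
    by move=> u _; rewrite Rintegral_cst ?mul0r//; exact: measurable_itv.
  - exists (fun=> 0); first exact/L2P.
    by move=> u _; rewrite /RLint z2 ?mulr0//; exact: measurable_itv.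
  - rewrite /dotp (z2 (fun=> 0) I mI) powR0 ?gt_eqF//; split; first exact: lexx.
    by rewrite sub0r oppr_le0 ltW.
have cq := continuous_norm_powR HH.
pose g (e : R) := `|t - e| `^ (2 * H) - `|e| `^ (2 * H).
have cg : continuous g.
  move=> x; apply: cvgB; last exact: cq.
  apply: (continuous_comp (f := fun x : R => t - x) (g := fun x : R => `|x| `^ (2 * H))); last exact: cq.
  by apply: cvgB; [exact: cvg_cst|exact: cvg_id].
have [e [e0 et ge]] : exists e, [/\ 0 < e, e < t & t `^ (2 * H) - eta <= g e].
  have G0 : g 0 = t `^ (2 * H) by rewrite /g subr0 normr0 powR0 ?gt_eqF// subr0 gtr0_norm.
  have h0 : \forall e \near (0 : R)^'+, `|g 0 - g e| < eta.
    by have := cvg_at_right_filter (cg 0) => /cvgrPdist_lt; exact.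
  have h1 : \forall e \near (0 : R)^'+, e < t by exact: nbhs_right_lt.
  have h2 : \forall e \near (0 : R)^'+, 0 < e by exact: nbhs_right_gt.
  have [e [[he1 he2] he3]] := @filter_ex _ _ _ _ (filterI (filterI h2 h1) h0).
  exists e; split => //; move: he3; rewrite G0 ltr_norml; lra.
have [h [phi [p1 p2 p3 p4 [p5 p6]]]] := test_function_eps T0 H0 H1 KKL2 KKcov c0 t0 tT e0 et.
by exists h, phi; split => //; split => //; exact: le_trans ge p6.
Qed.

End TestFunctions.

(** * Chapman-Robbins and sub-Gaussian bounds *)

Lemma ler_continuous0 (R : realType) (f : R -> R) (a : R) : {for 0, continuous f} ->
  (forall c, 0 < c -> a <= f c) -> a <= f 0.
Proof.
move=> cf h; apply/ler_addgt0Pr => e e0.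
have h0 : \forall c \near (0 : R)^'+, `|f 0 - f c| < e.
  by have := cvg_at_right_filter cf => /cvgrPdist_lt; exact.
have h2 : \forall c \near (0 : R)^'+, 0 < c by exact: nbhs_right_gt.
have [c [c0 hc]] := @filter_ex _ _ _ _ (filterI h2 h0).
by have := h c c0; move: hc; rewrite ltr_norml; lra.
Qed.

Lemma expRB1_le (R : realType) (x : R) : expR x - 1 <= x * expR x.
Proof.
have := expR_ge1Dx (- x); rewrite expRN => h.
have e0 := expR_gt0 x.
have := ler_wpM2r (ltW e0) h; rewrite mulVf ?gt_eqF// mulrDl mul1r; lra.
Qed.

Section ChangeOfMeasure.
Context {d : measure_display} {X : measurableType d} {R : realType}.
Implicit Types (m : {measure set X -> \bar R}).

(** With the extended integral defined as a difference of two nonnegative parts, a real value forces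
    both parts to be finite. An unbiasedness equation thus carries integrability. *)
Lemma integrable_of_fin_integral m (f : X -> R) : measurable_fun setT f ->
  (\int[m]_x (f x)%:E)%E \is a fin_num -> m.-integrable setT (EFin \o f).
Proof.
move=> mf; rewrite integralE fin_numB => /andP[f1 f2].
apply/integrableP; split; first exact/measurable_EFinP.
have mfE : measurable_fun setT (fun x => (f x)%:E) by exact/measurable_EFinP.
have -> : (\int[m]_x `|(EFin \o f) x| = \int[m]_x ((fun x => (f x)%:E)^\+ x + (fun x => (f x)%:E)^\- x))%E.
  by apply: eq_integral => x _; rewrite -/((abse \o (fun x => (f x)%:E)) x) fune_abse.
rewrite ge0_integralD//; last 2 first.
- exact: measurable_funepos.
- exact: measurable_funeneg.
by rewrite ltey_eq fin_numD f1 f2.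
Qed.

Lemma integral_density m (Q : {measure set X -> \bar R}) (L : X -> R) :
  measurable_fun setT L -> (forall x, 0 <= L x) ->
  (forall A, measurable A -> Q A = (\int[m]_(x in A) (L x)%:E)%E) ->
  forall f : X -> R, Q.-integrable setT (EFin \o f) ->
  m.-integrable setT (EFin \o (fun x => f x * L x)) /\
  (\int[Q]_x (f x)%:E = \int[m]_x (f x * L x)%:E)%E.
Proof.
move=> mL L0 QL f If.
have mf : measurable_fun setT f by apply/measurable_EFinP; exact: measurable_int If.
pose p x := Num.max (f x) 0; pose n x := Num.max (- f x) 0.
have mp : measurable_fun setT p by apply: measurable_maxr.
have mn : measurable_fun setT n by apply: measurable_maxr => //; apply: measurableT_comp.
have p0 x : 0 <= p x by rewrite /p le_max lexx orbT.
have n0 x : 0 <= n x by rewrite /n le_max lexx orbT.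
have fE x : f x = p x - n x.
  rewrite /p /n; case: (leP (f x) 0) => f0; case: (leP (- f x) 0) => f1; lra.
have pf x : p x <= `|f x| by rewrite /p ge_max normr_ge0 ler_norm.
have nf x : n x <= `|f x| by rewrite /n ge_max normr_ge0 lerNl lerNnormlW.
have Ip : Q.-integrable setT (EFin \o p).
  apply: le_integrable If => //; first exact/measurable_EFinP.
  by move=> x _ /=; rewrite lee_fin ger0_norm.
have In : Q.-integrable setT (EFin \o n).
  apply: le_integrable If => //; first exact/measurable_EFinP.
  by move=> x _ /=; rewrite lee_fin ger0_norm.
have Ep := ge0_integral_density mL L0 QL mp p0.
have En := ge0_integral_density mL L0 QL mn n0.
have Ige (g : X -> R) : measurable_fun setT g -> (forall x, 0 <= g x) ->
    Q.-integrable setT (EFin \o g) ->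
    m.-integrable setT (EFin \o (fun x => g x * L x)).
  move=> mg g0 Ig; apply/integrableP; split; first by apply/measurable_EFinP; apply: measurable_funM.
  have -> : (\int[m]_x `|(EFin \o (fun x => (g x * L x)%R)) x| = \int[m]_x (g x * L x)%:E)%E.
    by apply: eq_integral => x _ /=; rewrite ger0_norm// mulr_ge0.
  rewrite -(ge0_integral_density mL L0 QL mg g0).
  move/integrableP: Ig => [_]; congr (_ < _)%E; apply: eq_integral => x _ /=; rewrite ger0_norm//.
have IpL := Ige p mp p0 Ip; have InL := Ige n mn n0 In.
split.
  have := integrableB measurableT IpL InL; congr (integrable _ _ _).
  by apply/funext => x /=; rewrite fE mulrBl.
transitivity (\int[Q]_x (p x)%:E - \int[Q]_x (n x)%:E)%E.
  rewrite -integralB//; apply: eq_integral => x _; by rewrite fE.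
rewrite Ep En -integralB//; apply: eq_integral => x _; by rewrite fE mulrBl.
Qed.

End ChangeOfMeasure.

Section ChapmanRobbins.
Context {d : measure_display} {X : measurableType d} {R : realType}.
Variables (Q : probability X R) (Z : X -> R) (V : R).
Hypothesis mZ : measurable_fun setT Z.
Hypothesis mgf : forall c, (\int[Q]_x (expR (c * Z x - c ^+ 2 * V / 2))%:E = 1)%E.

Let L c x := expR (c * Z x - c ^+ 2 * V / 2).

Let mL c : measurable_fun setT (L c).
Proof.
apply: (measurableT_comp (@measurable_expR R)); apply: measurable_funB => //.
by apply: measurable_funM.
Qed.

(** [L_c^2 = exp (c^2 V) L_(2c)], so the normalization at [2 c] gives the second moment. *)
Let L_sqr c : (\int[Q]_x ((L c x) ^+ 2)%:E = (expR (c ^+ 2 * V))%:E)%E.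
Proof.
rewrite -[RHS]mule1 -(mgf (2 * c)).
rewrite -(ge0_integralZl_EFin Q measurableT (f1 := fun x => (L (2 * c) x)%:E)) ?expR_ge0; last 3 first.
- by move=> x _; rewrite lee_fin expR_ge0.
- by apply/measurable_EFinP; exact: mL.
- by [].
apply: eq_integral => x _; rewrite -EFinM; congr EFin.
by rewrite /L -expRD -expRM_natl; congr expR; field.
Qed.

Lemma chapman_robbins (f : X -> R) (mean phi : R) : measurable_fun setT f ->
  (forall c, Q.-integrable setT (EFin \o (fun x => f x * L c x)) /\
     (\int[Q]_x (f x * L c x)%:E = (mean + c * phi)%:E)%E) ->
  ((2 * phi - V)%:E <= \int[Q]_x ((f x - mean) ^+ 2)%:E)%E.
Proof.
move=> mf hf.
have mT : measurable [set: X] by exact: measurableT.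
have L0 x : L 0 x = 1 by rewrite /L mul0r expr0n/= !mul0r subr0 expR0.
have [sf|] := boolP (\int[Q]_x ((f x - mean) ^+ 2)%:E < +oo)%E; last first.
  by rewrite -leNgt leye_eq => /eqP ->; exact: leey.
have sq1 : sqint Q setT (fun x => f x - mean) by split => //; apply: measurable_funB.
rewrite dotpEFin// lee_fin; set A := dotp _ _ _ _.
have QT : (Q setT < +oo)%E by rewrite probability_setT ltry.
have s1 := sqint_cst mT 1 QT.
have main c : 0 < c -> 2 * phi - A <= V * expR (c ^+ 2 * V).
  move=> c0; have sL : sqint Q setT (L c) by split; [exact: mL|rewrite L_sqr ltry].
  have sL1 := sqintB mT sL s1.
  have [I0 E0] := hf 0; have [Ic Ec] := hf c.
  have LL : dotp Q setT (L c) (L c) = expR (c ^+ 2 * V).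
    by apply: EFin_inj; rewrite -dotpEFin// L_sqr.
  have L1 : dotp Q setT (L c) (cst 1) = 1.
    rewrite /dotp; under eq_Rintegral do rewrite mulr1; by rewrite /Rintegral mgf.
  have D11 : dotp Q setT (cst 1) (cst 1) = 1.
    transitivity (\int[Q]_(x in setT) cst 1 x); first by apply: eq_Rintegral => x _; rewrite mulr1.
    by rewrite Rintegral_cst// -[fine _]/(fine (Q setT)) probability_setT mul1r.
  have LB : dotp Q setT (fun x => L c x - cst 1 x) (fun x => L c x - cst 1 x) = expR (c ^+ 2 * V) - 1.
    rewrite (dotpBB mT sL s1 sL s1) (dotpC _ _ (cst 1) (L c)) LL L1 D11; ring.
  have I0' : Q.-integrable setT (EFin \o f).
    move: I0; congr (integrable _ _ _); apply/funext => x /=; by rewrite L0 mulr1.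
  have f1 : dotp Q setT (fun x => f x - mean) (cst 1) = 0.
    rewrite /dotp; under eq_Rintegral do rewrite mulr1.
    rewrite RintegralB//; last exact: finite_measure_integrable_cst.
    rewrite Rintegral_cst// -[fine _]/(fine (Q setT)) probability_setT mulr1.
    have -> : \int[Q]_(x in setT) f x = mean.
      rewrite /Rintegral -[RHS]/(fine mean%:E) -[mean in RHS]addr0 -(mul0r phi) -E0.
      by congr fine; apply: eq_integral => x _; rewrite L0 mulr1.
    by rewrite subrr.
  have iL := sqint_integrable mT QT sL.
  have IL : Q.-integrable setT (EFin \o (fun x => mean * L c x)) := integrableZl mT mean iL.
  have fL : dotp Q setT (fun x => f x - mean) (L c) = c * phi.
    rewrite /dotp; under eq_Rintegral do rewrite mulrBl.
    rewrite RintegralB// RintegralZl//.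
    by rewrite /Rintegral Ec mgf /=; ring.
  have fL1 : dotp Q setT (fun x => f x - mean) (fun x => L c x - cst 1 x) = c * phi.
    by rewrite (dotpBr mT sL s1 sq1) fL f1 subr0.
  have := dotp_young mT c0 sq1 sL1; rewrite fL1 LB -/A => h.
  (* With the weight [c] every term is of order [c], since the variance [exp (c^2 V) - 1] of [L c]
     is at most [c^2 V exp (c^2 V)]; dividing by [c] leaves a limit at 0. *)
  have h2 : 2 * (c * phi) <= c * A + c^-1 * (expR (c ^+ 2 * V) - 1).
    by apply: le_trans h; rewrite ler_pM2l// ler_norm.
  have h3 := expRB1_le (c ^+ 2 * V).
  have ci : 0 <= c^-1 by rewrite invr_ge0 ltW.
  have h4 := ler_wpM2l ci h3.
  have h5 : 2 * (c * phi) <= c * A + c * (V * expR (c ^+ 2 * V)).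
    apply: le_trans h2 _; rewrite lerD2l; apply: le_trans h4 _.
    by rewrite le_eqVlt; apply/orP; left; apply/eqP; field; rewrite gt_eqF.
  rewrite -(ler_pM2l c0); lra.
suff : 2 * phi - A <= V by lra.
have -> : V = V * expR (0 ^+ 2 * V) by rewrite expr0n/= mul0r expR0 mulr1.
apply: (@ler_continuous0 R (fun c => V * expR (c ^+ 2 * V))) => //.
apply: cvgM; first exact: cvg_cst.
apply: (continuous_comp (f := fun c : R => c ^+ 2 * V) (g := expR)); last exact: continuous_expR.
by apply: cvgM; [exact: sqr_continuous|exact: cvg_cst].
Qed.

End ChapmanRobbins.

Lemma expR_sinh_ge (R : realType) (y : R) : 0 <= y -> 2 * y <= expR y - expR (- y).
Proof.
move=> y0.
have dN (x : R) : is_derive x (1 : R) (fun x : R => expR (- x)) (- expR (- x)).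
  have := @is_derive1_comp R expR (fun y : R => - y) x _ _ (is_derive_expR (- x)) (is_deriveN (is_derive_id x 1)).
  by rewrite mulrN1.
have df (x : R) : is_derive x (1 : R) (fun x : R => expR x - expR (- x)) (expR x + expR (- x)).
  by have := is_deriveB (is_derive_expR x) (dN x); rewrite opprK.
have [] := @MVT_segment R _ (fun x => expR x + expR (- x)) 0 y y0 (fun x _ => df x).
  apply: derivable_within_continuous => x _; by have [] := df x.
move=> c _; rewrite oppr0 expR0 subrr !addr0 ?subr0 => E.
have h2 : 2 <= expR c + expR (- c).
  have := sqr_ge0 (expR c - 1); have := expR_gt0 c.
  have : expR c * expR (- c) = 1 by rewrite -expRD subrr expR0.
  by set u := expR c; set v := expR (- c) => p u0 h; nra.
have h3 := ler_wpM2r y0 h2.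
by rewrite E.
Qed.

(** Half-angle formula: [e^x + e^(-x) = (e^(x/2) - e^(-x/2))^2 + 2], together with
    [expR_sinh_ge]. *)
Lemma expR_cosh_ge (R : realType) (x : R) : x ^+ 2 + 2 <= expR x + expR (- x).
Proof.
wlog x0 : x / 0 <= x.
  move=> hw; case: (leP 0 x) => [|/ltW x0]; first exact: hw.
  by rewrite addrC -sqrrN [leRHS]addrC -[in X in _ <= _ + X](opprK x) addrC; apply: hw; rewrite oppr_ge0.
have y0 : 0 <= x / 2 by rewrite divr_ge0.
have := expR_sinh_ge y0; rewrite mulrC divfK// => h.
have E : expR x + expR (- x) = (expR (x / 2) - expR (- (x / 2))) ^+ 2 + 2.
  have p : expR (x / 2) * expR (- (x / 2)) = 1 by rewrite -expRD subrr expR0.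
  have e1 : expR x = expR (x / 2) ^+ 2 by rewrite expr2 -expRD; congr expR; field.
  have e2 : expR (- x) = expR (- (x / 2)) ^+ 2 by rewrite expr2 -expRD; congr expR; field.
  by rewrite e1 e2 sqrrB p; ring.
rewrite E lerD2r; have := expR_ge0 (x / 2); nra.
Qed.

Section SubGaussian.
Context {d : measure_display} {X : measurableType d} {R : realType}.
Variables (Q : probability X R) (Z : X -> R) (V : R).
Hypothesis mZ : measurable_fun setT Z.
Hypothesis mgf : forall c, (\int[Q]_x (expR (c * Z x))%:E <= (expR (c ^+ 2 * V / 2))%:E)%E.

Let mT : measurable [set: X]. Proof. exact: measurableT. Qed.

Let mexp c : measurable_fun setT (fun x => expR (c * Z x)).
Proof. by apply: (measurableT_comp (@measurable_expR R)); apply: measurable_funM. Qed.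

(** Adding the bounds at [c] and [- c] cancels the linear term and isolates the second moment. *)
Let cosh_int c : (\int[Q]_x ((c * Z x) ^+ 2 + 2)%:E <= (2 * expR (c ^+ 2 * V / 2))%:E)%E.
Proof.
apply: (@le_trans _ _ (\int[Q]_x ((expR (c * Z x))%:E + (expR (- c * Z x))%:E))%E).
  apply: ge0_le_integral => //.
  - by move=> x _; rewrite lee_fin addr_ge0 ?sqr_ge0.
  - by apply/measurable_EFinP; apply: measurable_funD => //; apply: measurable_funX; apply: measurable_funM.
  - by apply: emeasurable_funD; apply/measurable_EFinP; exact: mexp.
  - by move=> x _; rewrite -EFinD lee_fin mulNr expR_cosh_ge.
rewrite ge0_integralD; [|exact: mT|by move=> x _; rewrite lee_fin expR_ge0|by apply/measurable_EFinP; exact: mexp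
  |by move=> x _; rewrite lee_fin expR_ge0|by apply/measurable_EFinP; exact: mexp].
have -> : 2 * expR (c ^+ 2 * V / 2) = expR (c ^+ 2 * V / 2) + expR ((- c) ^+ 2 * V / 2) by rewrite sqrrN; ring.
by rewrite EFinD; apply: leeD; exact: mgf.
Qed.

Lemma sub_gaussian_sqint : sqint Q setT Z.
Proof.
split => //; apply: le_lt_trans (le_lt_trans (cosh_int 1) (ltry _)).
apply: ge0_le_integral => //.
- by move=> x _; rewrite lee_fin sqr_ge0.
- by apply/measurable_EFinP; apply: measurable_funX.
- by apply/measurable_EFinP; apply: measurable_funD => //; apply: measurable_funX; apply: measurable_funM.
- by move=> x _; rewrite lee_fin mul1r lerDl.
Qed.

Let QT : (Q setT < +oo)%E. Proof. by rewrite probability_setT ltry. Qed.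

Let int1 (k : R) : \int[Q]_(x in setT) (cst k x) = k.
Proof. by rewrite Rintegral_cst// -[fine _]/(fine (Q setT)) probability_setT mulr1. Qed.

(** In [cosh_int], subtract 2, divide by [c^2] and let [c] tend to 0. *)
Lemma sub_gaussian_variance : dotp Q setT Z Z <= V.
Proof.
have sZ := sub_gaussian_sqint.
have -> : V = V * expR (0 ^+ 2 * V / 2) by rewrite expr0n/= !mul0r expR0 mulr1.
apply: (@ler_continuous0 R (fun c => V * expR (c ^+ 2 * V / 2))).
  apply: cvgM; first exact: cvg_cst.
  apply: (continuous_comp (f := fun c : R => c ^+ 2 * V / 2) (g := expR)); last exact: continuous_expR.
  by apply: cvgM; last exact: cvg_cst; apply: cvgM; [exact: sqr_continuous|exact: cvg_cst].
move=> c c0.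
have i2 : Q.-integrable setT (EFin \o (fun x => c ^+ 2 * (Z x * Z x))).
  exact: (integrableZl mT (c ^+ 2) (sqint_mul mT sZ sZ)).
have E : (\int[Q]_x ((c * Z x) ^+ 2 + 2)%:E = (c ^+ 2 * dotp Q setT Z Z + 2)%:E)%E.
  rewrite -[in RHS](int1 2) /dotp -RintegralZl//; last exact: sqint_mul.
  rewrite -RintegralD//; last exact: finite_measure_integrable_cst.
  rewrite /Rintegral fineK.
    by apply: eq_integral => x _ /=; congr EFin; ring.
  apply: integrable_fin_num => //.
  by have := integrableD mT i2 (finite_measure_integrable_cst Q 2 mT).
have := cosh_int c; rewrite E lee_fin => h.
have := expRB1_le (c ^+ 2 * V / 2) => h3.
have c2 : 0 < c ^+ 2 by rewrite exprn_gt0.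
rewrite -(ler_pM2l c2); lra.
Qed.

Let mean_le c : c * \int[Q]_(x in setT) Z x <= expR (c ^+ 2 * V / 2) - 1.
Proof.
have iZ := sqint_integrable mT QT sub_gaussian_sqint.
have icZ : Q.-integrable setT (EFin \o (fun x => c * Z x)) by exact: (integrableZl mT c iZ).
have ie : Q.-integrable setT (EFin \o (fun x => expR (c * Z x))).
  apply/integrableP; split; first by apply/measurable_EFinP; exact: mexp.
  apply: le_lt_trans (le_lt_trans (mgf c) (ltry _)).
  by rewrite le_eqVlt; apply/orP; left; apply/eqP; apply: eq_integral => x _ /=; rewrite ger0_norm ?expR_ge0.
rewrite -RintegralZl// lerBrDr -[X in _ + X <= _](int1 1) -RintegralD//; last exact: finite_measure_integrable_cst.
apply: (@le_trans _ _ (\int[Q]_(x in setT) expR (c * Z x))).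
  apply: le_Rintegral => //.
    exact: (integrableD mT icZ (finite_measure_integrable_cst Q 1 mT)).
  by move=> x _ /=; rewrite addrC expR_ge1Dx.
rewrite -lee_fin /Rintegral fineK//; exact: integrable_fin_num.
Qed.

(** [mean_le] is used at [c] and [- c]: its right side is of order [c^2], so after division by [c]
    both one-sided bounds tend to 0. *)
Lemma sub_gaussian_mean : \int[Q]_(x in setT) Z x = 0.
Proof.
pose f c := c * V / 2 * expR (c ^+ 2 * V / 2).
have cf : {for 0, continuous f}.
  apply: cvgM.
    by apply: cvgM; last exact: cvg_cst; apply: cvgM; [exact: cvg_id|exact: cvg_cst].
  apply: (continuous_comp (f := fun c : R => c ^+ 2 * V / 2) (g := expR)); last exact: continuous_expR.
  by apply: cvgM; last exact: cvg_cst; apply: cvgM; [exact: sqr_continuous|exact: cvg_cst].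
have f0 : f 0 = 0 by rewrite /f !mul0r.
apply/eqP; rewrite eq_le; apply/andP; split.
  rewrite -f0; apply: ler_continuous0 => // c c0.
  have := mean_le c; have := expRB1_le (c ^+ 2 * V / 2) => h1 h2.
  rewrite -(ler_pM2l c0) /f; lra.
rewrite -oppr_le0 -f0; apply: ler_continuous0 => // c c0.
have := mean_le (- c); have := expRB1_le (c ^+ 2 * V / 2); rewrite sqrrN => h1 h2.
rewrite -(ler_pM2l c0) /f; lra.
Qed.

End SubGaussian.

(** * Shifted drifts *)

Section DriftSpace.
Context {R : realType}.
Local Notation mu := (@lebesgue_measure R).
Variables (H T : R).
Hypotheses (T0 : 0 < T) (H0 : 0 < H) (H1 : H < 1 / 2).
Local Notation I := (`[0, T]%classic : set (measurableTypeR R)).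

Let mI : measurable I. Proof. exact: measurable_itv. Qed.

Let J t := (`[0, t]%classic : set (measurableTypeR R)).
Let mJ t : measurable (J t). Proof. exact: measurable_itv. Qed.
Let JI t : t <= T -> J t `<=` I.
Proof. by move=> tT x; rewrite /J /= !in_itv/= => /andP[-> xt]; rewrite (le_trans xt). Qed.

(** Additivity of [RLint] needs integrable integrands; the kernel is square integrable because
    [2 (H - 1/2) > -1]. *)
Let sq_kernel t : 0 <= t -> sqint mu (J t) (fun s => (t - s) `^ (H + 1 / 2 - 1)).
Proof.
move=> t0; split.
  by apply: (measurableT_comp (measurable_powR _)); apply: measurable_funB.
have -> : (\int[mu]_(x in J t) (((t - x) `^ (H + 1 / 2 - 1)) ^+ 2)%:E =
   \int[mu]_(x in `[0%R, t]) ((t - x) `^ (2 * H - 1))%:E)%E.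
  apply: eq_integral => x _; congr EFin; rewrite -powR_mulrn ?powR_ge0// -powRrM.
  by congr (_ `^ _); field.
have HH : 0 < 2 * H by have := H0 => ?; lra.
by rewrite integral_powR_shift_rev// ltry.
Qed.

Lemma RLspace_lincomb (c : R) (phi psi : R -> R) :
  RLspace (H + 1 / 2) T phi -> RLspace (H + 1 / 2) T psi ->
  RLspace (H + 1 / 2) T (fun u => phi u + c * psi u).
Proof.
move=> [f /L2P sf hf] [g /L2P sg hg].
exists (fun x => f x + c * g x); first by apply/L2P; apply: sqintD => //; exact: sqintZ.
move=> t tT; rewrite hf// hg// /RLint mulrCA -mulrDr; congr (_ * _).
have /andP[t0 tT'] := tT; have sk := sq_kernel t0.
have sf' := sqint_sub mI (mJ t) (JI tT') sf; have sg' := sqint_sub mI (mJ t) (JI tT') sg.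
have ig := sqint_mul (mJ t) sk sg'.
rewrite -(RintegralZl c (mJ t) ig) -RintegralD.
- by apply: eq_Rintegral => x _; ring.
- exact: mJ.
- by have := sqint_mul (mJ t) sk sf'; exact.
- by have := integrableZl (mJ t) c ig; exact.
Qed.

Definition shift_drift (d : nat) (theta : 'I_d -> R -> R) (i : 'I_d) (c : R) (phi : R -> R) :
    'I_d -> R -> R :=
  fun j => if j == i then fun u => theta i u + c * phi u else theta j.

Lemma shift_drift_space (d : nat) (theta : 'I_d -> R -> R) (i : 'I_d) (c : R) (phi : R -> R) :
  drift_space H T theta ->
  (exists2 dphi, L2 T dphi & forall u, 0 <= u <= T -> phi u = \int[mu]_(s in `[0, u]) dphi s) ->
  RLspace (H + 1 / 2) T phi ->
  drift_space H T (shift_drift theta i c phi).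
Proof.
move=> hth [dphi /L2P sdp hdp] RLp j; rewrite /shift_drift; have [_|_] := eqVneq j i; last exact: hth.
have [[dth /L2P sdt hdt] RLt] := hth i; split; last exact: RLspace_lincomb.
exists (fun s => dth s + c * dphi s); first by apply/L2P; apply: sqintD => //; exact: sqintZ.
move=> t tT; rewrite hdt// hdp//.
have /andP[t0 tT'] := tT.
have i1 := sqint_integrable (mJ t) (lebesgue_measure_itvcc_lty 0 t) (sqint_sub mI (mJ t) (JI tT') sdt).
have i2 := sqint_integrable (mJ t) (lebesgue_measure_itvcc_lty 0 t) (sqint_sub mI (mJ t) (JI tT') sdp).
rewrite -(RintegralZl c (mJ t) i2) -RintegralD//.
by have := integrableZl (mJ t) c i2; exact.
Qed.

End DriftSpace.

(** Truncation at [n] is 1-Lipschitz, and below [n] the tangent inequality gives the exponential the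
    Lipschitz constant [expR n]. *)
Lemma expR_trunc_lip (R : realType) (n x y : R) :
  expR (Num.min x n) <= expR (Num.min y n) + expR n * `|x - y|.
Proof.
set x' := Num.min x n; set y' := Num.min y n.
have h1 : `|x' - y'| <= `|x - y|.
  rewrite /x' /y'; case: (leP x n) => xn; case: (leP y n) => yn.
  - by [].
  - rewrite !ler0_norm; lra.
  - rewrite !ger0_norm; lra.
  - by rewrite subrr normr0.
have xn : x' <= n by rewrite /x' ge_min lexx orbT.
have h2 := expR_ge1Dx (y' - x').
have h3 : expR x' - expR y' <= expR x' * (x' - y').
  have e : expR x' * expR (y' - x') = expR y' by rewrite -expRD; congr expR; ring.
  by have := ler_wpM2l (expR_ge0 x') h2; rewrite e; lra.
have h4 : expR x' * (x' - y') <= expR n * `|x - y|.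
  apply: (@le_trans _ _ (expR x' * `|x' - y'|)); first by rewrite ler_wpM2l ?expR_ge0 ?ler_norm.
  by apply: ler_pM; rewrite ?expR_ge0 ?ler_expR.
lra.
Qed.

(** * The risk of an estimator *)

Lemma integral_variance (R : realType) (T H : R) (d : nat) : 0 < T -> 0 < 2 * H ->
  (\int[lebesgue_measure]_(t in (`[0%R, T]%classic : set (measurableTypeR R))) (t `^ (2 * H) * d%:R)%:E =
   (T `^ (2 * H + 1) / (2 * H + 1) * d%:R)%:E)%E.
Proof.
move=> T0 HH; pose mu := @lebesgue_measure R.
pose I := (`[0%R, T]%classic : set (measurableTypeR R)).
have H21 : 0 < 2 * H + 1 by rewrite addr_gt0.
under eq_integral do rewrite mulrC EFinM.
rewrite ge0_integralZl_EFin//; last 2 first.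
- by move=> t _; rewrite lee_fin powR_ge0.
- by apply/measurable_EFinP; apply: measurable_funTS; exact: measurable_powR.
have -> : (\int[mu]_(t in I) (t `^ (2 * H))%:E = \int[mu]_(t in `[0%R, T]) ((t - 0) `^ (2 * H + 1 - 1))%:E)%E.
  by apply: eq_integral => t _; rewrite subr0 addrK.
have n0 : 2 * H + 1 != 0 by rewrite gt_eqF.
rewrite (integral_powR_shift (ltW T0) n0 (or_intror (conj (lexx 0) H21))).
by rewrite !subr0 powR0 ?gt_eqF// subr0 -EFinM mulrC.
Qed.

(** * Densities, bounds and risk under the drift laws *)

Section Main.
Context {R : realType} {dsp : measure_display} {Omega : measurableType dsp}.
Local Notation mu := (@lebesgue_measure R).
Variables (P : probability Omega R) (d : nat) (T H : R).
Variables (B W : 'I_d -> R -> {mfun Omega >-> R}).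
Variable Pth : ('I_d -> R -> R) -> probability Omega R.
Hypotheses (T0 : 0 < T) (H0 : 0 < H) (H1 : H < 1 / 2).
Hypothesis hB : is_fbm P T H B.
Hypothesis hW : is_bm P T W.
Hypothesis hBW : forall i (t : R), 0 <= t <= T -> is_wiener_integral P t (W i) (KH H t) (B i t).
Hypothesis hPth : forall theta, drift_space H T theta -> is_drift_law P T H W theta (Pth theta).
(** The kernel is the same for all components; its properties are read off this one. *)
Variable i0 : 'I_d.

Local Notation I := (`[0, T]%classic : set (measurableTypeR R)).
Local Notation K := (KK H).
Local Notation sqP := (sqint P setT).
Local Notation dotP := (dotp P setT).
Local Notation sqI := (sqint mu I).
Local Notation dotI := (dotp mu I).

Let mI : measurable I. Proof. exact: measurable_itv. Qed.
Let mT : measurable [set: Omega]. Proof. exact: measurableT. Qed.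
Let HH : 0 < 2 * H. Proof. by have := H0 => ?; lra. Qed.

Let Wlaw i : forall s t : R, 0 <= s -> s < t -> t <= T ->
  forall U : set R, measurable U ->
    P ((fun w => W i t w - W i s w) @^-1` U) = normal_prob 0 (Num.sqrt (t - s)) U.
Proof. by have [_ /(_ i)[]] := hW. Qed.

Let WB i t : 0 <= t <= T -> wiener P T (W i) (K t) (B i t).
Proof.
move=> tT; have /andP[t0 tT'] := tT.
apply: (wiener_of_integral (Wlaw i) t0 tT' (hBW i tT)).
- exact: measurable_KKr.
- by move=> x x0 _; rewrite KK_KH.
- by move=> x tx _; rewrite KK0// ltW.
Qed.

Let KKL2 t : 0 <= t <= T -> sqI (K t).
Proof. by move=> /(WB i0)[]. Qed.

(** The covariance of [B] transported by the isometry, instead of an integration of the kernel. *)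
Let KKcov s t : 0 <= s <= T -> 0 <= t <= T ->
  dotI (K s) (K t) = 2^-1 * (s `^ (2 * H) + t `^ (2 * H) - `|t - s| `^ (2 * H)).
Proof.
move=> sT tT; rewrite -(wiener_dotp (Wlaw i0) (WB i0 sT) (WB i0 tT)).
have [_ _ _ /(_ i0 s t sT tT)] := hB.
by rewrite unlock /dotp /Rintegral => ->.
Qed.

Let KKnorm t : 0 <= t <= T -> dotI (K t) (K t) = t `^ (2 * H).
Proof. by move=> tT; rewrite KKcov// subrr normr0 powR0 ?gt_eqF// subr0; lra. Qed.

(** A null constant would make the kernel vanish, against the positive variance [T^(2H)]. No Gamma
    value has to be estimated. *)
Let c0 : cH H != 0.
Proof.
apply/eqP => c0; have tT : 0 <= T <= T by rewrite lexx ltW.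
have := KKnorm tT; have -> : K T = (fun=> 0).
  by apply/funext => s; rewrite /KK c0 mul0r; case: ifP.
rewrite /dotp; under eq_Rintegral do rewrite mul0r.
rewrite Rintegral_cst// mul0r => /eqP; rewrite eq_sym gt_eqF// powR_gt0//.
Qed.

Let ae_of_dotK f g : sqI f -> sqI g ->
  (forall u, 0 <= u <= T -> dotI (K u) f = dotI (K u) g) -> {ae mu, forall x, I x -> f x = g x}.
Proof.
move=> sf sg fg; have sfg := sqintB mI sf sg.
have KKM t : 0 <= t <= T -> dotI (K t) (K t) <= T `^ (2 * H).
  move=> tT; rewrite KKnorm//; have /andP[t0 tT'] := tT.
  by apply: ler_powR_base => //; exact: ltW.
have := KK_inj T0 H0 H1 KKL2 KKM c0 sfg.
have z u : 0 <= u <= T -> dotI (K u) (fun x => f x - g x) = 0.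
  by move=> uT; rewrite (dotpBr mI sf sg (KKL2 uT)) fg// subrr.
move=> /(_ z); apply: filterS => x h Ix; apply/eqP; rewrite -subr_eq0; apply/eqP; exact: h.
Qed.

(** Needed because the difference of two representing functions equals the chosen direction only
    almost everywhere. *)
Let wiener_ae i f g X : wiener P T (W i) f X -> sqI g ->
  {ae mu, forall x, I x -> f x = g x} -> wiener P T (W i) g X.
Proof.
move=> [sf sX [s [sT h1 h2]]] sg fg; split => //; exists s; split => //.
rewrite [X in X @ _ --> _](_ : _ = fun n => dotI (fun x => f x - step_fun (s n) x) (fun x => f x - step_fun (s n) x)) //.
apply/funext => n; have st : sqI (step_fun (s n)) by exact: step_fun_sq.
have s1 := sqintB mI sf st; have s2 := sqintB mI sg st.
have E : {ae mu, forall x, I x -> g x - step_fun (s n) x = f x - step_fun (s n) x}.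
  by move: fg; apply: filterS => x h Ix; rewrite h.
exact: (ae_eq_dotp mI s2 s1 s2 s1 E E).
Qed.

(** Despite its name, the logarithm of the density of a drift law with respect to [P]. *)
Let mean_of (h : 'I_d -> R -> R) (J : 'I_d -> Omega -> R) w :=
  \sum_(i < d) (J i w - 2^-1 * dotI (h i) (h i)).

Let measurable_mean h (J : 'I_d -> {mfun Omega >-> R}) D : measurable_fun D (mean_of h (fun i => J i)).
Proof.
apply: measurable_funTS.
by apply: measurable_sum => i; apply: measurable_funB => //; exact: measurable_cst.
Qed.

Let rep (theta : 'I_d -> R -> R) : drift_space H T theta ->
  exists (h : 'I_d -> R -> R) (J : 'I_d -> {mfun Omega >-> R}),
  [/\ forall i, sqI (h i), forall i u, 0 <= u <= T -> dotI (K u) (h i) = theta i u,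
      forall i, wiener P T (W i) (h i) (J i)
    & forall A, measurable A -> Pth theta A = (\int[P]_(w in A) (expR (mean_of h (fun i => J i) w))%:E)%E].
Proof.
move=> /hPth[h [J [hinv hJ hQ]]]; exists h, J.
have sh i : sqI (h i) by apply/L2P => //; have [] := hinv i.
split => //.
- move=> i u uT; have [_ /(_ u uT) <-] := hinv i.
  have [mh _] := sh i; by rewrite (KHop_dotp H mh uT).
- move=> i; have TT : 0 <= T by exact: ltW.
  apply: (wiener_of_integral (Wlaw i) TT (lexx T) (hJ i)) => //; first by have [] := sh i.
  by move=> x Tx xT; have := lt_le_trans Tx xT; rewrite ltxx.
Qed.

Let test (g phi : R -> R) :=
  [/\ sqI g, forall u, 0 <= u <= T -> dotI (K u) g = phi u,
      exists2 dphi, L2 T dphi & forall u, 0 <= u <= T -> phi u = \int[mu]_(s in `[0, u]) dphi s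
    & RLspace (H + 1 / 2) T phi].

(** A single [Y] serves every [c]. No Wiener integral of [g] is given, so [Y] is the difference of
    those attached to the shift [c = 1] and to [theta]; uniqueness of Wiener integrals then
    identifies the one for [c] with [J i + c Y] almost surely. *)
Let shift_rep theta i g phi h (J : 'I_d -> {mfun Omega >-> R}) : drift_space H T theta -> test g phi ->
  (forall i, sqI (h i)) -> (forall i u, 0 <= u <= T -> dotI (K u) (h i) = theta i u) ->
  (forall i, wiener P T (W i) (h i) (J i)) ->
  exists Y : Omega -> R, wiener P T (W i) g Y /\ forall c A, measurable A ->
   Pth (shift_drift theta i c phi) A =
     (\int[P]_(w in A) (expR (c * (Y w - dotI (h i) g) - c ^+ 2 * dotI g g / 2 +
         mean_of h (fun i => J i) w))%:E)%E.
Proof.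
move=> hth [sg Kg dphi RLp] sh Kh wJ.
have hs c := shift_drift_space H0 i c hth dphi RLp.
have hi c hc : (forall j, sqI (hc j)) ->
   (forall j u, 0 <= u <= T -> dotI (K u) (hc j) = shift_drift theta i c phi j u) ->
   {ae mu, forall x, I x -> hc i x = 1 * h i x + c * g x}.
  move=> shc Khc; have slc := sqint_lincomb2 mI 1 c (sh i) sg.
  apply: ae_of_dotK => // u uT; rewrite Khc// /shift_drift eqxx.
  have s1 := sqintZ mI 1 (sh i); have s2 := sqintZ mI c sg; have sK := KKL2 uT.
  by rewrite (dotpDr mI s1 s2 sK) (dotpZr mI 1 (sh i) sK) (dotpZr mI c sg sK) Kh// Kg// mul1r.
have hj c hc j : j != i -> (forall j, sqI (hc j)) ->
   (forall j u, 0 <= u <= T -> dotI (K u) (hc j) = shift_drift theta i c phi j u) ->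
   {ae mu, forall x, I x -> hc j x = h j x}.
  move=> ji shc Khc; apply: ae_of_dotK => // u uT.
  by rewrite Khc// /shift_drift (negbTE ji) Kh.
have [h1 [J1 [sh1 Kh1 wJ1 _]]] := rep (hs 1).
pose Y w := 1 * J1 i w + -1 * J i w.
have wY : wiener P T (W i) g Y.
  apply: (wiener_ae (wiener_lin (Wlaw i) 1 (-1) (wJ1 i) (wJ i)) sg).
  by have := hi 1 h1 sh1 Kh1; apply: filterS => x E Ix; rewrite (E Ix); ring.
exists Y; split => // c A mA.
have [hc [Jc [shc Khc wJc dc]]] := rep (hs c); rewrite (dc A mA).
have ae : {ae P, forall w, mean_of hc (fun i => Jc i) w =
   c * (Y w - dotI (h i) g) - c ^+ 2 * dotI g g / 2 + mean_of h (fun i => J i) w}.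
  have aej : {ae P, forall w, forall j, j != i -> Jc j w = J j w}.
    apply: filter_forall => j; have [_|ji] := eqVneq j i; first by apply: nearW.
    have := wiener_uniq (Wlaw j) (wJc j) (wJ j) (hj c hc j ji shc Khc).
    by apply: filterS => w E _.
  have aei := wiener_uniq (Wlaw i) (wJc i) (wiener_lin (Wlaw i) 1 c (wJ i) wY) (hi c hc shc Khc).
  move: aei; apply: filterS2 aej => w Ej Ei.
  rewrite /mean_of (bigD1 i)//= [in RHS](bigD1 i)//= Ei.
  have slc := sqint_lincomb2 mI 1 c (sh i) sg.
  (* The cross term is what centers [Y] at [(h_i, g)]. *)
  have -> : dotI (hc i) (hc i) = dotI (h i) (h i) + 2 * c * dotI (h i) g + c ^+ 2 * dotI g g.
    rewrite (ae_eq_dotp mI (shc i) slc (shc i) slc (hi c hc shc Khc) (hi c hc shc Khc)).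
    by rewrite (dotp_lincomb2 mI 1 c (sh i) sg); ring.
  have -> : \sum_(j < d | j != i) (Jc j w - 2^-1 * dotI (hc j) (hc j)) =
     \sum_(j < d | j != i) (J j w - 2^-1 * dotI (h j) (h j)).
    apply: eq_bigr => j ji; rewrite Ej//; congr (_ - _ * _).
    have hcj := hj c hc j ji shc Khc.
    exact: (ae_eq_dotp mI (shc j) (sh j) (shc j) (sh j) hcj hcj).
  by field.
apply: ae_eq_integral => //.
- apply/measurable_EFinP; apply: (measurableT_comp (@measurable_expR R)); exact: measurable_mean.
- apply/measurable_EFinP; apply: (measurableT_comp (@measurable_expR R)).
  apply: measurable_funD; last exact: measurable_mean.
  apply: measurable_funTS.
  have [_ [mY _] _] := wY.
  by apply: measurable_funB => //; apply: measurable_funM => //; apply: measurable_funB.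
by move: ae; apply: filterS => w E _; rewrite E.
Qed.

Lemma drift_lower_bound theta i t (f : Omega -> R) : drift_space H T theta -> 0 <= t <= T ->
  measurable_fun setT f ->
  (forall th, drift_space H T th -> (\int[Pth th]_w (f w)%:E = (th i t)%:E)%E) ->
  ((t `^ (2 * H))%:E <= \int[Pth theta]_w ((f w - theta i t) ^+ 2)%:E)%E.
Proof.
move=> hth tT mf unb; have /andP[t0 tT'] := tT.
apply/lee_addgt0Pr => e e0.
(* With an error [e / 2] on [phi t] and [V <= t^(2H)], one gets [2 phi t - V >= t^(2H) - e]. *)
have e2 : 0 < e / 2 by rewrite divr_gt0.
have [g [phi [sg Kg dphi RLp [Vle phige]]]] := test_function T0 H0 H1 KKL2 KKcov c0 t0 tT' e2.
have tst : test g phi by [].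
have [h [J [sh Kh wJ dens0]]] := rep hth.
have [Y [wY dens]] := shift_rep i hth tst sh Kh wJ.
have [_ [mY _] _] := wY.
set V := dotI g g in Vle dens; set m := dotI (h i) g in dens.
pose Z w := Y w - m.
have mZ : measurable_fun setT Z by apply: measurable_funB.
pose S := mean_of h (fun i => J i).
have mS D : measurable_fun D S by exact: measurable_mean.
pose L c w := expR (c * Z w - c ^+ 2 * V / 2).
have mL c : measurable_fun setT (L c).
  by apply: (measurableT_comp (@measurable_expR R)); apply: measurable_funB => //; apply: measurable_funM.
have mE : measurable_fun setT (fun w => expR (S w)) by exact: (measurableT_comp (@measurable_expR R)).
have L0 c w : 0 <= L c w by exact: expR_ge0.
have densQ c A : measurable A -> Pth (shift_drift theta i c phi) A = (\int[Pth theta]_(w in A) (L c w)%:E)%E.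
  move=> mA; rewrite (dens c A mA) integral_mkcond [RHS]integral_mkcond.
  transitivity (\int[Pth theta]_w (L c w * \1_A w)%:E)%E; last first.
    by apply: eq_integral => w _; rewrite patchE indicE; case: (w \in A); rewrite ?mulr1 ?mulr0.
  rewrite (ge0_integral_density mE (fun w => expR_ge0 _) dens0).
  - apply: eq_integral => w _; rewrite patchE indicE; case: (w \in A); rewrite ?mulr1 ?mulr0 ?mul0r//.
    by rewrite /L -expRD.
  - by apply: measurable_funM => //; exact: measurable_indic.
  - by move=> w; rewrite mulr_ge0.
(* The moment generating function of [Z] is the total mass of the shifted law. *)
have mgf c : (\int[Pth theta]_w (L c w)%:E = 1)%E.
  by rewrite -densQ//; exact: probability_setT.
have hf c : (Pth theta).-integrable setT (EFin \o (fun w => f w * L c w)) /\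
    (\int[Pth theta]_w (f w * L c w)%:E = (theta i t + c * phi t)%:E)%E.
  have hs := shift_drift_space H0 i c hth dphi RLp.
  have U := unb _ hs.
  have If : (Pth (shift_drift theta i c phi)).-integrable setT (EFin \o f).
    by apply: integrable_of_fin_integral => //; rewrite U.
  have [I1 I2] := integral_density (mL c) (L0 c) (@densQ c) If.
  by split => //; rewrite -I2 U /shift_drift eqxx.
have := chapman_robbins mZ mgf mf hf.
move=> CR; apply: (@le_trans _ _ ((2 * phi t - V)%:E + e%:E)%E).
  by rewrite -EFinD lee_fin; lra.
by rewrite leeD2r.
Qed.

(* The truncation at [n] makes the exponential Lipschitz, so that [B i t] can be
   replaced by the Gaussian variable [Y] attached to a test drift close to [K t]. *)
Let trunc_bound theta i t h (J : 'I_d -> {mfun Omega >-> R}) c (n : R) : drift_space H T theta -> 0 <= t <= T ->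
  (forall i, sqI (h i)) -> (forall i u, 0 <= u <= T -> dotI (K u) (h i) = theta i u) ->
  (forall i, wiener P T (W i) (h i) (J i)) ->
  (\int[P]_w (expR (Num.min (c * (B i t w - theta i t) + mean_of h (fun i => J i) w) n))%:E <=
    (expR (c ^+ 2 * t `^ (2 * H) / 2))%:E)%E.
Proof.
move=> hth tT sh Kh wJ; have /andP[t0 tT'] := tT.
apply/lee_addgt0Pr => e e0.
(* The test drift will be chosen with [|K_t - g|^2 <= 2 / k^2]. Then 3/2 bounds the mean of [|k U|]
   and [(N + 2) / 2] bounds [k |theta i t - m|], both by Young, so the total error is at most
   [C / k <= e]. *)
pose N := dotI (h i) (h i); pose C := expR n * `|c| * (3 / 2 + (N + 2) / 2).
have N0 : 0 <= N by exact: dotp_ge0.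
have C0 : 0 <= C by rewrite mulr_ge0 ?mulr_ge0 ?expR_ge0 ?normr_ge0//; lra.
pose k := C / e + 1.
have k0 : 0 < k by rewrite ltr_wpDl// divr_ge0// ltW.
have Ck : C / k <= e.
  rewrite ler_pdivrMr// /k mulrDr mulr1 mulrCA divff ?gt_eqF// mulr1 lerDl ltW//.
have eta0 : 0 < (k ^+ 2)^-1 by rewrite invr_gt0 exprn_gt0.
have [g [phi [sg Kg dphi RLp [Vle phige]]]] := test_function T0 H0 H1 KKL2 KKcov c0 t0 tT' eta0.
have tst : test g phi by [].
have [Y [wY dens]] := shift_rep i hth tst sh Kh wJ.
have [_ sY _] := wY; have [mY _] := sY.
have wB := WB i tT; have [_ sB _] := wB.
set V := dotI g g in Vle dens; set m := dotI (h i) g in dens.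
set S := mean_of h (fun i => J i).
have mS D : measurable_fun D S by exact: measurable_mean.
have sK := KKL2 tT.
have dist : dotI (fun x => K t x - g x) (fun x => K t x - g x) <= 2 / k ^+ 2.
  rewrite (dotpBB mI sK sg sK sg) (dotpC mu I g (K t)) Kg// KKnorm// -/V; lra.
have distU : dotP (fun w => 1 * B i t w + -1 * Y w) (fun w => 1 * B i t w + -1 * Y w) <= 2 / k ^+ 2.
  rewrite (wiener_iso (Wlaw i) (wiener_lin (Wlaw i) 1 (-1) wB wY)).
  have -> : (fun x => 1 * K t x + -1 * g x) = (fun x => K t x - g x) by apply/funext => x; ring.
  exact: dist.
set U := fun w => 1 * B i t w + -1 * Y w in distU.
have sU : sqP U by exact: sqint_lincomb2.
have skU := sqintZ mT k sU.
have PT : (P setT < +oo)%E by rewrite probability_setT ltry.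
have s1 : sqP (cst 1) := sqint_cst mT 1 PT.
have I1 : (\int[P]_w `|k * U w|%:E <= (3 / 2)%:E)%E.
  have := integral_norm_mul_le mT skU s1.
  have -> : dotP (cst 1) (cst 1) = 1.
    transitivity (\int[P]_(x in setT) cst 1 x); first by apply: eq_Rintegral => x _; rewrite mulr1.
    by rewrite Rintegral_cst// -[fine _]/(fine (P setT)) probability_setT mul1r.
  rewrite (dotpZl mT k sU skU) (dotpZr mT k sU sU) => h1.
  have -> : (\int[P]_w `|k * U w|%:E = \int[P]_w `|k * U w * cst 1 w|%:E)%E.
    by apply: eq_integral => w _; rewrite mulr1.
  apply: le_trans h1 _; rewrite lee_fin.
  have : k * (k * dotP U U) <= 2.
    by rewrite mulrA -expr2 mulrC -ler_pdivlMr// exprn_gt0.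
  lra.
have thm : `|theta i t - m| <= (N + 2) / 2 / k.
  have ki : 0 < k^-1 by rewrite invr_gt0.
  have := dotp_young mI ki (sh i) (sqintB mI sK sg).
  rewrite (dotpBr mI sK sg (sh i)) (dotpC mu I (h i) (K t)) Kh// -/m -/N invrK => h1.
  have h2 : k * dotI (fun x => K t x - g x) (fun x => K t x - g x) <= 2 / k.
    apply: (@le_trans _ _ (k * (2 / k ^+ 2))); first by rewrite ler_pM2l.
    by rewrite le_eqVlt; apply/orP; left; apply/eqP; field; rewrite gt_eqF.
  rewrite (_ : (N + 2) / 2 / k = 2^-1 * (k^-1 * N + 2 / k)); last by field; rewrite gt_eqF.
  by rewrite -(ler_pM2l (ltr0Sn R 1)) mulrA divff ?pnatr_eq0// mul1r; lra.
(* Again the mass 1 of the shifted law, now read under [P]. *)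
have gauss : (\int[P]_w (expR (c * (Y w - m) + S w))%:E = (expR (c ^+ 2 * V / 2))%:E)%E.
  have D1 := dens c setT mT.
  rewrite -[RHS]mule1 -(probability_setT (Pth (shift_drift theta i c phi))).
  rewrite -[X in (_ * X)%E]/(Pth (shift_drift theta i c phi) setT) D1 -ge0_integralZl_EFin ?expR_ge0//.
    by apply: eq_integral => w _; rewrite -EFinM -expRD; congr (expR _)%:E; rewrite /S; ring.
  apply/measurable_EFinP; apply: (measurableT_comp (@measurable_expR R)); apply: measurable_funD => //.
  by apply: measurable_funB => //; apply: measurable_funM => //; apply: measurable_funB.
pose b w := expR n * `|c| / k * `|k * U w|.
pose b0 := expR n * `|c| * `|theta i t - m|.
have mU : measurable_fun setT U by case: sU.
have mb : measurable_fun setT b.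
  by apply: measurable_funM => //; apply: measurableT_comp => //; apply: measurable_funM.
have b00 : 0 <= b0 by rewrite !mulr_ge0 ?expR_ge0.
have ck0 : 0 <= expR n * `|c| / k by apply: mulr_ge0; [apply: mulr_ge0; [exact: expR_ge0|exact: normr_ge0]|rewrite invr_ge0 ltW].
have b_ge0 w : 0 <= b w by rewrite mulr_ge0.
have mX' : measurable_fun setT (fun w => expR (c * (Y w - m) + S w)).
  apply: (measurableT_comp (@measurable_expR R)); apply: measurable_funD => //.
  by apply: measurable_funM => //; apply: measurable_funB.
have step : (\int[P]_w (expR (Num.min (c * (B i t w - theta i t) + S w) n))%:E <=
   \int[P]_w ((expR (c * (Y w - m) + S w))%:E + (b w + b0)%:E))%E.
  apply: ge0_le_integral => //.
  - apply/measurable_EFinP; apply: (measurableT_comp (@measurable_expR R)); apply: measurable_minr => //.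
    by apply: measurable_funD => //; apply: measurable_funM => //; apply: measurable_funB.
  - by apply: emeasurable_funD; apply/measurable_EFinP => //; apply: measurable_funD.
  - move=> w _; rewrite -EFinD lee_fin.
    apply: le_trans (expR_trunc_lip n _ (c * (Y w - m) + S w)) _.
    apply: lerD; first by rewrite ler_expR ge_min lexx.
    have -> : c * (B i t w - theta i t) + S w - (c * (Y w - m) + S w) = c * (U w - (theta i t - m)).
      by rewrite /U; ring.
    rewrite normrM /b /b0 normrM (ger0_norm (ltW k0)).
    have -> : expR n * `|c| / k * (k * `|U w|) + expR n * `|c| * `|theta i t - m| =
       expR n * (`|c| * (`|U w| + `|theta i t - m|)) by field; rewrite gt_eqF.
    by rewrite ler_wpM2l ?expR_ge0// ler_wpM2l// ler_normB.
apply: le_trans step _.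
rewrite ge0_integralD//; last 3 first.
- exact/measurable_EFinP.
- by move=> w _; rewrite lee_fin addr_ge0.
- by apply/measurable_EFinP; apply: measurable_funD.
rewrite gauss; apply: leeD; first by rewrite lee_fin ler_expR; have := sqr_ge0 c; nra.
have -> : (\int[P]_w (b w + b0)%:E = (expR n * `|c| / k)%:E * \int[P]_w `|k * U w|%:E + b0%:E)%E.
  under eq_integral do rewrite EFinD.
  rewrite ge0_integralD//; [|by move=> w _; rewrite lee_fin|exact/measurable_EFinP].
  have -> : (\int[P]_w b0%:E = b0%:E)%E.
    by rewrite -[RHS]mule1 -(probability_setT P) -integral_cst.
  congr (_ + _)%E.
  rewrite -ge0_integralZl_EFin//; last by apply/measurable_EFinP; apply: measurableT_comp => //; apply: measurable_funM.
apply: (@le_trans _ _ ((expR n * `|c| / k)%:E * (3 / 2)%:E + b0%:E)%E).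
  by rewrite leeD2r// lee_wpmul2l// lee_fin.
rewrite -EFinM -EFinD lee_fin; apply: le_trans Ck.
have h1 : b0 <= expR n * `|c| * ((N + 2) / 2 / k) by rewrite ler_wpM2l// mulr_ge0 ?expR_ge0.
rewrite /C; apply: le_trans (lerD (lexx _) h1) _.
by rewrite le_eqVlt; apply/orP; left; apply/eqP; field; rewrite gt_eqF.
Qed.

(** [trunc_bound] is uniform in the truncation level, so monotone convergence removes it. *)
Let B_mgf theta i t c : drift_space H T theta -> 0 <= t <= T ->
  (\int[Pth theta]_w (expR (c * (B i t w - theta i t)))%:E <=
    (expR (c ^+ 2 * t `^ (2 * H) / 2))%:E)%E.
Proof.
move=> hth tT; have [h [J [sh Kh wJ dens]]] := rep hth.
set S := mean_of h (fun i => J i) in dens.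
have mS : measurable_fun setT S by exact: measurable_mean.
have mE : measurable_fun setT (fun w => expR (S w)) by exact: (measurableT_comp (@measurable_expR R)).
pose Z w := c * (B i t w - theta i t).
have mZ : measurable_fun setT Z by apply: measurable_funM => //; apply: measurable_funB.
rewrite (ge0_integral_density mE (fun w => expR_ge0 _) dens (f := fun w => expR (Z w))); last 2 first.
- exact: (measurableT_comp (@measurable_expR R)).
- by move=> w; exact: expR_ge0.
pose g (n : nat) w := (expR (Num.min (Z w + S w) n%:R))%:E.
have -> : (\int[P]_w (expR (Z w) * expR (S w))%:E = \int[P]_w limn (g ^~ w))%E.
  apply: eq_integral => w _; rewrite -expRD; apply/esym/cvg_lim => //.
  apply: cvg_near_cst; exists (Num.truncn `|Z w + S w|).+1 => //= n hn; congr (expR _)%:E.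
  apply/min_idPl; apply: le_trans (ler_norm _) _; apply: ltW.
  apply: lt_le_trans (truncnS_gt _) _; by rewrite ler_nat.
rewrite monotone_convergence//.
- apply: lime_le.
    apply: ereal_nondecreasing_is_cvgn => a b ab; apply: ge0_le_integral => //.
    + by move=> w _; rewrite lee_fin expR_ge0.
    + by apply/measurable_EFinP; apply: (measurableT_comp (@measurable_expR R)); apply: measurable_minr => //; apply: measurable_funD.
    + by apply/measurable_EFinP; apply: (measurableT_comp (@measurable_expR R)); apply: measurable_minr => //; apply: measurable_funD.
    + move=> w _; rewrite lee_fin ler_expR le_min ge_min lexx/= ge_min ler_nat ab orbT//.
  by apply: nearW => n; exact: trunc_bound.
- by move=> n; apply/measurable_EFinP; apply: (measurableT_comp (@measurable_expR R)); apply: measurable_minr => //; apply: measurable_funD.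
- by move=> n w _; rewrite lee_fin expR_ge0.
- move=> w _ a b ab; rewrite lee_fin ler_expR le_min ge_min lexx/= ge_min ler_nat ab orbT//.
Qed.

Let mBt i t theta : measurable_fun setT (fun w => B i t w - theta i t).
Proof. by apply: measurable_funB. Qed.

Lemma B_unbiased theta i t : drift_space H T theta -> 0 <= t <= T ->
  (\int[Pth theta]_w (B i t w)%:E = (theta i t)%:E)%E.
Proof.
move=> hth tT; have mgf c := B_mgf i c hth tT.
have sZ := sub_gaussian_sqint (mBt i t theta) mgf.
have m0 := sub_gaussian_mean (mBt i t theta) mgf.
have QT : (Pth theta setT < +oo)%E by rewrite -[X in (X < _)%E]/(Pth theta setT) probability_setT ltry.
have iZ := sqint_integrable mT QT sZ.
have ic := finite_measure_integrable_cst (Pth theta) (theta i t) mT.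
have -> : (\int[Pth theta]_w (B i t w)%:E = \int[Pth theta]_w ((B i t w - theta i t)%:E + (cst (theta i t) w)%:E))%E.
  by apply: eq_integral => w _; rewrite -EFinD subrK.
rewrite integralD//.
have -> : (\int[Pth theta]_w (cst (theta i t) w)%:E = (theta i t)%:E)%E.
  by rewrite -[RHS]mule1 -(probability_setT (Pth theta)) -integral_cst.
have -> : (\int[Pth theta]_w (B i t w - theta i t)%:E = 0)%E.
  rewrite -[LHS]fineK; first by rewrite -[fine _]/(\int[Pth theta]_w (B i t w - theta i t))%R m0.
  exact: integrable_fin_num.
by rewrite add0e.
Qed.

Lemma B_variance theta i t : drift_space H T theta -> 0 <= t <= T ->
  (\int[Pth theta]_w ((B i t w - theta i t) ^+ 2)%:E = (t `^ (2 * H))%:E)%E.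
Proof.
move=> hth tT; have mgf c := B_mgf i c hth tT.
have sZ := sub_gaussian_sqint (mBt i t theta) mgf.
apply/eqP; rewrite eq_le; apply/andP; split.
  rewrite dotpEFin// lee_fin; exact: (sub_gaussian_variance (mBt i t theta) mgf).
apply: drift_lower_bound => //.
by move=> th hth'; exact: B_unbiased.
Qed.

(** Writing [theta i t] as [(K_t, h_i)] transfers the joint measurability of the kernel to the
    drift, as Tonelli requires for the risk. *)
Lemma measurable_drift (theta : 'I_d -> R -> R) (i : 'I_d) : drift_space H T theta -> measurable_fun I (theta i).
Proof.
move=> /rep[h [J [sh Kh _ _]]]; have [mh _] := sh i.
have mh' : measurable_fun setT (h i \_ I) by apply/(measurable_restrictT _ mI).
apply: (@eq_measurable_fun _ _ _ _ _ (fun t => \int[mu]_(s in I) (K t s * (h i \_ I) s))).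
  move=> t /set_mem; rewrite /= in_itv/= => tT; rewrite -Kh//; apply: eq_Rintegral => s sI.
  by rewrite patchE sI.
apply: measurable_funTS.
apply: (measurable_Rintegral_param_on (f := fun t s => K t s * (h i \_ I) s) mu mI).
apply: measurable_funM; first exact: measurable_KK.
exact: (measurableT_comp mh' measurable_snd).
Qed.

(** Reduces the risk to bounds at fixed time and component. Measurability in time is returned too,
    for the comparison of integrals over [t]. *)
Lemma risk_Tonelli theta (X : 'I_d -> R -> {mfun Omega >-> R}) : drift_space H T theta ->
  (forall i, measurable_process T (X i)) ->
  risk (Pth theta) T X theta =
    (\int[mu]_(t in I) \sum_(i < d) \int[Pth theta]_w ((X i t w - theta i t) ^+ 2)%:E)%E /\
  measurable_fun I (fun t => \sum_(i < d) \int[Pth theta]_w ((X i t w - theta i t) ^+ 2)%:E)%E.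
Proof.
move=> hth mX.
pose F (t : measurableTypeR R) (w : Omega) := \sum_(i < d) (X i t w - theta i t) ^+ 2.
have mF : measurable_fun (I `*` [set: Omega]) (fun p : measurableTypeR R * Omega => (F p.1 p.2)%:E).
  apply/measurable_EFinP; apply: measurable_sum => i; apply: measurable_funX.
  apply: measurable_funB; first exact: mX.
  apply: (measurable_comp (F := I) (f := theta i) mI).
  - by move=> _ [p [h _] <-].
  - exact: measurable_drift.
  - by apply: measurable_funTS; exact: measurable_fst.
have F0 t w : 0 <= F t w by apply: sumr_ge0 => i _; exact: sqr_ge0.
have sumE t : I t -> (\int[Pth theta]_w (F t w)%:E = \sum_(i < d) \int[Pth theta]_w ((X i t w - theta i t) ^+ 2)%:E)%E.
  move=> tI; under eq_integral do rewrite -sumEFin.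
  rewrite ge0_integral_sum//.
  - by move=> i; apply/measurable_EFinP; apply: measurable_funX; apply: measurable_funB.
  - by move=> i w _; rewrite lee_fin sqr_ge0.
split.
  rewrite /risk -(tonelli_rect mu (Pth theta) (f := fun t w => (F t w)%:E) mI mT mF); last first.
    by move=> t w _ _; rewrite lee_fin.
  by apply: eq_integral => t /set_mem; exact: sumE.
pose G (t : measurableTypeR R) (w : Omega) := ((fun p : measurableTypeR R * Omega => (F p.1 p.2)%:E) \_ (I `*` [set: Omega])) (t, w).
have mG : measurable_fun setT (fun p : measurableTypeR R * Omega => G p.1 p.2).
  rewrite (_ : (fun p => _) = (fun p : measurableTypeR R * Omega => (F p.1 p.2)%:E) \_ (I `*` [set: Omega])); last by apply/funext => -[].
  apply/(measurable_restrictT _ (measurableX mI mT)); exact: mF.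
have := measurable_integral_param (Pth theta) mG.
move=> /(measurable_funS measurableT (@subsetT _ I)); apply: eq_measurable_fun => t tI.
rewrite -sumE//; last exact: set_mem.
apply: eq_integral => w _; rewrite /G patchE mem_set//=; split => //; exact: set_mem.
Qed.

End Main.

Theorem theorem1 (R : realType) (dsp : measure_display)
    (Omega : measurableType dsp) (P : probability Omega R)
    (d : nat) (T H : R)
    (B W : 'I_d -> R -> {mfun Omega >-> R})
    (Pth : ('I_d -> R -> R) -> probability Omega R)
    (hd : (1 <= d)%N) (hT : 0 < T) (hH : 0 < H < 1 / 2)
    (hB : is_fbm P T H B)
    (hBmeas : forall i, measurable_process T (B i))
    (hW : is_bm P T W)
    (hBW : forall i (t : R), 0 <= t <= T ->
       is_wiener_integral P t (W i) (KH H t) (B i t))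
    (hPth : forall theta, drift_space H T theta ->
       is_drift_law P T H W theta (Pth theta)) :
  (forall xi : 'I_d -> R -> {mfun Omega >-> R},
     (forall i, measurable_process T (xi i)) ->
     unbiased T H Pth xi -> adapted T B xi ->
     forall theta, drift_space H T theta ->
       ((T `^ (2 * H + 1) / (2 * H + 1) * d%:R)%:E
          <= risk (Pth theta) T xi theta)%E) /\
  (forall theta, drift_space H T theta ->
     risk (Pth theta) T B theta
       = (T `^ (2 * H + 1) / (2 * H + 1) * d%:R)%:E).
Proof.
have /andP[H0 H1] := hH; pose i0 : 'I_d := Ordinal hd.
have sumd (x : R) : ((x * d%:R)%:E = \sum_(i < d) x%:E)%E.
  by rewrite sumEFin sumr_const card_ord mulr_natr.
have HH : 0 < 2 * H by lra.
rewrite -(integral_variance d hT HH); split.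
  move=> xi mxi unb _ theta hth.
  have [-> mS] := risk_Tonelli hT hW hPth hth mxi.
  apply: ge0_le_integral; first exact: measurable_itv.
  - by move=> t _; rewrite lee_fin mulr_ge0 ?powR_ge0.
  - apply/measurable_EFinP; apply: measurable_funM => //.
    by apply: measurable_funTS; exact: measurable_powR.
  - exact: mS.
  move=> t; rewrite /= in_itv/= => tT; rewrite sumd; apply: lee_sum => i _.
  apply: (drift_lower_bound hT H0 H1 hB hW hBW hPth i0 hth tT) => //.
  by move=> th hth'; have := unb th hth' t i tT; rewrite unlock.
move=> theta hth; have [-> _] := risk_Tonelli hT hW hPth hth hBmeas.
apply: eq_integral => t /set_mem; rewrite /= in_itv/= => tT; rewrite sumd; apply: eq_bigr => i _.
exact: (B_variance hT H0 H1 hB hW hBW hPth i0 i hth tT).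
Qed.
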